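(* Let $\Bbbk$ be an algebraically closed field with $\operatorname{char}\Bbbk=p>2$. With the Hopf superalgebras $\mathbf R$, $\mathcal D$ and $\mathfrak u(\mathfrak{osp}(1|2))$ defined in the context, there exist Hopf superalgebra maps $\iota$ and $\pi$ such that $$\mathbf R\xrightarrow{\ \iota\ }\mathcal D\xrightarrow{\ \pi\ }\mathfrak u(\mathfrak{osp}(1|2))$$ is an exact sequence of Hopf superalgebras.
   Context: $\mathcal D$ is the Hopf superalgebra generated by odd $x_1,x_2,u_1,u_2$ and even $g,\zeta$ with relations (writing $x_{21}=x_2x_1+x_1x_2$, $u_{21}=u_1u_2+u_2u_1$): $x_1^2=0$, $x_2x_{21}=x_{21}x_2+x_1x_{21}$, $x_{21}^p=0$, $x_2^{2p}=0$, $u_1^2=0$, $u_2u_{21}=u_{21}u_2+u_1u_{21}$, $u_{21}^p=0$, $u_2^{2p}=0$, $\zeta^p=\zeta$, $g^p=1$, $\zeta g=g\zeta$, $\zeta x_i=x_i\zeta+x_i$, $u_i\zeta=\zeta u_i+u_i$ ($i=1,2$), $gx_1=x_1g$, $gx_2=(x_2-x_1)g$, $u_1g=gu_1$, $u_2g=gu_2-gu_1$, $u_1x_1=-x_1u_1$, $u_1x_2=-x_2u_1+(1-g)$, $u_2x_1=-x_1u_2+(1-g)+x_1u_1$, $u_2x_2=-x_2u_2+g\zeta+x_2u_1$. Comultiplication: $g$ group-like, $\zeta,u_1$ primitive, $\Delta(x_i)=x_i\otimes1+g\otimes x_i$, $\Delta(u_2)=u_2\otimes1+1\otimes u_2-\zeta\otimes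 u_1$. $\mathbf R=\Bbbk[X_1,X_2,T]/(X_1^p,X_2^p,T^p-1)\otimes\Lambda(Y_1,Y_2)$ is the super commutative Hopf superalgebra ($\Lambda$ = exterior algebra) with $X_1,X_2,T$ even, $Y_1,Y_2$ odd, and $\Delta(X_1)=X_1\otimes1+T^2\otimes X_1+Y_1T\otimes Y_1$, $\Delta(T)=T\otimes T$, $\Delta(X_2)=X_2\otimes1+1\otimes X_2+Y_2\otimes Y_2$, $\Delta(Y_2)=Y_2\otimes1+1\otimes Y_2$, $\Delta(Y_1)=Y_1\otimes1+T\otimes Y_1$. $\mathfrak{osp}(1|2)=\mathfrak g_0\oplus\mathfrak g_1$ is the Lie superalgebra with $\mathfrak g_0=\mathfrak{sl}_2(\Bbbk)$ with Cartan generators $e,f,h$, $\mathfrak g_1$ with basis $\psi_+,\psi_-$, and $[e,\psi_+]=0$, $[h,\psi_+]=\psi_+$, $[f,\psi_+]=\psi_-$, $[e,\psi_-]=\psi_+$, $[h,\psi_-]=-\psi_-$, $[f,\psi_-]=0$, $[\psi_+,\psi_+]=2e$, $[\psi_-,\psi_-]=-2f$, $[\psi_+,\psi_-]=-h$; its $p$-structure is $e^{[p]}=0$, $h^{[p]}=h$, $f^{[p]}=0$. The restricted enveloping algebra is $\mathfrak u(\mathfrak g)=U(\mathfrak g)/\langle x^{[p]}-x^p:x\in\mathfrak g_0\rangle$, with elements of $\mathfrak g$ primitive. A sequence of Hopf superalgebra maps $A\xrightarrow{\iota}C\xrightarrow{\pi}B$ is exact if $\iota$ is injective, $\pi$ surjective,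 $\ker\pi=C\iota(A)^+$ and $\iota(A)=C^{\mathrm{co}\,\pi}=\{c:(\mathrm{id}\otimes\pi)\Delta(c)=c\otimes1\}$, where $A^+=\ker\varepsilon$. *)

(* Defs.v *)
From HB Require Import structures.
From mathcomp Require Import all_boot all_algebra.
From mathcomp Require Import finmap boolp.
From mathcomp Require Import monalg.

Set Implicit Arguments.
Unset Strict Implicit.
Unset Printing Implicit Defensive.

Import GRing.Theory.
Import Quotient.Exports.

Local Open Scope ring_scope.
Local Open Scope quotient_scope.

Reserved Notation "v ⊗ w" (at level 40, left associativity).

(* V ⊗ W is the quotient of the free vector space {malg k[V * W]} on the set
   V * W by the subspace spanned by the bilinearity relations. *)
Section Tensor.
Variables (k : fieldType) (V W : lmodType k).

Definition tens_free := {malg k[(V * W)%type]}.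

Inductive bilin : tens_free -> Prop :=
| bilin_0 : bilin 0
| bilin_D f g : bilin f -> bilin g -> bilin (f + g)
| bilin_Z a f : bilin f -> bilin (a *: f)
| bilin_Dl v1 v2 w : bilin (<< (v1 + v2, w) >> - << (v1, w) >> - << (v2, w) >>)
| bilin_Dr v w1 w2 : bilin (<< (v, w1 + w2) >> - << (v, w1) >> - << (v, w2) >>)
| bilin_Zl a v w : bilin (<< (a *: v, w) >> - a *: << (v, w) >>)
| bilin_Zr a v w : bilin (<< (v, a *: w) >> - a *: << (v, w) >>).

Definition bilinb := [pred f : tens_free | `[< bilin f >]].

Lemma bilinb_zmod_closed : zmod_closed bilinb.
Proof.
split=> [|f g]; rewrite !unfold_in; first by apply/asboolP; constructor.
move=> /asboolP Hf /asboolP Hg; apply/asboolP/bilin_D => //.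
by rewrite -scaleN1r; apply: bilin_Z.
Qed.

HB.instance Definition _ :=
  GRing.isZmodClosed.Build tens_free bilinb bilinb_zmod_closed.

Definition tensor := @Quotient.quot tens_free bilinb.

HB.instance Definition _ := Choice.on tensor.
HB.instance Definition _ := GRing.Zmodule.on tensor.
HB.instance Definition _ := EqQuotient.on tensor.

Lemma tensor_eqP (f g : tens_free) :
  reflect (bilin (f - g)) (\pi_tensor f == \pi_tensor g).
Proof. by rewrite -Quotient.idealrBE unfold_in; apply: asboolP. Qed.

Lemma tpiD : {morph \pi_tensor : f g / f + g}.
Proof. by move=> f g; rewrite !piE. Qed.

Definition tscale (a : k) (t : tensor) : tensor := \pi_tensor (a *: repr t).

Lemma tscale_pi a f : tscale a (\pi_tensor f) = \pi_tensor (a *: f).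
Proof.
apply/eqP/tensor_eqP; rewrite -scalerBr; apply: bilin_Z.
by apply/tensor_eqP; rewrite reprK.
Qed.

Lemma tscaleA a b t : tscale a (tscale b t) = tscale (a * b) t.
Proof. by elim/quotW: t => t; rewrite (tscale_pi b) !tscale_pi scalerA. Qed.
Lemma tscale1 : left_id 1 tscale.
Proof. by elim/quotW => t; rewrite tscale_pi scale1r. Qed.
Lemma tscaleDr : right_distributive tscale +%R.
Proof.
move=> a; elim/quotW => s; elim/quotW => t.
by rewrite -tpiD !tscale_pi -tpiD scalerDr.
Qed.
Lemma tscaleDl t : {morph tscale^~ t : a b / a + b}.
Proof. by move=> a b; elim/quotW: t => t; rewrite !tscale_pi -tpiD scalerDl. Qed.

HB.instance Definition _ := GRing.Zmodule_isLmodule.Build k tensor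
  tscaleA tscale1 tscaleDr tscaleDl.

Definition tens (v : V) (w : W) : tensor := \pi_tensor << (v, w) >>.

End Tensor.

Arguments tens {k V W}.
Notation "v ⊗ w" := (tens v w) : ring_scope.

(* For bilinear f : V -> W -> Z, tlift f is the linear map V ⊗ W -> Z with
   v ⊗ w |-> f v w (lemmas tlift_linear and tliftE below). *)
Definition tlift (k : fieldType) (V W Z : lmodType k) (f : V -> W -> Z)
    (t : tensor V W) : Z :=
  let r : {malg k[(V * W)%type]} := repr t in
  \sum_(x <- msupp r) r@_x *: f x.1 x.2.

Section Lift.
Variables (k : fieldType) (V W Z : lmodType k) (f : V -> W -> Z).
Hypothesis fl : forall w, linear (f^~ w).
Hypothesis fr : forall v, linear (f v).

Let ev (r : {malg k[(V * W)%type]}) : Z := \sum_(x <- msupp r) r@_x *: f x.1 x.2.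

Let evw (d : {fset (V * W)%type}) r : (msupp r `<=` d)%fset ->
  ev r = \sum_(x <- d) r@_x *: f x.1 x.2.
Proof.
move=> le; rewrite /ev (big_fset_incl _ le) // => x _ /mcoeff_outdom ->.
by rewrite scale0r.
Qed.

Let ev_linear : linear ev.
Proof.
move=> a r s; pose d := (msupp r `|` msupp s `|` msupp (a *: r + s))%fset.
rewrite !(@evw d) ?fsubsetUr //; last 2 first.
- exact: fsubset_trans (fsubsetUr _ _) (fsubsetUl _ _).
- exact: fsubset_trans (fsubsetUl _ _) (fsubsetUl _ _).
rewrite scaler_sumr -big_split /=; apply: eq_bigr => x _.
by rewrite mcoeffD mcoeffZ scalerDl scalerA.
Qed.

Let linB (U1 U2 : lmodType k) (h : U1 -> U2) : linear h ->
  {morph h : x y / x - y}.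
Proof. by move=> hl x y; rewrite addrC -!scaleN1r hl addrC. Qed.
Let linZ (U1 U2 : lmodType k) (h : U1 -> U2) : linear h ->
  forall a, {morph h : x / a *: x}.
Proof.
move=> hl a x; have h0 : h 0 = 0 by rewrite -{1}(subrr 0) (linB hl) subrr.
by rewrite -[a *: x]addr0 hl h0 addr0.
Qed.
Let linD (U1 U2 : lmodType k) (h : U1 -> U2) : linear h ->
  {morph h : x y / x + y}.
Proof. by move=> hl x y; rewrite -[x]scale1r hl !scale1r. Qed.

Let evU v w : ev << (v, w) >> = f v w.
Proof. by rewrite /ev msuppU oner_eq0 big_seq_fset1 mcoeffUU scale1r. Qed.

Let ev_bilin r : bilin r -> ev r = 0.
Proof.
have evB := linB ev_linear; have evZ := linZ ev_linear.
elim=> [|g h _ Hg _ Hh|a g _ Hg|v1 v2 w|v w1 w2|a v w|a v w].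
- by rewrite -(subrr 0) evB subrr.
- by rewrite (linD ev_linear) Hg Hh addr0.
- by rewrite evZ Hg scaler0.
- by rewrite !evB !evU (linD (fl w)) addrAC addrK subrr.
- by rewrite !evB !evU (linD (fr v)) addrAC addrK subrr.
- by rewrite evB evZ !evU (linZ (fl w)) subrr.
- by rewrite evB evZ !evU (linZ (fr v)) subrr.
Qed.

Let tlift_pi r : tlift f (\pi_(tensor V W) r) = ev r.
Proof.
apply/eqP; rewrite -subr_eq0 -[tlift _ _]/(ev _) -(linB ev_linear) ev_bilin //.
by apply/tensor_eqP; rewrite reprK.
Qed.

Lemma tliftE v w : tlift f (v ⊗ w) = f v w.
Proof. by rewrite tlift_pi evU. Qed.

Lemma tlift_linear : linear (tlift f).
Proof.
move=> a; elim/quotW => s; elim/quotW => t.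
by rewrite -[a *: _]/(tscale a _) tscale_pi -tpiD !tlift_pi ev_linear.
Qed.

End Lift.

Definition tmap (k : fieldType) (V W V' W' : lmodType k)
    (f : V -> V') (g : W -> W') : tensor V W -> tensor V' W' :=
  tlift (fun v w => f v ⊗ g w).

Definition tassoc (k : fieldType) (V W X : lmodType k) :
    tensor (tensor V W) X -> tensor V (tensor W X) :=
  tlift (fun t x => tlift (fun v w => v ⊗ (w ⊗ x)) t).

(* sproj i is the projection of A = A_0 ⊕ A_1 onto A_i; degrees in Z/2 are
   Booleans, with true for odd, and addb for addition. *)
HB.mixin Record isSuperAlgebra (k : fieldType) A of GRing.Algebra k A := {
  sproj : bool -> A -> A;
  sproj_linear : forall i, linear (sproj i);
  sproj_proj : forall i j a,
    sproj i (sproj j a) = if i == j then sproj j a else 0;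
  sproj_sum : forall a, sproj false a + sproj true a = a;
  sproj1 : sproj false 1 = 1;
  sprojM : forall i j a b,
    sproj (i (+) j) (sproj i a * sproj j b) = sproj i a * sproj j b
}.

#[short(type="superAlgType")]
HB.structure Definition SuperAlgebra (k : fieldType) :=
  {A of GRing.Algebra k A & isSuperAlgebra k A}.

Definition homog (k : fieldType) (A : superAlgType k) (i : bool) (a : A) :=
  sproj i a = a.

Section SuperTensor.
Variables (k : fieldType) (A : superAlgType k).

(* (a ⊗ b)(c ⊗ d) = (-1)^(|b||c|) ac ⊗ bd for homogeneous b and c. *)
Definition smul (s t : tensor A A) : tensor A A :=
  tlift (fun a b => tlift (fun c d =>
    \sum_(i : bool) \sum_(j : bool)
      (-1) ^+ (i && j) *: ((a * sproj j c) ⊗ (sproj i b * d))) t) s.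

Definition tproj (i : bool) (t : tensor A A) : tensor A A :=
  \sum_(j : bool) tmap (sproj j) (sproj (i (+) j)) t.

End SuperTensor.

HB.mixin Record isHopfSuperAlgebra (k : fieldType) A of SuperAlgebra k A := {
  comul : A -> tensor A A;
  counit : A -> k;
  antipode : A -> A;
  comul_linear : linear comul;
  comul_even : forall i a, comul (sproj i a) = tproj i (comul a);
  comul1 : comul 1 = 1 ⊗ 1;
  comulM : forall a b, comul (a * b) = smul (comul a) (comul b);
  counit_linear : scalar counit;
  counit_even : forall a, counit (sproj true a) = 0;
  counit1 : counit 1 = 1;
  counitM : forall a b, counit (a * b) = counit a * counit b;
  antipode_linear : linear antipode;
  antipode_even : forall i a, antipode (sproj i a) = sproj i (antipode a);
  comulA : forall a,
    tassoc (tmap comul id (comul a)) = tmap id comul (comul a);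
  counitl : forall a, tlift (fun b c => counit b *: c) (comul a) = a;
  counitr : forall a, tlift (fun b c => counit c *: b) (comul a) = a;
  antipodel : forall a,
    tlift (fun b c => antipode b * c) (comul a) = counit a *: 1;
  antipoder : forall a,
    tlift (fun b c => b * antipode c) (comul a) = counit a *: 1
}.

#[short(type="hopfSuperAlgType")]
HB.structure Definition HopfSuperAlgebra (k : fieldType) :=
  {A of SuperAlgebra k A & isHopfSuperAlgebra k A}.

Definition hopf_morphism (k : fieldType) (A B : hopfSuperAlgType k)
    (f : {lrmorphism A -> B}) :=
  [/\ forall i a, f (sproj i a) = sproj i (f a),
      forall a, comul (f a) = tmap f f (comul a),
      forall a, counit (f a) = counit a
    & forall a, antipode (f a) = f (antipode a)].

(* C · iota(A)^+ is the span of the products c * iota a with counit a = 0. *)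
Definition in_augmentation_ideal (k : fieldType) (A C : hopfSuperAlgType k)
    (iota : A -> C) (c : C) :=
  exists s : seq (C * A), all (fun x => counit x.2 == 0) s /\
    c = \sum_(x <- s) x.1 * iota x.2.

Definition hopf_exact (k : fieldType) (A C B : hopfSuperAlgType k)
    (iota : A -> C) (pi : C -> B) :=
  [/\ injective iota,
      forall b, exists c, pi c = b,
      forall c, pi c = 0 <-> in_augmentation_ideal iota c
    & forall c, (exists a, iota a = c) <-> tmap id pi (comul c) = c ⊗ 1].

Notation "{ 'free' k [ I ] }" := {malg k[{fmonom I}]}
  (at level 0, k, I at level 2, format "{ 'free'  k [ I ] }") : type_scope.

Definition gen (k : fieldType) (I : choiceType) (i : I) : {free k[I]} :=
  << fmu i >>.

Definition free_eval (k : fieldType) (I : choiceType) (A : algType k)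
    (x : I -> A) (f : {free k[I]}) : A :=
  \sum_(m <- msupp f) f@_m *: \prod_(i <- (m : seq I)) x i.

Inductive ideal_gen (F : nzRingType) (rel : F -> Prop) : F -> Prop :=
| ideal_gen0 : ideal_gen rel 0
| ideal_genD f g : ideal_gen rel f -> ideal_gen rel g -> ideal_gen rel (f + g)
| ideal_genM f r g : rel r -> ideal_gen rel (f * r * g).

(* A is the superalgebra presented by the generators x i, of parity par i, and
   the relations r = 0 for r in rel: the morphism k<I> -> A defined by x is
   surjective and its kernel is the two-sided ideal generated by rel. *)
Definition presented_by (k : fieldType) (I : choiceType) (par : I -> bool)
    (rel : {free k[I]} -> Prop) (A : superAlgType k) (x : I -> A) :=
  [/\ forall i, homog (par i) (x i),
      forall a, exists f, free_eval x f = a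
    & forall f, free_eval x f = 0 <-> ideal_gen rel f].

Inductive D_gen := Dx1 | Dx2 | Du1 | Du2 | Dg | Dzeta.

Definition D_gen_code (i : D_gen) : nat :=
  match i with Dx1 => 0 | Dx2 => 1 | Du1 => 2 | Du2 => 3 | Dg => 4 | Dzeta => 5
  end.
Definition D_gen_decode (n : nat) : D_gen :=
  nth Dx1 [:: Dx1; Dx2; Du1; Du2; Dg; Dzeta] n.
Lemma D_gen_codeK : cancel D_gen_code D_gen_decode. Proof. by case. Qed.
HB.instance Definition _ := Countable.copy D_gen (can_type D_gen_codeK).

Definition D_par (i : D_gen) : bool :=
  match i with Dg | Dzeta => false | _ => true end.

(* Each element l - r of the list stands for the relation l = r. *)
Definition D_rels (k : fieldType) (p : nat) : seq {free k[D_gen]} :=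
  let x1 := gen k Dx1 in let x2 := gen k Dx2 in
  let u1 := gen k Du1 in let u2 := gen k Du2 in
  let g := gen k Dg in let zeta := gen k Dzeta in
  let x21 := x2 * x1 + x1 * x2 in let u21 := u1 * u2 + u2 * u1 in
  [:: x1 ^+ 2;
      x2 * x21 - (x21 * x2 + x1 * x21);
      x21 ^+ p;
      x2 ^+ (2 * p);
      u1 ^+ 2;
      u2 * u21 - (u21 * u2 + u1 * u21);
      u21 ^+ p;
      u2 ^+ (2 * p);
      zeta ^+ p - zeta;
      g ^+ p - 1;
      zeta * g - g * zeta;
      zeta * x1 - (x1 * zeta + x1);
      zeta * x2 - (x2 * zeta + x2);
      u1 * zeta - (zeta * u1 + u1);
      u2 * zeta - (zeta * u2 + u2);
      g * x1 - x1 * g;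
      g * x2 - (x2 - x1) * g;
      u1 * g - g * u1;
      u2 * g - (g * u2 - g * u1);
      u1 * x1 - (- (x1 * u1));
      u1 * x2 - (- (x2 * u1) + (1 - g));
      u2 * x1 - (- (x1 * u2) + (1 - g) + x1 * u1);
      u2 * x2 - (- (x2 * u2) + g * zeta + x2 * u1) ].

Definition is_D (k : fieldType) (p : nat) (D : hopfSuperAlgType k)
    (x : D_gen -> D) :=
  presented_by D_par (fun r => r \in D_rels k p) x /\
  let x1 := x Dx1 in let x2 := x Dx2 in let u1 := x Du1 in let u2 := x Du2 in
  let g := x Dg in let zeta := x Dzeta in
  [/\ comul g = g ⊗ g,
      comul zeta = zeta ⊗ 1 + 1 ⊗ zeta,
      comul u1 = u1 ⊗ 1 + 1 ⊗ u1
    & [/\ comul x1 = x1 ⊗ 1 + g ⊗ x1,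
          comul x2 = x2 ⊗ 1 + g ⊗ x2
        & comul u2 = u2 ⊗ 1 + 1 ⊗ u2 - zeta ⊗ u1]].

Inductive R_gen := RX1 | RX2 | RT | RY1 | RY2.

Definition R_gen_code (i : R_gen) : nat :=
  match i with RX1 => 0 | RX2 => 1 | RT => 2 | RY1 => 3 | RY2 => 4 end.
Definition R_gen_decode (n : nat) : R_gen :=
  nth RX1 [:: RX1; RX2; RT; RY1; RY2] n.
Lemma R_gen_codeK : cancel R_gen_code R_gen_decode. Proof. by case. Qed.
HB.instance Definition _ := Countable.copy R_gen (can_type R_gen_codeK).

Definition R_par (i : R_gen) : bool :=
  match i with RY1 | RY2 => true | _ => false end.

(* k[X1,X2,T]/(X1^p, X2^p, T^p - 1) ⊗ Λ(Y1,Y2); the first constructor says that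
   the X's and T are central, and the squares of the Y's vanish separately from
   their anticommutation. *)
Inductive R_rel (k : fieldType) (p : nat) : {free k[R_gen]} -> Prop :=
| R_rel_comm i j : ~~ R_par i ->
    R_rel p (gen k i * gen k j - gen k j * gen k i)
| R_rel_X1 : R_rel p (gen k RX1 ^+ p)
| R_rel_X2 : R_rel p (gen k RX2 ^+ p)
| R_rel_T : R_rel p (gen k RT ^+ p - 1)
| R_rel_Y1 : R_rel p (gen k RY1 ^+ 2)
| R_rel_Y2 : R_rel p (gen k RY2 ^+ 2)
| R_rel_Y12 : R_rel p (gen k RY1 * gen k RY2 + gen k RY2 * gen k RY1).

Definition is_R (k : fieldType) (p : nat) (R : hopfSuperAlgType k)
    (x : R_gen -> R) :=
  presented_by R_par (@R_rel k p) x /\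
  let X1 := x RX1 in let X2 := x RX2 in let T := x RT in
  let Y1 := x RY1 in let Y2 := x RY2 in
  [/\ comul X1 = X1 ⊗ 1 + (T ^+ 2) ⊗ X1 + (Y1 * T) ⊗ Y1,
      comul T = T ⊗ T,
      comul X2 = X2 ⊗ 1 + 1 ⊗ X2 + Y2 ⊗ Y2,
      comul Y2 = Y2 ⊗ 1 + 1 ⊗ Y2
    & comul Y1 = Y1 ⊗ 1 + T ⊗ Y1].

Inductive osp_gen := Oe | Of | Oh | Op | Om.

Definition osp_gen_code (i : osp_gen) : nat :=
  match i with Oe => 0 | Of => 1 | Oh => 2 | Op => 3 | Om => 4 end.
Definition osp_gen_decode (n : nat) : osp_gen :=
  nth Oe [:: Oe; Of; Oh; Op; Om] n.
Lemma osp_gen_codeK : cancel osp_gen_code osp_gen_decode. Proof. by case. Qed.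
HB.instance Definition _ := Countable.copy osp_gen (can_type osp_gen_codeK).
Lemma osp_gen_enumP : Finite.axiom [:: Oe; Of; Oh; Op; Om].
Proof. by case. Qed.
HB.instance Definition _ := isFinite.Build osp_gen osp_gen_enumP.

Definition osp_par (i : osp_gen) : bool :=
  match i with Op | Om => true | _ => false end.

Section Osp.
Variable k : fieldType.

(* osp(1|2), in coordinates in the basis e, f, h, psi_+, psi_- *)
Definition osp := {ffun osp_gen -> k^o}.

Definition osp_basis (i : osp_gen) : osp := [ffun j => (j == i)%:R].

Definition osp_homog (i : bool) (x : osp) :=
  forall j, x j != 0 -> osp_par j = i.

Definition osp_bracket_basis (i j : osp_gen) : osp :=
  let e := osp_basis Oe in let f := osp_basis Of in let h := osp_basis Oh in
  let psip := osp_basis Op in let psim := osp_basis Om in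
  match i, j with
  | Oe, Of => h          | Of, Oe => - h
  | Oh, Oe => 2 *: e     | Oe, Oh => - (2 *: e)
  | Oh, Of => - (2 *: f) | Of, Oh => 2 *: f
  | Oe, Op => 0          | Op, Oe => 0
  | Oh, Op => psip       | Op, Oh => - psip
  | Of, Op => psim       | Op, Of => - psim
  | Oe, Om => psip       | Om, Oe => - psip
  | Oh, Om => - psim     | Om, Oh => psim
  | Of, Om => 0          | Om, Of => 0
  | Op, Op => 2 *: e
  | Om, Om => - (2 *: f)
  | Op, Om => - h        | Om, Op => - h
  | Oe, Oe | Of, Of | Oh, Oh => 0
  end.

Definition osp_bracket (x y : osp) : osp :=
  \sum_i \sum_j (x i * y j) *: osp_bracket_basis i j.

(* The p-structure of osp(1|2)_0 = sl_2 is the p-th power of traceless 2 x 2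
   matrices; it is determined by its values on e, f and h, see osp_pmapE. *)
Definition sl2_mx (x : osp) : 'M[k]_2 :=
  x Oe *: delta_mx 0 1 + x Of *: delta_mx 1 0
  + x Oh *: (delta_mx 0 0 - delta_mx 1 1).

Definition osp_pmap (p : nat) (x : osp) : osp :=
  let M := sl2_mx x ^+ p in
  M 0 1 *: osp_basis Oe + M 1 0 *: osp_basis Of + M 0 0 *: osp_basis Oh.

Lemma osp_pmapE (p : nat) : odd p -> (2 < p)%N ->
  [/\ osp_pmap p (osp_basis Oe) = 0, osp_pmap p (osp_basis Of) = 0
    & osp_pmap p (osp_basis Oh) = osp_basis Oh].
Proof.
move=> p_odd p_gt2.
have sq0 i j : i != j -> (delta_mx i j : 'M[k]_2) ^+ p = 0.
  move=> ij; rewrite -(subnKC (ltnW p_gt2)) exprD expr2.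
  have -> : delta_mx i j * delta_mx i j = 0 :> 'M[k]_2.
    by apply: mul_delta_mx_0; rewrite eq_sym.
  by rewrite mul0r.
have h2 : (delta_mx 0 0 - delta_mx 1 1 : 'M[k]_2) ^+ 2 = 1.
  apply/matrixP=> i j; rewrite expr2 -mulmxE !mxE !big_ord_recl big_ord0 !mxE.
  by case: i => [[|[|[]]] ?] //; case: j => [[|[|[]]] ?] //=;
    rewrite ?(subr0, sub0r, mulr0, mul0r, addr0, add0r, mulrNN, mulr1).
have eM : sl2_mx (osp_basis Oe) = delta_mx 0 1.
  by rewrite /sl2_mx !ffunE /= scale1r !scale0r !addr0.
have fM : sl2_mx (osp_basis Of) = delta_mx 1 0.
  by rewrite /sl2_mx !ffunE /= scale1r !scale0r addr0 add0r.
have hM : sl2_mx (osp_basis Oh) = delta_mx 0 0 - delta_mx 1 1.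
  by rewrite /sl2_mx !ffunE /= scale1r !scale0r !add0r.
split; rewrite /osp_pmap ?eM ?fM ?sq0 // ?mxE ?scale0r ?addr0 //.
rewrite hM -(odd_double_half p) p_odd -mul2n exprD exprM h2 expr1n mulr1 expr1.
by rewrite !mxE /= !subr0 !scale0r !add0r scale1r.
Qed.

(* The free algebra on the basis of osp(1|2) is its tensor algebra, and osp_free
   is the inclusion of osp(1|2) into it. *)
Definition osp_free (x : osp) : {free k[osp_gen]} := \sum_i x i *: gen k i.

Inductive u_osp_rel (p : nat) : {free k[osp_gen]} -> Prop :=
| u_osp_rel_bracket i j x y : osp_homog i x -> osp_homog j y ->
    u_osp_rel p (osp_free x * osp_free y
      - (-1) ^+ (i && j) *: (osp_free y * osp_free x)
      - osp_free (osp_bracket x y))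
| u_osp_rel_pmap x : osp_homog false x ->
    u_osp_rel p (osp_free (osp_pmap p x) - osp_free x ^+ p).

End Osp.

Definition is_u_osp (k : fieldType) (p : nat) (U : hopfSuperAlgType k)
    (x : osp_gen -> U) :=
  presented_by osp_par (@u_osp_rel k p) x /\
  forall i, comul (x i) = x i ⊗ 1 + 1 ⊗ x i.

(* Main.v *)
Require Import Defs.
From HB Require Import structures.
From mathcomp Require Import all_boot all_algebra.
From mathcomp Require Import finmap boolp monalg.
From mathcomp Require Import ring.

Set Implicit Arguments.
Unset Strict Implicit.
Unset Printing Implicit Defensive.

Import GRing.Theory.
Import Quotient.Exports.
Local Open Scope ring_scope.
Local Open Scope quotient_scope.

(** Why the sequence is exact.

    Both maps come from presentations: [R] and [D] are given by generators and
    relations, so a morphism is a choice of images that satisfies the relations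
    ([presented_lift]). The embedding is
      [X_1 |-> x_21, X_2 |-> - u_21, T |-> g, Y_1 |-> x_1, Y_2 |-> u_1],
    and the projection kills [x_1] and [u_1], sends [g] to 1, [x_2] to [psi_+],
    [u_2] to [- psi_-] and [zeta] to [h] ([iota_exists], [pi_exists]). They
    respect coproducts and counits because they do so on generators
    ([hopf_morphism_gen], [comul_x21], [comul_u21]); a morphism of bialgebras
    commutes with the antipodes ([antipode_morph]).

    The difficulty is that a presentation says when elements vanish but not when
    they are independent. No basis of [R], [D] or [U] is known beforehand, and
    independence is extracted from two small representations. A functional [phi]
    on a Hopf superalgebra acts on it by [a |-> a_1 phi(a_2)] ([hit]); when [phi] is
    a matrix entry of a representation, this operator is computable on words
    ([hitM_skew]), and [iota r = 0] implies that [iota] kills the transform of [r]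
    when [phi] factors through [iota] ([hit_morph]).

    - Injectivity of [iota]. The natural representation of osp(1|2) deforms to a
      representation of [D] over the dual numbers ([def_rep]). Restricted to [R],
      it is [counit + eps delta], where [delta] sends the five generators to the
      elements of a basis of osp(1|2). Suitable entries of [delta] therefore give
      one operator on [R] for each generator, acting like a partial derivative and
      preserving the kernel of [iota] ([derivation_exists]). As [R] is spanned by
      the obvious monomials ([span_R_all]) and their exponents are less than [p],
      differentiating an element of the kernel brings its coefficients into the
      kernel ([powers_elim]), down to scalars, whence they all vanish
      ([iota_injective]).

    - A basis. [D] is spanned by the words [x_2^l u_2^j zeta^i], with
      [l, j < 2p] and [i < p], with coefficients in [iota R] on the left
      ([pbw_span]): the commutators of the three letters with [iota R] lie in
      [iota R] ([iota_comm]). The images of these words in [U] are linearly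
      independent, by the operators attached to the natural representation of
      osp(1|2) ([pbw_free], from [x_layer], [y_layer] and [h_layer]).

    - The kernel of [pi]. As [pi (iota r)] is the counit of [r], an element of the
      kernel has coefficients in [R^+] by independence; and [R^+ D] lies in
      [D R^+], again by [iota_comm] ([ker_pi]).

    - Coinvariants. Let [w] be a longest word whose coefficient [r] in a
      coinvariant [c] is nonzero, and [phi] the coordinate on [U] at [pi w]. By
      [hit_word], [phi] sends [c] to [r g^l], as it vanishes on all the proper
      subwords that the coproducts of the words of [c] produce; but it sends a
      coinvariant to [phi(1) c]. Hence [w] is empty and [c] lies in [iota R]
      ([coinv_iota]). *)

(** * Tensor products and linear maps *)

Section LinearPred.
Variables (k : fieldType) (U V : lmodType k) (f : U -> V).
Hypothesis fl : linear f.
Lemma linD : {morph f : x y / x + y}.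
Proof. by move=> x y; rewrite -[x]scale1r fl !scale1r. Qed.
Lemma lin0 : f 0 = 0.
Proof. by apply: (addrI (f 0)); rewrite -linD !addr0. Qed.
Lemma linZ a : {morph f : x / a *: x}.
Proof. by move=> x; rewrite -[a *: x]addr0 fl lin0 addr0. Qed.
Lemma linN : {morph f : x / - x}.
Proof. by move=> x; rewrite -scaleN1r linZ scaleN1r. Qed.
Lemma linB : {morph f : x y / x - y}.
Proof. by move=> x y; rewrite linD linN. Qed.
Lemma lin_sum I (r : seq I) P (F : I -> U) :
  f (\sum_(i <- r | P i) F i) = \sum_(i <- r | P i) f (F i).
Proof. exact: (big_morph f linD lin0). Qed.
End LinearPred.

Section TensorTheory.
Variables (k : fieldType) (V W : lmodType k).
Implicit Types (v : V) (w : W).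

Lemma tscaleE a (t : tensor V W) : tscale a t = a *: t. Proof. by []. Qed.

Lemma tensDl v1 v2 w : (v1 + v2) ⊗ w = v1 ⊗ w + v2 ⊗ w.
Proof.
rewrite /tens -tpiD; apply/eqP/tensor_eqP.
by rewrite opprD addrA; apply: bilin_Dl.
Qed.
Lemma tensDr v w1 w2 : v ⊗ (w1 + w2) = v ⊗ w1 + v ⊗ w2.
Proof.
rewrite /tens -tpiD; apply/eqP/tensor_eqP.
by rewrite opprD addrA; apply: bilin_Dr.
Qed.
Lemma tensZl a v w : (a *: v) ⊗ w = a *: (v ⊗ w).
Proof.
rewrite /tens -[RHS]/(tscale _ _) tscale_pi; apply/eqP/tensor_eqP.
exact: bilin_Zl.
Qed.
Lemma tensZr a v w : v ⊗ (a *: w) = a *: (v ⊗ w).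
Proof.
rewrite /tens -[RHS]/(tscale _ _) tscale_pi; apply/eqP/tensor_eqP.
exact: bilin_Zr.
Qed.
Lemma tens_linl w : linear (fun v : V => v ⊗ w).
Proof. by move=> a x y; rewrite tensDl tensZl. Qed.
Lemma tens_linr v : linear (fun w : W => v ⊗ w).
Proof. by move=> a x y; rewrite tensDr tensZr. Qed.
Lemma tens0l w : (0 : V) ⊗ w = 0.
Proof. exact: lin0 (tens_linl w). Qed.
Lemma tens0r v : v ⊗ (0 : W) = 0.
Proof. exact: lin0 (tens_linr v). Qed.

Lemma tens_ind (P : tensor V W -> Prop) :
  P 0 -> (forall v w, P (v ⊗ w)) -> (forall s t, P s -> P t -> P (s + t)) ->
  forall t, P t.
Proof.
move=> P0 Pt PD; elim/quotW => r; rewrite (monalgE r).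
elim: (enum_fset (msupp r)) => [|x s IH].
  rewrite big_nil; suff -> : \pi_(tensor V W) 0 = 0 by [].
  by apply: (addrI (\pi_(tensor V W) 0)); rewrite -tpiD !addr0.
rewrite big_cons tpiD; apply: PD => //.
have -> : << r@_x *g x >> = r@_x *: << x >> :> tens_free V W.
  apply/malgP=> y; rewrite mcoeffZ !mcoeffU.
  by case: eqP => _; rewrite ?mulr1n ?mulr0n ?mulr1 ?mulr0.
rewrite -tscale_pi tscaleE.
have -> : \pi_(tensor V W) << x >> = x.1 ⊗ x.2 by case: x.
by rewrite -tensZl.
Qed.

Lemma tens_ext (Z : lmodType k) (f g : tensor V W -> Z) :
  linear f -> linear g -> (forall v w, f (v ⊗ w) = g (v ⊗ w)) -> f =1 g.
Proof.
move=> fl gl fg; apply: tens_ind => // [|s t es et].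
  by rewrite (lin0 fl) (lin0 gl).
by rewrite (linD fl) (linD gl) es et.
Qed.

End TensorTheory.

Section TensorMaps.
Variables (k : fieldType).

Lemma tmap_bil (V W V' W' : lmodType k) (f : V -> V') (g : W -> W') :
  linear f -> linear g ->
  (forall w, linear (fun v => f v ⊗ g w)) * (forall v, linear (fun w => f v ⊗ g w)).
Proof.
by move=> fl gl; split=> z a x y; rewrite ?fl ?gl ?tensDl ?tensDr ?tensZl ?tensZr.
Qed.

Lemma tmap_linear (V W V' W' : lmodType k) (f : V -> V') (g : W -> W') :
  linear f -> linear g -> linear (tmap f g).
Proof. by move=> fl gl; have [Hl Hr] := tmap_bil fl gl; apply: tlift_linear. Qed.

Lemma tmapE (V W V' W' : lmodType k) (f : V -> V') (g : W -> W') v w :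
  linear f -> linear g -> tmap f g (v ⊗ w) = f v ⊗ g w.
Proof. by move=> fl gl; have [Hl Hr] := tmap_bil fl gl; rewrite /tmap tliftE. Qed.

End TensorMaps.

(** * Superalgebras given by generators and relations *)

Section FreeEval.
Variables (k : fieldType) (I : choiceType) (A : algType k) (x : I -> A).

Let wordval (m : {fmonom I}) : A := \prod_(i <- (m : seq I)) x i.

Let wordval_mmorphism : mmorphism wordval.
Proof.
by split=> [m n|]; rewrite /wordval ?fm1 ?big_nil // fmM big_cat.
Qed.

HB.instance Definition _ := isMultiplicative.Build _ _ wordval wordval_mmorphism.

Let free_evalE : free_eval x =1 mmap (in_alg A) wordval.
Proof. by move=> f; apply: eq_bigr => m _; rewrite mulr_algl. Qed.

Lemma free_eval_linear : linear (free_eval x).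
Proof.
move=> a f g; rewrite !free_evalE mmapD mmapZ; congr (_ + _).
by rewrite mulr_algl.
Qed.

Lemma free_eval_multiplicative : multiplicative (free_eval x).
Proof.
have [|HM H1] := commr_mmap_is_multiplicative (f := in_alg A) (h := wordval).
  by move=> f m m'; rewrite /GRing.comm mulr_algl mulr_algr.
by split=> [f g|]; rewrite !free_evalE.
Qed.

Lemma free_eval_gen i : free_eval x (gen k i) = x i.
Proof. by rewrite free_evalE /gen mmapU mulr_algl scale1r /wordval fmU big_seq1. Qed.

Lemma free_evalM f g : free_eval x (f * g) = free_eval x f * free_eval x g.
Proof. by case: free_eval_multiplicative => ->. Qed.
Lemma free_eval1 : free_eval x 1 = 1.
Proof. by case: free_eval_multiplicative => _ ->. Qed.
Definition free_evalD := linD free_eval_linear.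
Definition free_evalB := linB free_eval_linear.
Definition free_evalN := linN free_eval_linear.
Definition free_evalZ := linZ free_eval_linear.
Definition free_eval0 := lin0 free_eval_linear.

Lemma free_evalX f n : free_eval x (f ^+ n) = free_eval x f ^+ n.
Proof.
elim: n => [|n IH]; first exact: free_eval1.
by rewrite !exprS free_evalM IH.
Qed.

Lemma free_eval_ideal (rel : {free k[I]} -> Prop) f :
  (forall r, rel r -> free_eval x r = 0) -> ideal_gen rel f ->
  free_eval x f = 0.
Proof.
move=> rel0; elim=> [|g h _ Hg _ Hh|g r h /rel0 Hr]; first exact: free_eval0.
  by rewrite free_evalD Hg Hh addr0.
by rewrite !free_evalM Hr mulr0 mul0r.
Qed.

End FreeEval.

(** Ring expressions, so that one expression can be evaluated both in the free
    algebra and in an algebra with given generators. *)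
Inductive ring_expr (I : Type) :=
| Gen of I | One | Opp of ring_expr I
| Add of ring_expr I & ring_expr I | Mul of ring_expr I & ring_expr I
| Exp of ring_expr I & nat.
Arguments One {I}.

Fixpoint expr_eval (I : Type) (A : nzRingType) (x : I -> A) (e : ring_expr I) : A :=
  match e with
  | Gen i => x i
  | One => 1
  | Opp e => - expr_eval x e
  | Add e f => expr_eval x e + expr_eval x f
  | Mul e f => expr_eval x e * expr_eval x f
  | Exp e n => expr_eval x e ^+ n
  end.

Lemma free_eval_expr (k : fieldType) (I : choiceType) (A : algType k)
    (x : I -> A) (e : ring_expr I) :
  free_eval x (expr_eval (@gen k I) e) = expr_eval x e.
Proof.
elim: e => [i||e IH|e IHe f IHf|e IHe f IHf|e IH n] /=.
- exact: free_eval_gen.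
- exact: free_eval1.
- by rewrite free_evalN IH.
- by rewrite free_evalD IHe IHf.
- by rewrite free_evalM IHe IHf.
- by rewrite free_evalX IH.
Qed.

Section BasicRelations.
Variables (k : fieldType) (I : choiceType) (A : algType k) (x : I -> A).

Lemma free_eval_comm i j :
  free_eval x (gen k i * gen k j - gen k j * gen k i) = x i * x j - x j * x i.
Proof.
exact: (free_eval_expr x
  (Add (Mul (Gen i) (Gen j)) (Opp (Mul (Gen j) (Gen i))))).
Qed.

Lemma free_eval_anticomm i j :
  free_eval x (gen k i * gen k j + gen k j * gen k i) = x i * x j + x j * x i.
Proof.
exact: (free_eval_expr x (Add (Mul (Gen i) (Gen j)) (Mul (Gen j) (Gen i)))).
Qed.

Lemma free_eval_expB1 i n : free_eval x (gen k i ^+ n - 1) = x i ^+ n - 1.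
Proof. exact: (free_eval_expr x (Add (Exp (Gen i) n) (Opp One))). Qed.

End BasicRelations.

Section Presented.
Variables (k : fieldType) (I : choiceType) (par : I -> bool).
Variables (rel : {free k[I]} -> Prop) (A : superAlgType k) (x : I -> A).
Hypothesis A_pres : presented_by par rel x.

Lemma presented_rel r : rel r -> free_eval x r = 0.
Proof.
case: A_pres => _ _ H Hr; apply/H.
rewrite -[r]add0r; apply: ideal_genD; first by constructor.
by rewrite -[r]mul1r -[_ * r]mulr1; constructor.
Qed.

Lemma presented_ind (P : A -> Prop) :
  P 0 -> (forall a b, P a -> P b -> P (a + b)) -> (forall c a, P a -> P (c *: a)) ->
  P 1 -> (forall i a, P a -> P (x i * a)) -> forall a, P a.
Proof.
move=> P0 PD PZ P1 PM a; have [_ /(_ a)[f <-] _] := A_pres.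
apply: (big_ind P) => // m _; apply: PZ.
elim: (m : seq I) => [|i s IH]; first by rewrite big_nil.
by rewrite big_cons; apply: PM.
Qed.

Lemma presented_indr (P : A -> Prop) :
  P 0 -> (forall a b, P a -> P b -> P (a + b)) -> (forall c a, P a -> P (c *: a)) ->
  P 1 -> (forall i a, P a -> P (a * x i)) -> forall a, P a.
Proof.
move=> P0 PD PZ P1 PM a; have [_ /(_ a)[f <-] _] := A_pres.
apply: (big_ind P) => // m _; apply: PZ.
elim/last_ind: (m : seq I) => [|s i IH]; first by rewrite big_nil.
by rewrite -cats1 big_cat big_seq1; apply: PM.
Qed.

(** A chosen preimage in the free algebra is well defined up to the ideal of the
    relations, on which evaluation at [y] vanishes. *)
Lemma presented_lift (B : algType k) (y : I -> B) :
  (forall r, rel r -> free_eval y r = 0) ->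
  exists f : {lrmorphism A -> B}, forall i, f (x i) = y i.
Proof.
move=> rel0; have [_ surj ker] := A_pres.
pose pre a := projT1 (cid (surj a)).
have preK a : free_eval x (pre a) = a by rewrite /pre; case: cid.
have wd f : free_eval y (pre (free_eval x f)) = free_eval y f.
  apply/eqP; rewrite -subr_eq0 -free_evalB; apply/eqP.
  by apply: (free_eval_ideal rel0); apply/ker; rewrite free_evalB preK subrr.
pose h a := free_eval y (pre a).
have hl : linear h.
  move=> c a b; rewrite /h -{1}(preK a) -{1}(preK b) -free_eval_linear wd.
  exact: free_eval_linear.
have hm : multiplicative h.
  split=> [a b|]; last first.
    by rewrite /h; have := wd 1; rewrite !free_eval1.
  rewrite /h -{1}(preK a) -{1}(preK b) -free_evalM wd.
  exact: free_evalM.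
pose H1 := GRing.isLinear.Build k A B *:%R h hl.
pose H2 := GRing.isMultiplicative.Build A B h hm.
pose F : {lrmorphism A -> B} := HB.pack h H1 H2.
by exists F => i; rewrite /F /= /h -(free_eval_gen x) wd free_eval_gen.
Qed.

End Presented.

(** The sign that an element picks up when it moves past one of degree [i];
    [sgn true] is the parity automorphism. *)
HB.lock Definition sgn (k : fieldType) (A : superAlgType k) (i : bool) (a : A) :=
  sproj false a + (-1) ^+ i *: sproj true a.

Section SuperAlgebraTheory.
Variables (k : fieldType) (A : superAlgType k).
Implicit Types (a b c : A) (i j : bool).

HB.instance Definition _ i :=
  GRing.isLinear.Build k A A *:%R (@sproj k A i) (@sproj_linear k A i).

Lemma sproj_homog i a : homog i (sproj i a).
Proof. by rewrite /homog sproj_proj eqxx. Qed.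

Lemma homogP i j a : homog i a -> sproj j a = if j == i then a else 0.
Proof. by move=> <-; rewrite sproj_proj. Qed.

Lemma homog1 : homog false (1 : A). Proof. exact: sproj1. Qed.

Lemma homogM i j a b : homog i a -> homog j b -> homog (i (+) j) (a * b).
Proof. by move=> <- <-; rewrite /homog sprojM. Qed.

Lemma homogD i a b : homog i a -> homog i b -> homog i (a + b).
Proof. by rewrite /homog linearD /= => -> ->. Qed.

Lemma homogN i a : homog i a -> homog i (- a).
Proof. by rewrite /homog linearN /= => ->. Qed.

Lemma homogX a n : homog false a -> homog false (a ^+ n).
Proof.
move=> ha; elim: n => [|n IH]; first exact: homog1.
by rewrite exprS; apply: (homogM ha IH).
Qed.

Lemma sproj_mull i j a b : homog i a -> sproj j (a * b) = a * sproj (i (+) j) b.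
Proof.
move=> ha; rewrite -{1}(sproj_sum b) mulrDr linearD /=.
rewrite !(homogP _ (homogM ha (sproj_homog _ _))).
by case: i j {ha} => [] [] /=; rewrite ?addr0 ?add0r.
Qed.

Lemma sgn_linear i : linear (sgn i : A -> A).
Proof.
by move=> z a b; rewrite sgn.unlock !linearP /= !scalerDr addrACA.
Qed.
HB.instance Definition _ i :=
  GRing.isLinear.Build k A A *:%R (sgn i : A -> A) (@sgn_linear i).

Lemma sgn_even a : sgn false a = a.
Proof. by rewrite sgn.unlock scale1r sproj_sum. Qed.

Lemma sgn_homog i j a : homog j a -> sgn i a = (-1) ^+ (i && j) *: a.
Proof.
rewrite sgn.unlock => ha; rewrite !(homogP _ ha); case: j {ha} => /=.
  by rewrite add0r andbT.
by rewrite scaler0 addr0 andbF scale1r.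
Qed.

Lemma sgn_homog0 i a : homog false a -> sgn i a = a.
Proof. by move=> /(sgn_homog i) ->; rewrite andbF scale1r. Qed.

Lemma sgn_homog1 a : homog true a -> sgn true a = - a.
Proof. by move=> /(sgn_homog true) ->; rewrite scaleN1r. Qed.

Lemma sgn1 i : sgn i (1 : A) = 1. Proof. exact: sgn_homog0 homog1. Qed.

Lemma sgnM i a b : sgn i (a * b) = sgn i a * sgn i b.
Proof.
rewrite -(sproj_sum a) -(sproj_sum b) [in RHS]linearD [X in _ = _ * X]linearD /=.
rewrite !(sgn_homog _ (sproj_homog _ _)) !mulrDl !mulrDr !linearD /=.
rewrite !(sgn_homog _ (homogM (sproj_homog _ _) (sproj_homog _ _))).
rewrite -!scalerAl -!scalerAr !scalerA -!signr_addb.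
by case: i.
Qed.

Lemma sgnK i : involutive (sgn i : A -> A).
Proof.
move=> a; rewrite -{1}(sproj_sum a) !linearD /= !(sgn_homog _ (sproj_homog _ _)).
rewrite !linearZ /= !(sgn_homog _ (sproj_homog _ _)) !scalerA -!signr_addb.
by rewrite !addbb !scale1r sproj_sum.
Qed.

End SuperAlgebraTheory.

(** * Multiplication and contraction of tensors *)

Section TliftTheory.
Variables (k : fieldType) (V W Z : lmodType k).

(** [tlift f t] is linear in [f] too, whence maps of several variables can be
    lifted one tensor at a time. *)
Lemma tlift_lin a (f g h : V -> W -> Z) t :
  (forall v w, h v w = a *: f v w + g v w) ->
  tlift h t = a *: tlift f t + tlift g t.
Proof.
move=> E; rewrite /tlift /= scaler_sumr -big_split /=; apply: eq_bigr => x _.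
by rewrite E scalerDr !scalerA mulrC.
Qed.

Lemma eq_tlift (f g : V -> W -> Z) t : (forall v w, f v w = g v w) ->
  tlift f t = tlift g t.
Proof. by move=> E; apply: eq_bigr => x _; rewrite E. Qed.

Lemma tlift0 (f : V -> W -> Z) t : (forall v w, f v w = 0) -> tlift f t = 0.
Proof. by move=> E; rewrite /tlift /= big1 // => x _; rewrite E scaler0. Qed.

Lemma tlift_comp (Z' : lmodType k) (h : Z -> Z') (f : V -> W -> Z) t :
  linear h -> tlift (fun v w => h (f v w)) t = h (tlift f t).
Proof.
by move=> hl; rewrite /tlift (lin_sum hl); apply: eq_bigr => x _; rewrite (linZ hl).
Qed.

End TliftTheory.

Lemma tlift_tmap (k : fieldType) (V W Z V' W' : lmodType k)
    (f : V -> W -> Z) (a : V' -> V) (b : W' -> W) t :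
  (forall w, linear (f^~ w)) -> (forall v, linear (f v)) ->
  linear a -> linear b ->
  tlift f (tmap a b t) = tlift (fun v w => f (a v) (b w)) t.
Proof.
move=> fl fr al bl.
have cl : linear (tlift f) by apply: tlift_linear.
rewrite -(tlift_comp _ _ cl); apply: eq_tlift => v w.
by rewrite tliftE.
Qed.

Lemma tens_ext3 (k : fieldType) (V W X Z : lmodType k)
    (f g : tensor (tensor V W) X -> Z) : linear f -> linear g ->
  (forall v w x, f (v ⊗ w ⊗ x) = g (v ⊗ w ⊗ x)) -> f =1 g.
Proof.
move=> fl gl fg; apply: (tens_ext fl gl) => t x.
elim/tens_ind: t => [|v w|s t Hs Ht]; [|exact: fg|].
  by rewrite tens0l (lin0 fl) (lin0 gl).
rewrite tensDl (linD fl) (linD gl); exact: (congr2 +%R Hs Ht).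
Qed.

Section Tassoc.
Variables (k : fieldType) (V W X : lmodType k).

Let inner (x : X) (t : tensor V W) : tensor V (tensor W X) :=
  tlift (fun v w => v ⊗ (w ⊗ x)) t.

Let inner_bil (x : X) : (forall w : W, linear (fun v : V => v ⊗ (w ⊗ x))) *
  (forall v : V, linear (fun w : W => v ⊗ (w ⊗ x))).
Proof. by split=> e z u v; rewrite ?tens_linl ?tens_linr. Qed.

Let outer_bil : (forall x, linear (inner x)) * (forall t, linear (inner^~ t)).
Proof.
split=> [x|t z x y]; first by have [H1 H2] := inner_bil x; apply: tlift_linear.
by apply: tlift_lin => v w; rewrite !tens_linr.
Qed.

Lemma tassoc_linear : linear (@tassoc k V W X).
Proof.
have [H1 H2] := outer_bil => z s t.
exact: (@tlift_linear _ _ _ _ (fun t x => inner x t) H1 H2 z s t).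
Qed.

Lemma tassocE (v : V) (w : W) (x : X) : tassoc (v ⊗ w ⊗ x) = v ⊗ (w ⊗ x).
Proof.
have [H1 H2] := outer_bil; have [H3 H4] := inner_bil x.
apply: (etrans (@tliftE _ _ _ _ (fun t x => inner x t) H1 H2 (v ⊗ w) x)).
exact: (@tliftE _ _ _ _ (fun v w => v ⊗ (w ⊗ x)) H3 H4 v w).
Qed.

End Tassoc.

Local Opaque tlift.

Section Contraction.
Variables (k : fieldType) (V W : lmodType k).

Definition contract (phi : W -> k) : tensor V W -> V :=
  tlift (fun v w => phi w *: v).

Variable phi : W -> k.
Hypothesis phi_lin : scalar phi.

Lemma contract_bil :
  (forall w, linear (fun v : V => phi w *: v)) *
  (forall v : V, linear (fun w => phi w *: v)).
Proof.
split=> [w a x y|v a x y]; first by rewrite scalerDr !scalerA mulrC.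
by rewrite phi_lin scalerDl scalerA.
Qed.

Lemma contract_linear : linear (contract phi).
Proof. by have [Hl Hr] := contract_bil; apply: tlift_linear. Qed.

Lemma contractE v w : contract phi (v ⊗ w) = phi w *: v.
Proof. by have [Hl Hr] := contract_bil; rewrite /contract tliftE. Qed.

Lemma eq_contract psi t : phi =1 psi -> contract phi t = contract psi t.
Proof. by move=> E; apply: eq_tlift => v w; rewrite E. Qed.

End Contraction.

(** In a Koszul-signed product only the odd part of [c] sees the parity of [b];
    bilinearity of the tensor product is all that the computation needs. *)
Lemma koszul_sum (k : fieldType) (A : superAlgType k) (Z : lmodType k)
    (T : A -> A -> Z) (a b c d : A) :
  (forall w, linear (T^~ w)) -> (forall v, linear (T v)) ->
  \sum_(i : bool) \sum_(j : bool)
    (-1) ^+ (i && j) *: T (a * sproj j c) (sproj i b * d) =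
  T (a * sproj false c) (b * d) + T (a * sproj true c) (sgn true b * d).
Proof.
move=> Tl Tr; rewrite !big_bool /= !expr0 !scale1r sgn.unlock expr1 !scaleN1r.
rewrite addrACA addrC -(linD (Tr _)) -mulrDl [sproj true b + _]addrC sproj_sum.
by rewrite mulrDl mulNr (linD (Tr _)) (linN (Tr _)) [- _ + _]addrC.
Qed.

Section Smul.
Variables (k : fieldType) (A : superAlgType k).
Implicit Types (a b c d : A) (s t : tensor A A).

Let core a b c d : tensor A A := \sum_(i : bool) \sum_(j : bool)
  (-1) ^+ (i && j) *: ((a * sproj j c) ⊗ (sproj i b * d)).

Let coreE a b c d : core a b c d =
  a * sproj false c ⊗ (b * d) + a * sproj true c ⊗ (sgn true b * d).
Proof. exact: (koszul_sum a b c d (@tens_linl k A A) (@tens_linr k A A)). Qed.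

Let core1 b c d : linear (fun a => core a b c d).
Proof. by move=> z x y; rewrite !coreE !mulrDl -!scalerAl !tens_linl scalerDr addrACA. Qed.
Let core2 a c d : linear (fun b => core a b c d).
Proof.
by move=> z x y; rewrite !coreE linearP !mulrDl -!scalerAl !tens_linr scalerDr addrACA.
Qed.
Let core3 a b d : linear (fun c => core a b c d).
Proof.
by move=> z x y; rewrite !coreE !linearP /= !mulrDr -!scalerAr !tens_linl scalerDr addrACA.
Qed.
Let core4 a b c : linear (fun d => core a b c d).
Proof.
by move=> z x y; rewrite !coreE !mulrDr -!scalerAr !tens_linr scalerDr addrACA.
Qed.

Let inner_bil t : (forall b, linear (fun a => tlift (core a b) t)) *
  (forall a, linear (fun b => tlift (core a b) t)).
Proof. by split=> e z x y; apply: tlift_lin => v w; rewrite ?core1 ?core2. Qed.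

Lemma smul_linl t : linear (@smul k A ^~ t).
Proof.
have [H1 H2] := inner_bil t; move=> z x y.
exact: (@tlift_linear _ _ _ _ (fun a b => tlift (core a b) t) H1 H2 z x y).
Qed.

Lemma smul_linr s : linear (@smul k A s).
Proof.
move=> z x y; apply: tlift_lin => v w.
exact: (@tlift_linear _ _ _ _ (core v w) (core3 v w) (core4 v w) z x y).
Qed.

Lemma smulE a b c d : smul (a ⊗ b) (c ⊗ d) =
  a * sproj false c ⊗ (b * d) + a * sproj true c ⊗ (sgn true b * d).
Proof.
have [H1 H2] := inner_bil (c ⊗ d).
rewrite -coreE.
apply: (etrans (@tliftE _ _ _ _ (fun a b => tlift (core a b) (c ⊗ d)) H1 H2 a b)).
exact: (@tliftE _ _ _ _ (core a b) (core3 a b) (core4 a b) c d).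
Qed.

Lemma smulE_homog i a b c d : homog i b ->
  smul (a ⊗ b) (c ⊗ d) = (a * sgn i c) ⊗ (b * d).
Proof.
move=> hb; rewrite smulE (sgn_homog true hb) sgn.unlock mulrDr tensDl.
by rewrite -scalerAl tensZr -scalerAr tensZl; case: i {hb}.
Qed.

(** The sign of moving [b] past the first factor of [t] becomes [sgn i] on what is left
    of [t] after contraction. *)
Lemma contract_smul i a b t (phi : A -> k) : scalar phi -> homog i b ->
  contract phi (smul (a ⊗ b) t) = a * sgn i (contract (fun d => phi (b * d)) t).
Proof.
move=> pl hb.
have pl' : scalar (fun d => phi (b * d)).
  by move=> z x y; rewrite mulrDr -scalerAr pl.
elim/tens_ind: t => [|c d|s t Hs Ht].
- rewrite (lin0 (smul_linr _)) (lin0 (contract_linear pl)).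
  by rewrite (lin0 (contract_linear pl')) linear0 mulr0.
- by rewrite (smulE_homog _ _ _ hb) !contractE // linearZ /= scalerAr.
rewrite (linD (smul_linr (a ⊗ b)) s t).
rewrite (linD (contract_linear pl) (smul (a ⊗ b) s)).
apply: etrans (congr2 +%R Hs Ht) _.
rewrite (linD (contract_linear pl') s t).
by rewrite linearD mulrDr.
Qed.

End Smul.

(** * Hopf superalgebras and the action of functionals *)

Section HopfTheory.
Variables (k : fieldType) (A : hopfSuperAlgType k).

HB.instance Definition _ :=
  GRing.isLinear.Build k A (tensor A A) *:%R (@comul k A) (@comul_linear k A).
HB.instance Definition _ :=
  GRing.isLinear.Build k A k *%R (@counit k A) (@counit_linear k A).
HB.instance Definition _ :=
  GRing.isLinear.Build k A A *:%R (@antipode k A) (@antipode_linear k A).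

Lemma counit_sgn i (a : A) : counit (sgn i a) = counit a.
Proof.
rewrite sgn.unlock -{3}(sproj_sum a) !linearD linearZ /= !counit_even.
by rewrite mulr0.
Qed.

Lemma counit_odd (a : A) : homog true a -> counit a = 0.
Proof. by move=> <-; rewrite counit_even. Qed.

Lemma scal1_inj (z : k) : z *: (1 : A) = 0 -> z = 0.
Proof. by move/eqP; rewrite scaler_eq0 oner_eq0 orbF => /eqP. Qed.

Let counit_bil : (forall w : A, linear (fun v : A => counit v *: w)) *
  (forall v : A, linear (fun w : A => counit v *: w)).
Proof.
split=> [w a u v|v a u w]; first by rewrite linearP scalerDl scalerA.
by rewrite scalerDr !scalerA mulrC.
Qed.

(** The counit axiom on the left reads [x = counit x *: 1 + x]. *)
Lemma counit_skew2 (g x b c : A) : comul x = x ⊗ 1 + g ⊗ x + b ⊗ c ->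
  counit g = 1 -> counit b = 0 -> counit x = 0.
Proof.
move=> cx cg cb; have := counitl x; rewrite cx; have [Hl Hr] := counit_bil.
rewrite !(linD (tlift_linear Hl Hr)) !tliftE // cg cb scale1r scale0r addr0.
by move/(canRL (addrK _)); rewrite subrr => /scal1_inj.
Qed.

Lemma counit_skew (g x : A) : comul x = x ⊗ 1 + g ⊗ x -> counit g = 1 ->
  counit x = 0.
Proof.
move=> cx cg; apply: (@counit_skew2 g x 0 0); rewrite ?linear0 //.
by rewrite tens0l addr0.
Qed.

(** The counit axiom reads [g = counit g *: g], and [g] is invertible. *)
Lemma counit_grouplike (g : A) n : comul g = g ⊗ g -> g ^+ n.+1 = 1 ->
  counit g = 1.
Proof.
move=> cg gn; have := counitl g; rewrite cg; have [Hl Hr] := counit_bil.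
rewrite tliftE // => cgg; have /eqP : (counit g - 1) *: g = 0.
  by rewrite scalerBl cgg scale1r subrr.
rewrite scaler_eq0 subr_eq0 => /orP[/eqP //|/eqP g0].
by move/eqP: gn; rewrite g0 expr0n eq_sym oner_eq0.
Qed.

Lemma contract_counitr (a : A) : contract counit (comul a) = a.
Proof. exact: counitr. Qed.

End HopfTheory.

(** [a |-> a_1 phi(a_2)], the action of the dual algebra on [A]. Unlike [phi] itself,
    this operator can be iterated and combined with multiplications. *)
HB.lock Definition hit (k : fieldType) (A : hopfSuperAlgType k) (phi : A -> k)
  (a : A) : A := contract phi (comul a).

Section Hit.
Variables (k : fieldType) (A : hopfSuperAlgType k).
Implicit Types (phi psi : A -> k) (a b x r : A).

Lemma hit_linear phi : scalar phi -> linear (hit phi).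
Proof. by move=> pl z x y; rewrite hit.unlock comul_linear (contract_linear pl). Qed.

Lemma eq_hit phi psi a : phi =1 psi -> hit phi a = hit psi a.
Proof. by move=> E; rewrite hit.unlock; apply: eq_contract. Qed.

Lemma hit_comb z phi psi (chi : A -> k) a : (forall b, chi b = z * phi b + psi b) ->
  hit chi a = z *: hit phi a + hit psi a.
Proof.
move=> E; rewrite hit.unlock; apply: tlift_lin => v w.
by rewrite E scalerDl scalerA.
Qed.

Lemma hit1 phi : scalar phi -> hit phi 1 = phi 1 *: 1.
Proof. by move=> pl; rewrite hit.unlock comul1 contractE. Qed.

Lemma hit_counit a : hit counit a = a.
Proof. by rewrite hit.unlock; apply: counitr. Qed.

Lemma hit0 a : hit (fun=> 0) a = 0.
Proof. by rewrite hit.unlock; apply: tlift0 => v w; rewrite scale0r. Qed.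

Let hit_smul phi i a b r : scalar phi -> homog i b ->
  contract phi (smul (a ⊗ b) (comul r)) = a * sgn i (hit (fun d => phi (b * d)) r).
Proof. by move=> pl hb; rewrite (contract_smul _ _ pl hb) hit.unlock. Qed.

Let hit_smul1 phi a r : scalar phi ->
  contract phi (smul (a ⊗ 1) (comul r)) = a * hit phi r.
Proof.
move=> pl; rewrite (hit_smul _ _ pl (homog1 A)) sgn_even; congr (_ * _).
by apply: eq_hit => d; rewrite mul1r.
Qed.

Let contract_smulD phi s t u : scalar phi ->
  contract phi (smul (s + t) u) = contract phi (smul s u) + contract phi (smul t u) :> A.
Proof. by move=> pl; rewrite (linD (smul_linl _)) (linD (contract_linear pl)). Qed.

Lemma hit_sum I (r : seq I) (c : I -> k) (phi : I -> A -> k) a :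
  hit (fun d => \sum_(i <- r) c i * phi i d) a = \sum_(i <- r) c i *: hit (phi i) a.
Proof.
elim: r => [|i r IH].
  by rewrite big_nil -[RHS](hit0 a); apply: eq_hit => d; rewrite big_nil.
rewrite big_cons -IH; apply: hit_comb => d.
by rewrite big_cons.
Qed.

(** Since [comul] is multiplicative, [hit phi] can be computed on a product letter
    by letter, at the cost of replacing [phi] by its translates
    [d |-> phi (b * d)]. *)
Lemma hitM1 phi i a b x r : scalar phi -> homog i b -> comul x = a ⊗ b ->
  hit phi (x * r) = a * sgn i (hit (fun d => phi (b * d)) r).
Proof.
move=> pl hb cx; rewrite {1}hit.unlock comulM cx.
exact: hit_smul.
Qed.

Lemma hitM_skew phi i g x r : scalar phi -> homog i x ->
  comul x = x ⊗ 1 + g ⊗ x ->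
  hit phi (x * r) = x * hit phi r + g * sgn i (hit (fun d => phi (x * d)) r).
Proof.
move=> pl hx cx; rewrite {1}hit.unlock comulM cx.
by apply: (etrans (contract_smulD _ _ _ pl)); congr (_ + _); [apply: hit_smul1|apply: hit_smul].
Qed.

Lemma hitM_skew2 phi i j g x b c r : scalar phi -> homog i x -> homog j c ->
  comul x = x ⊗ 1 + g ⊗ x + b ⊗ c ->
  hit phi (x * r) = x * hit phi r + g * sgn i (hit (fun d => phi (x * d)) r)
    + b * sgn j (hit (fun d => phi (c * d)) r).
Proof.
move=> pl hx hc cx; rewrite {1}hit.unlock comulM cx.
apply: (etrans (contract_smulD _ _ _ pl)); congr (_ + _); last exact: hit_smul.
by apply: (etrans (contract_smulD _ _ _ pl)); congr (_ + _); [apply: hit_smul1|apply: hit_smul].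
Qed.

End Hit.

(** * Morphisms of Hopf superalgebras *)

Section Morphisms.
Variables (k : fieldType) (A B : hopfSuperAlgType k) (f : {lrmorphism A -> B}).

Let fl : linear f. Proof. exact: linearP. Qed.

Hypothesis f_even : forall i a, f (sproj i a) = sproj i (f a).

Lemma sgn_morph i a : f (sgn i a) = sgn i (f a).
Proof. by rewrite sgn.unlock linearD linearZ /= !f_even. Qed.

Lemma smul_morph s t :
  tmap f f (smul s t) = smul (tmap f f s) (tmap f f t).
Proof.
have tl := tmap_linear fl fl.
elim/tens_ind: s => [|a b|s1 s2 H1 H2].
- by rewrite (lin0 (smul_linl t)) !(lin0 tl) (lin0 (smul_linl _)).
- elim/tens_ind: t => [|c d|t1 t2 H1 H2].
  + by rewrite (lin0 (smul_linr _)) !(lin0 tl) (lin0 (smul_linr _)).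
  + apply: etrans (congr1 (tmap f f) (smulE a b c d)) _.
    apply: etrans (linD tl _ _) _; apply: esym.
    apply: etrans (congr2 (@smul k B) (tmapE a b fl fl) (tmapE c d fl fl)) _.
    apply: etrans (smulE _ _ _ _) _; apply: esym.
    by apply: congr2; rewrite (tmapE _ _ fl fl) !rmorphM /= ?f_even ?sgn_morph.
  + apply: etrans (_ : _ = smul _ (tmap f f t1 + tmap f f t2)) _.
      rewrite (linD (smul_linr _)) (linD tl) (linD (smul_linr _)).
      exact: (congr2 +%R H1 H2).
    exact: (congr1 (smul _) (esym (linD tl t1 t2))).
- apply: etrans (_ : _ = smul (tmap f f s1 + tmap f f s2) _) _.
    rewrite (linD (smul_linl t)) (linD tl) (linD (smul_linl _)).
    exact: (congr2 +%R H1 H2).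
  exact: (congr1 (@smul k B ^~ (tmap f f t)) (esym (linD tl s1 s2))).
Qed.

Hypothesis f_comul : forall a, comul (f a) = tmap f f (comul a).

(** A functional that factors through [f] gives an operator compatible with [f];
    in particular this operator preserves the kernel of [f]. *)
Lemma hit_morph (phi : B -> k) a : scalar phi ->
  hit phi (f a) = f (hit (fun d => phi (f d)) a).
Proof.
move=> pl; have [Hl Hr] := contract_bil B pl.
rewrite !hit.unlock f_comul /contract tlift_tmap // -(tlift_comp _ _ fl).
by apply: eq_tlift => v w; rewrite (linZ fl).
Qed.

Hypothesis f_counit : forall a, counit (f a) = counit a.

Let conv (al be : A -> B) (a : A) : B := tlift (fun b c => al b * be c) (comul a).

Let conv_bil (al be : A -> B) : linear al -> linear be ->
  (forall w, linear (fun v => al v * be w)) * (forall v, linear (fun w => al v * be w)).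
Proof.
move=> all bel; split=> z a u v; first by rewrite all mulrDl -scalerAl.
by rewrite bel mulrDr -scalerAr.
Qed.

Let convA (al be ga : A -> B) a : linear al -> linear be -> linear ga ->
  conv (conv al be) ga a = conv al (conv be ga) a.
Proof.
move=> all bel gal.
have [Hl1 Hr1] := conv_bil all bel; have [Hl2 Hr2] := conv_bil bel gal.
pose ab := tlift (fun b c => al b * be c); pose bc := tlift (fun b c => be b * ga c).
have abl : linear ab by apply: tlift_linear.
have bcl : linear bc by apply: tlift_linear.
have [Hl3 Hr3] : (forall w, linear (fun t => ab t * ga w)) *
    (forall t, linear (fun w => ab t * ga w)).
  split=> z x u v; first by rewrite abl mulrDl -scalerAl.
  by rewrite gal mulrDr -scalerAr.
have [Hl4 Hr4] : (forall t, linear (fun w => al w * bc t)) *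
    (forall w, linear (fun t => al w * bc t)).
  split=> z x u v; first by rewrite all mulrDl -scalerAl.
  by rewrite bcl mulrDr -scalerAr.
have idl : linear (@id A) by [].
have cl : linear (@comul k A) by exact: linearP.
pose L := tlift (fun t w => ab t * ga w); pose M := tlift (fun w t => al w * bc t).
have Ll : linear L by apply: tlift_linear.
have Ml : linear M by apply: tlift_linear.
have -> : conv (conv al be) ga a = L (tmap comul id (comul a)).
  by rewrite /L tlift_tmap.
have -> : conv al (conv be ga) a = M (tmap id comul (comul a)).
  by rewrite /M tlift_tmap.
have MtL : linear (fun t : tensor (tensor A A) A => M (tassoc t)).
  by move=> z x y; apply: etrans (congr1 M (tassoc_linear z x y)) (Ml z _ _).
rewrite -comulA; apply: (tens_ext3 Ll MtL).
move=> x y z; apply: etrans (tliftE Hl3 Hr3 _ _) _.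
apply: etrans (congr1 ( *%R^~ _) (tliftE Hl1 Hr1 _ _)) _.
rewrite tassocE; apply: esym; apply: etrans (tliftE Hl4 Hr4 _ _) _.
by apply: etrans (congr1 ( *%R _) (tliftE Hl2 Hr2 _ _)) _; rewrite mulrA.
Qed.

(** A morphism of bialgebras commutes with the antipodes: [S o f] and [f o S]
    are a left and a right inverse of [f] under convolution. *)
Lemma antipode_morph a : antipode (f a) = f (antipode a).
Proof.
have Sl : linear (fun a => antipode (f a)) by move=> z x y; rewrite !linearP.
have Sr : linear (fun a => f (antipode a)) by move=> z x y; rewrite !linearP.
have SA : linear (@antipode k A) by exact: linearP.
have SB : linear (@antipode k B) by exact: linearP.
have L b : conv (fun a => antipode (f a)) f b = counit b *: 1.
  rewrite -f_counit -antipodel f_comul tlift_tmap //.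
    by move=> w z x y; rewrite SB mulrDl -scalerAl.
  by move=> v z x y; rewrite mulrDr -scalerAr.
have R b : conv f (fun a => f (antipode a)) b = counit b *: 1.
  apply: (@etrans _ _ (f (counit b *: 1))); last by rewrite linearZ /= rmorph1.
  rewrite -antipoder -(tlift_comp _ _ fl).
  by apply: eq_tlift => v w; rewrite rmorphM.
have E1 : conv (conv (fun a => antipode (f a)) f) (fun a => f (antipode a)) a =
    f (antipode a).
  rewrite -[in RHS](counitl a) -(tlift_comp _ _ Sr).
  by apply: eq_tlift => v w; rewrite L mulr_algl !linearZ.
have E2 : conv (fun a => antipode (f a)) (conv f (fun a => f (antipode a))) a =
    antipode (f a).
  rewrite -[in RHS](counitr a) -(tlift_comp _ _ Sl).
  by apply: eq_tlift => v w; rewrite R mulr_algr !linearZ.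
by rewrite -E1 -E2 (convA a Sl fl Sr).
Qed.

End Morphisms.

(** For a morphism out of a presented superalgebra it is enough to compare the
    structures on the generators. *)
Lemma hopf_morphism_gen (k : fieldType) (I : choiceType) (par : I -> bool)
    (rel : {free k[I]} -> Prop) (A B : hopfSuperAlgType k) (x : I -> A)
    (f : {lrmorphism A -> B}) :
  presented_by par rel x ->
  (forall i, homog (par i) (f (x i))) ->
  (forall i, comul (f (x i)) = tmap f f (comul (x i))) ->
  (forall i, counit (f (x i)) = counit (x i)) ->
  hopf_morphism f.
Proof.
move=> pres f_homog f_comul f_counit.
have fl : linear f by exact: linearP.
have tl := tmap_linear fl fl.
have x_homog i : homog (par i) (x i) by have [] := pres.
have f_even a : forall i, f (sproj i a) = sproj i (f a).
  elim/(presented_ind pres): a => [i|a b Ha Hb i|c a Ha i|i|i a Ha j].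
  - by rewrite !linear0.
  - by rewrite !linearD /= Ha Hb.
  - by rewrite !linearZ /= Ha.
  - by rewrite rmorph1 !(homogP _ (homog1 _)); case: i; rewrite ?rmorph1 ?linear0.
  - by rewrite (sproj_mull _ _ (x_homog i)) !rmorphM /= (sproj_mull _ _ (f_homog i)) Ha.
have f_even' i a : f (sproj i a) = sproj i (f a) by [].
have cA : linear (@comul k A) by exact: linearP.
have cB : linear (@comul k B) by exact: linearP.
have f_cm a : comul (f a) = tmap f f (comul a).
  elim/(presented_ind pres): a => [|a b Ha Hb|c a Ha||i a Ha].
  - by rewrite (lin0 fl) (lin0 cB) (lin0 cA) (lin0 tl).
  - rewrite (linD fl) (linD cB) (linD cA) (linD tl).
    exact: (congr2 +%R Ha Hb).
  - rewrite (linZ fl) (linZ cB) (linZ cA) (linZ tl).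
    exact: (congr1 ( *:%R c) Ha).
  - by rewrite rmorph1 !comul1 (tmapE _ _ fl fl) rmorph1.
  - rewrite rmorphM !comulM (smul_morph f_even').
    exact: (congr2 (@smul k B) (f_comul i) Ha).
have f_cu a : counit (f a) = counit a.
  elim/(presented_ind pres): a => [|a b Ha Hb|c a Ha||i a Ha].
  - by rewrite !linear0.
  - by rewrite !linearD /= Ha Hb.
  - by rewrite !linearZ /= Ha.
  - by rewrite rmorph1 !counit1.
  - by rewrite rmorphM !counitM f_counit Ha.
by split=> //; apply: antipode_morph.
Qed.

(** * Matrices with integer entries *)

Section IntegerMatrices.
Variables (k : fieldType) (n : nat).

(** Equality of lists of integers can be decided by computation, which equality of
    matrices over [k] cannot. *)
Definition imx (L : seq (seq int)) : 'M[k]_n.+1 :=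
  \matrix_(i, j) (nth 0 (nth [::] L i) j)%:~R.

Let mkrows (F : nat -> nat -> int) : seq (seq int) :=
  mkseq (fun i => mkseq (F i) n.+1) n.+1.
Let entry (L : seq (seq int)) i j := nth 0 (nth [::] L i) j.

Definition rows_mul L M := mkrows (fun i j =>
  foldr +%R 0 [seq entry L i l * entry M l j | l <- iota 0 n.+1]).
Definition rows_add L M := mkrows (fun i j => entry L i j + entry M i j).
Definition rows_opp L := mkrows (fun i j => - entry L i j).
Definition rows_scalar (c : int) := mkrows (fun i j => if i == j then c else 0).

Let mkrowsE F : imx (mkrows F) = \matrix_(i, j) (F i j)%:~R.
Proof. by apply/matrixP=> i j; rewrite !mxE !nth_mkseq. Qed.

Lemma imxM L M : imx L * imx M = imx (rows_mul L M).
Proof.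
rewrite mkrowsE; apply/matrixP=> i j; rewrite -mulmxE !mxE foldrE big_map.
rewrite -[X in iota 0 X]subn0 -/(index_iota 0 n.+1) big_mkord.
by rewrite rmorph_sum /=; apply: eq_bigr => l _; rewrite !mxE rmorphM.
Qed.

Lemma imxD L M : imx L + imx M = imx (rows_add L M).
Proof. by rewrite mkrowsE; apply/matrixP=> i j; rewrite !mxE rmorphD. Qed.

Lemma imxN L : - imx L = imx (rows_opp L).
Proof. by rewrite mkrowsE; apply/matrixP=> i j; rewrite !mxE rmorphN. Qed.

Lemma imx_scalar (c : int) : c%:~R = imx (rows_scalar c).
Proof.
rewrite mkrowsE; apply/matrixP=> i j; rewrite -[_%:~R]scaler_int !mxE -val_eqE.
by case: (val i == val j); rewrite ?mulr1 ?mulr0.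
Qed.

Lemma imx1 : 1 = imx (rows_scalar 1). Proof. exact: (imx_scalar 1). Qed.
Lemma imx0 : 0 = imx (rows_scalar 0). Proof. exact: (imx_scalar 0). Qed.

Lemma pchar_mx p : p \in [pchar k] -> p \in [pchar 'M[k]_n.+1].
Proof.
by move=> hp; rewrite (rmorph_pchar (@scalar_mx k n.+1)).
Qed.

End IntegerMatrices.

Definition imxE := (imxM, imxD, imxN).

Ltac imx_compute :=
  rewrite ?expr2 ?imx1 ?imxE ?imx0 ?imxE; congr (imx _ _ _); vm_compute; reflexivity.

(** * The natural representation of osp(1|2) *)

Definition osp_eval (k : fieldType) (B : algType k) (y : osp_gen -> B)
  (x : osp k) : B := \sum_i x i *: y i.

Section OspEval.
Variables (k : fieldType) (B : algType k) (y : osp_gen -> B).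

Lemma free_eval_osp (x : osp k) : free_eval y (osp_free x) = osp_eval y x.
Proof.
rewrite /osp_free (lin_sum (free_eval_linear y)); apply: eq_bigr => i _.
by rewrite free_evalZ free_eval_gen.
Qed.

Lemma free_eval_supercomm (f g h : {free k[osp_gen]}) (a b d : B) c :
  free_eval y f = a -> free_eval y g = b -> free_eval y h = d ->
  free_eval y (f * g - c *: (g * f) - h) = a * b - c *: (b * a) - d.
Proof.
move=> fa gb hd; apply: etrans (free_evalB y _ h) _.
apply: (congr2 (fun u v => u - v)) hd.
apply: etrans (free_evalB y _ _) _.
have E := free_evalM y f g; have E' := free_evalM y g f.
rewrite fa gb in E E'; rewrite -E -E'.
by apply: (congr2 (fun u v => u - v)) (free_evalZ y c _).
Qed.

Lemma osp_eval_linear : linear (osp_eval y).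
Proof.
move=> a u v; rewrite /osp_eval scaler_sumr -big_split; apply: eq_bigr => i _.
by rewrite !ffunE scalerDl scalerA.
Qed.
HB.instance Definition _ :=
  GRing.isLinear.Build k (osp k) B *:%R (osp_eval y) osp_eval_linear.

Lemma osp_eval_basis i : osp_eval y (osp_basis k i) = y i.
Proof.
rewrite /osp_eval (bigD1 i) //= ffunE eqxx scale1r big1 ?addr0 // => j ji.
by rewrite ffunE (negPf ji) scale0r.
Qed.

Lemma osp_basis_homog i : osp_homog (osp_par i) (osp_basis k i).
Proof. by move=> j; rewrite ffunE; case: (j =P i) => [-> //|_]; rewrite eqxx. Qed.

(** The bracket relations are bilinear, so it is enough to check them on the basis.
    The p-map is not additive, and its relations are required for every even
    element. *)
Lemma u_osp_rel_eval p :
  (forall i j, y i * y j - (-1) ^+ (osp_par i && osp_par j) *: (y j * y i) =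
     osp_eval y (osp_bracket_basis k i j)) ->
  (forall x, osp_homog false x -> osp_eval y (osp_pmap p x) = osp_eval y x ^+ p) ->
  forall r, u_osp_rel p r -> free_eval y r = 0.
Proof.
move=> Hb Hp r [i j x z hx hz|x hx]; last first.
  apply: etrans (free_evalB y (osp_free (osp_pmap p x)) (osp_free x ^+ p)) _.
  have E := free_evalX y (osp_free x) p; rewrite free_eval_osp -Hp // in E.
  by apply/eqP; rewrite subr_eq0; apply/eqP; apply: etrans (free_eval_osp _) (esym E).
apply: etrans (free_eval_supercomm _ (free_eval_osp x) (free_eval_osp z)
  (free_eval_osp (osp_bracket x z))) _.
apply/eqP; rewrite subr_eq0; apply/eqP.
have E u v : osp_eval y u * osp_eval y v = \sum_a \sum_b (u a * v b) *: (y a * y b).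
  rewrite mulr_suml; apply: eq_bigr => a _; rewrite mulr_sumr.
  by apply: eq_bigr => b _; rewrite -scalerAl -scalerAr scalerA.
rewrite E [osp_eval y z * _]E [X in _ *: X]exchange_big scaler_sumr -sumrB.
rewrite (lin_sum osp_eval_linear); apply: eq_bigr => a _.
rewrite scaler_sumr -sumrB (lin_sum osp_eval_linear); apply: eq_bigr => b _.
rewrite (linZ osp_eval_linear) -Hb scalerBr !scalerA; congr (_ - _ *: _).
have [->|xa] := eqVneq (x a) 0; first by rewrite !(mul0r, mulr0).
have [->|zb] := eqVneq (z b) 0; first by rewrite !(mul0r, mulr0).
by rewrite (hx _ xa) (hz _ zb) mulrC [z b * _]mulrC.
Qed.

Lemma u_osp_rel_bracketE p i j :
  (forall r, u_osp_rel p r -> free_eval y r = 0) ->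
  y i * y j - (-1) ^+ (osp_par i && osp_par j) *: (y j * y i) =
     osp_eval y (osp_bracket_basis k i j).
Proof.
move=> H; have := H _ (u_osp_rel_bracket p (@osp_basis_homog i) (@osp_basis_homog j)).
have fE u := free_eval_osp (osp_basis k u); rewrite (free_eval_supercomm _
  (etrans (fE i) (osp_eval_basis i)) (etrans (fE j) (osp_eval_basis j))
  (free_eval_osp (osp_bracket (osp_basis k i) (osp_basis k j)))).
move/eqP; rewrite subr_eq0 => /eqP ->; congr osp_eval.
rewrite /osp_bracket (bigD1 i) //= [X in _ + X]big1 ?addr0 => [|a ai]; last first.
  by rewrite big1 // => b _; rewrite ffunE (negPf ai) mul0r scale0r.
rewrite (bigD1 j) //= [X in _ + X]big1 ?addr0 => [|b bj]; last first.
  by rewrite !ffunE (negPf bj) mulr0 scale0r.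
by rewrite !ffunE !eqxx mulr1 scale1r.
Qed.

End OspEval.

(** The action of osp(1|2) on its three-dimensional module, in a basis
    [v_1, v_0, v_-1] of weight vectors: [psi_+] maps [v_-1] to [v_0] to [v_1]. *)
Definition nat_rows (i : osp_gen) : seq (seq int) :=
  match i with
  | Oe => [:: [:: 0; 0; 1]; [:: 0; 0; 0]; [:: 0; 0; 0]]
  | Of => [:: [:: 0; 0; 0]; [:: 0; 0; 0]; [:: 1; 0; 0]]
  | Oh => [:: [:: 1; 0; 0]; [:: 0; 0; 0]; [:: 0; 0; -1]]
  | Op => [:: [:: 0; 1; 0]; [:: 0; 0; 1]; [:: 0; 0; 0]]
  | Om => [:: [:: 0; 0; 0]; [:: -1; 0; 0]; [:: 0; 1; 0]]
  end.

Lemma osp_sumE (V : nmodType) (F : osp_gen -> V) :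
  \sum_i F i = F Oe + F Of + F Oh + F Op + F Om.
Proof.
rewrite (perm_big [:: Oe; Of; Oh; Op; Om]); last first.
  apply: uniq_perm => [|//|i]; first exact: index_enum_uniq.
  by rewrite mem_index_enum; case: i.
by rewrite !big_cons big_nil Monoid.mulm1 !Monoid.mulmA.
Qed.

Section NatRep.
Variables (k : fieldType).

Definition nat_rep (i : osp_gen) : 'M[k]_3 := imx k 2 (nat_rows i).

Lemma nat_rep_bracket i j :
  nat_rep i * nat_rep j - (-1) ^+ (osp_par i && osp_par j) *: (nat_rep j * nat_rep i) =
  osp_eval nat_rep (osp_bracket_basis k i j).
Proof.
case: i j => [] []; rewrite /osp_bracket_basis ?(linear0, linearN, linearZ) /=
  ?osp_eval_basis ?expr0 ?expr1 ?scale1r ?scaleN1r ?scaler_nat ?mulr2n /nat_rep; imx_compute.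
Qed.

Lemma sl2_sqr (x : osp k) : sl2_mx x ^+ 2 = (x Oh ^+ 2 + x Oe * x Of)%:M.
Proof.
apply/matrixP=> i j; rewrite expr2 -mulmxE !mxE !big_ord_recl big_ord0 !mxE.
by case: i => [[|[|[]]] ?] //; case: j => [[|[|[]]] ?] //=; rewrite ?mulr1n ?mulr0n; ring.
Qed.

(* The two even weight vectors span a copy of the vector representation of sl_2. *)
Let emb (M : 'M[k]_2) : 'M[k]_3 :=
  M 0 0 *: imx k 2 [:: [:: 1; 0; 0]; [:: 0; 0; 0]; [:: 0; 0; 0]] +
  M 0 1 *: nat_rep Oe + M 1 0 *: nat_rep Of +
  M 1 1 *: imx k 2 [:: [:: 0; 0; 0]; [:: 0; 0; 0]; [:: 0; 0; 1]].

Let embM M N : emb (M * N) = emb M * emb N.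
Proof.
have e1 : lift ord0 ord0 = 1 :> 'I_2 by apply: val_inj.
apply/matrixP=> i j; rewrite -!mulmxE !mxE !big_ord_recl !big_ord0 !mxE e1.
case: i => [[|[|[|[]]]] ?] //; case: j => [[|[|[|[]]]] ?] //=; ring.
Qed.

Let embX M n : emb (M ^+ n.+1) = emb M ^+ n.+1.
Proof. by elim: n => // n IH; rewrite exprS embM IH -exprS. Qed.

Let emb_sl2 x : osp_homog false x -> osp_eval nat_rep x = emb (sl2_mx x).
Proof.
move=> hx; have x0 i : osp_par i -> x i = 0 :> k.
  by move=> pi; apply: contraTeq pi => /hx ->.
rewrite /osp_eval osp_sumE (x0 Op) // (x0 Om) // !scale0r !addr0.
rewrite /emb /sl2_mx !mxE /=.
rewrite ?(mulr0, mulr1, addr0, add0r, subr0, sub0r) ?mulrN1 scaleNr -scalerN.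
have -> : nat_rep Oh = imx k 2 [:: [:: 1; 0; 0]; [:: 0; 0; 0]; [:: 0; 0; 0]]
    - imx k 2 [:: [:: 0; 0; 0]; [:: 0; 0; 0]; [:: 0; 0; 1]] by imx_compute.
rewrite oppr0 mulr0 !addr0 scalerBr scalerN -!addrA.
by rewrite [RHS]addrCA; congr (_ + _); rewrite addrCA.
Qed.

(** By Cayley-Hamilton, an odd power of a traceless 2 x 2 matrix [M] is a multiple of
    [M], hence traceless; and [emb] is multiplicative. *)
Lemma nat_rep_pmap p (x : osp k) : odd p -> osp_homog false x ->
  osp_eval nat_rep (osp_pmap p x) = osp_eval nat_rep x ^+ p.
Proof.
move=> p_odd hx; pose M := sl2_mx x; pose c := x Oh ^+ 2 + x Oe * x Of.
have Mp : M ^+ p = c ^+ p./2 *: M.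
  rewrite -{1}(odd_double_half p) p_odd -mul2n add1n exprS exprM sl2_sqr -/c.
  by rewrite -rmorphXn /= -mulmxE mul_mx_scalar.
have tr0 : (M ^+ p) 1 1 = - (M ^+ p) 0 0.
  by rewrite Mp !mxE /=; ring.
rewrite [in RHS]emb_sl2 // -/M; have [q qE] : exists q, p = q.+1.
  by exists p.-1; rewrite prednK // odd_gt0.
rewrite qE -embX -qE /osp_pmap -/M !linearD !linearZ /= !osp_eval_basis.
rewrite /emb tr0.
have -> : nat_rep Oh = imx k 2 [:: [:: 1; 0; 0]; [:: 0; 0; 0]; [:: 0; 0; 0]]
    - imx k 2 [:: [:: 0; 0; 0]; [:: 0; 0; 0]; [:: 0; 0; 1]] by imx_compute.
rewrite scalerBr scaleNr -!addrA.
by rewrite [RHS]addrCA; congr (_ + _); rewrite [RHS]addrCA.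
Qed.

Lemma nat_rep_rel p : odd p -> forall r, u_osp_rel p r -> free_eval nat_rep r = 0.
Proof.
move=> p_odd; apply: u_osp_rel_eval; first exact: nat_rep_bracket.
by move=> x; apply: nat_rep_pmap.
Qed.

End NatRep.

(** * A deformation of the natural representation *)

Definition block_rows (A B : seq (seq int)) : seq (seq int) :=
  [seq s.1 ++ s.2 | s <- zip A B] ++ [seq nseq 3 0 ++ s | s <- A].

Definition zero_rows : seq (seq int) := nseq 3 (nseq 3 0).
Definition one_rows : seq (seq int) := [:: [:: 1; 0; 0]; [:: 0; 1; 0]; [:: 0; 0; 1]].
Definition neg_rows (A : seq (seq int)) : seq (seq int) := map (map (fun a => - a)) A.

(** Matrices [A + B eps] over the dual numbers, written as [[A, B], [0, A]]. Modulo
    [eps] this is the natural representation of osp(1|2) pulled back along [pi], and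
    the elements of [R] get their first-order terms in osp(1|2). The first-order
    term [B] of [u_2] solves [B psi_+ + psi_+ B = h^2 + psi_+ psi_-], which is the
    relation [u_2 x_2 + x_2 u_2 = g zeta + x_2 u_1] to first order. *)
Definition def_rows (i : D_gen) : seq (seq int) :=
  match i with
  | Dx1 => block_rows zero_rows (neg_rows (nat_rows Op))
  | Dx2 => block_rows (nat_rows Op) zero_rows
  | Du1 => block_rows zero_rows (nat_rows Om)
  | Du2 => block_rows (neg_rows (nat_rows Om))
             [:: [:: 0; 0; 0]; [:: 0; 0; 0]; [:: 0; 1; 0]]
  | Dg => block_rows one_rows (nat_rows Oh)
  | Dzeta => block_rows (nat_rows Oh) zero_rows
  end.

(** The relations of [D] as expressions, to be evaluated in any algebra. *)
Definition D_exprs (p : nat) : seq (ring_expr D_gen) :=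
  let x1 := Gen Dx1 in let x2 := Gen Dx2 in
  let u1 := Gen Du1 in let u2 := Gen Du2 in
  let g := Gen Dg in let zeta := Gen Dzeta in
  let x21 := Add (Mul x2 x1) (Mul x1 x2) in let u21 := Add (Mul u1 u2) (Mul u2 u1) in
  let Sub e f := Add e (Opp f) in
  [:: Exp x1 2;
      Sub (Mul x2 x21) (Add (Mul x21 x2) (Mul x1 x21));
      Exp x21 p;
      Exp x2 (2 * p);
      Exp u1 2;
      Sub (Mul u2 u21) (Add (Mul u21 u2) (Mul u1 u21));
      Exp u21 p;
      Exp u2 (2 * p);
      Sub (Exp zeta p) zeta;
      Sub (Exp g p) One;
      Sub (Mul zeta g) (Mul g zeta);
      Sub (Mul zeta x1) (Add (Mul x1 zeta) x1);
      Sub (Mul zeta x2) (Add (Mul x2 zeta) x2);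
      Sub (Mul u1 zeta) (Add (Mul zeta u1) u1);
      Sub (Mul u2 zeta) (Add (Mul zeta u2) u2);
      Sub (Mul g x1) (Mul x1 g);
      Sub (Mul g x2) (Mul (Sub x2 x1) g);
      Sub (Mul u1 g) (Mul g u1);
      Sub (Mul u2 g) (Sub (Mul g u2) (Mul g u1));
      Sub (Mul u1 x1) (Opp (Mul x1 u1));
      Sub (Mul u1 x2) (Add (Opp (Mul x2 u1)) (Sub One g));
      Sub (Mul u2 x1) (Add (Add (Opp (Mul x1 u2)) (Sub One g)) (Mul x1 u1));
      Sub (Mul u2 x2) (Add (Add (Opp (Mul x2 u2)) (Mul g zeta)) (Mul x2 u1)) ].

Lemma D_relsE (k : fieldType) p :
  D_rels k p = map (expr_eval (@gen k D_gen)) (D_exprs p).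
Proof. by []. Qed.

Definition D_holds p (A : nzRingType) (y : D_gen -> A) :=
  all (fun e => expr_eval y e == 0) (D_exprs p).

Lemma D_holdsP (k : fieldType) p (A : algType k) (y : D_gen -> A) :
  reflect (forall r, r \in D_rels k p -> free_eval y r = 0) (D_holds p y).
Proof.
have -> : D_holds p y = all (fun r => free_eval y r == 0) (D_rels k p).
  by rewrite D_relsE all_map; apply: eq_all => e /=; rewrite free_eval_expr.
by apply: (iffP allP) => H r /H /eqP.
Qed.

Section DefRep.
Variables (k : fieldType) (p : nat).
Hypotheses (p_char : p \in [pchar k]) (p_gt2 : (2 < p)%N).

Definition def_rep (i : D_gen) : 'M[k]_6 := imx k 5 (def_rows i).

Lemma expr0_leq (A : nzRingType) (a : A) m n : a ^+ m = 0 -> (m <= n)%N -> a ^+ n = 0.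
Proof. by move=> am mn; rewrite -(subnK mn) exprD am mulr0. Qed.

Lemma pchar_odd : odd p.
Proof. by case: (even_prime (pcharf_prime p_char)) p_gt2 => // ->. Qed.

Lemma def_rep_holds : D_holds p def_rep.
Proof.
have p_odd := pchar_odd.
have c2 : def_rep Dx2 ^+ (2 * p) = 0.
  apply: (@expr0_leq _ _ 3); last by rewrite mul2n -addnn; apply: leq_trans (leq_addr _ _).
  by rewrite !exprS expr0 /def_rep; imx_compute.
have d2 : def_rep Du2 ^+ (2 * p) = 0.
  apply: (@expr0_leq _ _ 3); last by rewrite mul2n -addnn; apply: leq_trans (leq_addr _ _).
  by rewrite !exprS expr0 /def_rep; imx_compute.
have c21 : (def_rep Dx2 * def_rep Dx1 + def_rep Dx1 * def_rep Dx2) ^+ p = 0.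
  apply: (@expr0_leq _ _ 2); last exact: ltnW.
  by rewrite !exprS expr0 /def_rep; imx_compute.
have d21 : (def_rep Du1 * def_rep Du2 + def_rep Du2 * def_rep Du1) ^+ p = 0.
  apply: (@expr0_leq _ _ 2); last exact: ltnW.
  by rewrite !exprS expr0 /def_rep; imx_compute.
have gp : def_rep Dg ^+ p = 1.
  have -> : def_rep Dg = 1 + imx k 5 (block_rows zero_rows (nat_rows Oh)) by imx_compute.
  rewrite -!(pFrobenius_autE (pchar_mx 5 p_char)) pFrobenius_autD_comm; last exact/commr_sym/commr1.
  rewrite pFrobenius_aut1 pFrobenius_autE (@expr0_leq _ _ 2) ?addr0 //; last exact: ltnW.
  by imx_compute.
have zp : def_rep Dzeta ^+ p = def_rep Dzeta.
  rewrite -[in LHS](odd_double_half p) p_odd -mul2n exprS exprM.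
  elim: p./2 => [|n IH]; first by rewrite expr0 mulr1.
  rewrite exprS mulrA (_ : def_rep Dzeta * def_rep Dzeta ^+ 2 = def_rep Dzeta) //.
  by rewrite /def_rep; imx_compute.
have c1 : def_rep Dx1 ^+ 2 = 0 by rewrite /def_rep; imx_compute.
have d1 : def_rep Du1 ^+ 2 = 0 by rewrite /def_rep; imx_compute.
rewrite /D_holds /= c1 d1 c2 d2 c21 d21 gp zp !subrr eqxx /=.
have E (a b : 'M[k]_6) : a = b -> a - b == 0 by move=> ->; rewrite subrr.
by rewrite !E //= /def_rep; imx_compute.
Qed.
End DefRep.

(** * Computing in the algebra [D] *)

(** Noncommutative polynomials with integer coefficients. Identities between them
    in [D] are proved by rewriting words with the relations that do not involve [p],
    oriented so as to move letters into the order x, g, zeta, u. *)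
Definition nc_poly := seq (int * seq D_gen).

Definition D_rule (w : seq D_gen) : option (nc_poly * seq D_gen) :=
  match w with
  | Dx1 :: Dx1 :: t => Some ([::], t)
  | Dx2 :: Dx2 :: Dx1 :: t =>
      Some ([:: (1, [:: Dx1; Dx2; Dx2]); (1, [:: Dx1; Dx2; Dx1])], t)
  | Du1 :: Du1 :: t => Some ([::], t)
  | Du2 :: Du2 :: Du1 :: t =>
      Some ([:: (1, [:: Du1; Du2; Du2]); (1, [:: Du1; Du2; Du1])], t)
  | Dzeta :: Dg :: t => Some ([:: (1, [:: Dg; Dzeta])], t)
  | Dzeta :: Dx1 :: t => Some ([:: (1, [:: Dx1; Dzeta]); (1, [:: Dx1])], t)
  | Dzeta :: Dx2 :: t => Some ([:: (1, [:: Dx2; Dzeta]); (1, [:: Dx2])], t)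
  | Du1 :: Dzeta :: t => Some ([:: (1, [:: Dzeta; Du1]); (1, [:: Du1])], t)
  | Du2 :: Dzeta :: t => Some ([:: (1, [:: Dzeta; Du2]); (1, [:: Du2])], t)
  | Dg :: Dx1 :: t => Some ([:: (1, [:: Dx1; Dg])], t)
  | Dg :: Dx2 :: t => Some ([:: (1, [:: Dx2; Dg]); (-1, [:: Dx1; Dg])], t)
  | Du1 :: Dg :: t => Some ([:: (1, [:: Dg; Du1])], t)
  | Du2 :: Dg :: t => Some ([:: (1, [:: Dg; Du2]); (-1, [:: Dg; Du1])], t)
  | Du1 :: Dx1 :: t => Some ([:: (-1, [:: Dx1; Du1])], t)
  | Du1 :: Dx2 :: t =>
      Some ([:: (-1, [:: Dx2; Du1]); (1, [::]); (-1, [:: Dg])], t)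
  | Du2 :: Dx1 :: t =>
      Some ([:: (-1, [:: Dx1; Du2]); (1, [::]); (-1, [:: Dg]); (1, [:: Dx1; Du1])], t)
  | Du2 :: Dx2 :: t =>
      Some ([:: (-1, [:: Dx2; Du2]); (1, [:: Dg; Dzeta]); (1, [:: Dx2; Du1])], t)
  | _ => None
  end.

Fixpoint D_step (w : seq D_gen) : option nc_poly :=
  if D_rule w is Some (P, t) then Some [seq (m.1, m.2 ++ t) | m <- P]
  else if w is i :: w' then
    if D_step w' is Some P then Some [seq (m.1, i :: m.2) | m <- P] else None
  else None.

Fixpoint nc_insert (m : int * seq D_gen) (P : nc_poly) : nc_poly :=
  if P is q :: P' then
    if q.2 == m.2 then (q.1 + m.1, q.2) :: P' else q :: nc_insert m P'
  else [:: m].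

Definition nc_collect (P : nc_poly) : nc_poly :=
  [seq m <- foldr nc_insert [::] P | m.1 != 0].

Definition D_pass (P : nc_poly) : nc_poly :=
  nc_collect (flatten [seq (if D_step m.2 is Some Q
                            then [seq (m.1 * q.1, q.2) | q <- Q] else [:: m]) | m <- P]).

Fixpoint nc_of_expr (e : ring_expr D_gen) : nc_poly :=
  match e with
  | Gen i => [:: (1, [:: i])]
  | One => [:: (1, [::])]
  | Opp e => [seq (- m.1, m.2) | m <- nc_of_expr e]
  | Add e f => nc_of_expr e ++ nc_of_expr f
  | Mul e f => [seq (m.1 * q.1, m.2 ++ q.2) | m <- nc_of_expr e, q <- nc_of_expr f]
  | Exp e n => iter n (fun P => [seq (m.1 * q.1, m.2 ++ q.2) | m <- nc_of_expr e, q <- P])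
                 [:: (1, [::])]
  end.

Section NcEval.
Variables (A : nzRingType) (y : D_gen -> A).

Definition word_eval (w : seq D_gen) : A := \prod_(i <- w) y i.
Definition nc_eval (P : nc_poly) : A := \sum_(m <- P) word_eval m.2 *~ m.1.

Lemma nc_eval_mul P Q :
  nc_eval [seq (m.1 * q.1, m.2 ++ q.2) | m <- P, q <- Q] = nc_eval P * nc_eval Q.
Proof.
rewrite /nc_eval big_allpairs_dep /= mulr_suml; apply: eq_bigr => m _.
rewrite mulr_sumr; apply: eq_bigr => q _.
by rewrite /word_eval big_cat /= mulrzAl mulrzAr -mulrzA mulrC.
Qed.

Lemma nc_of_exprE e : nc_eval (nc_of_expr e) = expr_eval y e.
Proof.
elim: e => [i||e IH|e IHe f IHf|e IHe f IHf|e IH n] /=.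
- by rewrite /nc_eval /word_eval !big_seq1.
- by rewrite /nc_eval /word_eval big_seq1 big_nil.
- rewrite -IH /nc_eval big_map -sumrN; apply: eq_bigr => m _.
  by rewrite mulrNz.
- by rewrite -IHe -IHf /nc_eval big_cat.
- by rewrite nc_eval_mul IHe IHf.
- elim: n => [|n IHn] /=; first by rewrite /nc_eval /word_eval big_seq1 big_nil.
  by rewrite nc_eval_mul IH IHn exprS.
Qed.

Lemma nc_collectE P : nc_eval (nc_collect P) = nc_eval P.
Proof.
rewrite /nc_collect /nc_eval big_filter big_mkcond.
rewrite (eq_bigr (fun m => word_eval m.2 *~ m.1)) => [|m _]; last first.
  by case: eqP => [->|].
elim: P => // m P IH; rewrite big_cons -IH /=.
elim: (foldr _ _ _) => [|q Q IHQ] /=; first by rewrite big_seq1 big_nil addr0.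
case: eqP => [e|_]; rewrite !big_cons /=; last by rewrite IHQ addrCA.
by rewrite mulrzDr e -addrA [RHS]addrCA.
Qed.

Variable p : nat.
Hypothesis y_holds : D_holds p y.

Lemma D_holds_nth n : (n < 23)%N -> expr_eval y (nth One (D_exprs p) n) = 0.
Proof. by move=> n_lt; apply/eqP/(all_nthP One y_holds). Qed.

Lemma D_ruleE w P t : D_rule w = Some (P, t) ->
  word_eval w = nc_eval P * word_eval t.
Proof.
have E n a b : (n < 23)%N -> expr_eval y (nth One (D_exprs p) n) = a - b -> a = b.
  by move=> /D_holds_nth -> /esym/eqP; rewrite subr_eq0 => /eqP.
have x1x1 : y Dx1 * y Dx1 = 0 := D_holds_nth (isT : (0 < 23)%N).
have x2x21 := E 1%N _ _ isT erefl.
have u1u1 : y Du1 * y Du1 = 0 := D_holds_nth (isT : (4 < 23)%N).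
have u2u21 := E 5%N _ _ isT erefl.
have zg := E 10%N _ _ isT erefl.
have zx1 := E 11%N _ _ isT erefl.
have zx2 := E 12%N _ _ isT erefl.
have u1z := E 13%N _ _ isT erefl.
have u2z := E 14%N _ _ isT erefl.
have gx1 := E 15%N _ _ isT erefl.
have gx2 := E 16%N _ _ isT erefl.
have u1g := E 17%N _ _ isT erefl.
have u2g := E 18%N _ _ isT erefl.
have u1x1 := E 19%N _ _ isT erefl.
have u1x2 := E 20%N _ _ isT erefl.
have u2x1 := E 21%N _ _ isT erefl.
have u2x2 := E 22%N _ _ isT erefl.
rewrite /= in x2x21 u2u21 zg zx1 zx2 u1z u2z gx1 gx2 u1g u2g u1x1 u1x2 u2x1 u2x2.
have x221 : y Dx2 * y Dx2 * y Dx1 = y Dx1 * y Dx2 * y Dx2 + y Dx1 * y Dx2 * y Dx1.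
  move: x2x21; rewrite !mulrDr !mulrDl !mulrA x1x1 mul0r addr0.
  by rewrite [X in X = _]addrC -addrA => /addrI.
have u221 : y Du2 * y Du2 * y Du1 = y Du1 * y Du2 * y Du2 + y Du1 * y Du2 * y Du1.
  move: u2u21; rewrite !mulrDr !mulrDl !mulrA u1u1 mul0r add0r.
  by rewrite [X in X = _]addrC [X in _ = X]addrAC => /addIr.
rewrite mulrBl in gx2; rewrite -!addrA in u2x1 u2x2.
pose rules := (x221, u221, zg, zx1, zx2, (u1z, u2z, gx1, gx2, u1g, u2g),
  (u1x1, u1x2, u2x1, u2x2)).
case: w => [|[] [|[] w]] //=; try (case: w => [|[] w] //=);
  case=> <- <-; rewrite /nc_eval /word_eval ?big_cons ?big_nil /= ?mulr1 ?addr0 ?mulrA;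
  rewrite ?x1x1 ?u1u1 ?mul0r // ?mulrNz ?mulr1z ?rules //.
Qed.

Lemma D_stepE w P : D_step w = Some P -> word_eval w = nc_eval P.
Proof.
elim: w P => [|i w IH] P; first by [].
rewrite /D_step -/D_step; case E : (D_rule _) => [[Q t]|].
  case=> <-; rewrite (D_ruleE E) /nc_eval big_map mulr_suml; apply: eq_bigr => m _.
  by rewrite /word_eval big_cat mulrzAl.
case E' : (D_step w) => [Q|] // [<-]; rewrite /word_eval big_cons -/(word_eval w) (IH _ E').
rewrite /nc_eval big_map mulr_sumr; apply: eq_bigr => m _.
by rewrite /word_eval big_cons mulrzAr.
Qed.

Lemma D_passE P : nc_eval (D_pass P) = nc_eval P.
Proof.
rewrite nc_collectE /nc_eval big_flatten big_map; apply: eq_bigr => m _.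
case E : (D_step m.2) => [Q|]; last by rewrite big_seq1.
rewrite big_map (D_stepE E) /nc_eval mulrz_suml; apply: eq_bigr => q _.
by rewrite -mulrzA mulrC.
Qed.

(** The number of passes only has to exceed the length of the longest reduction
    that occurs. *)
Lemma D_identity e f : iter 30 D_pass (nc_of_expr (Add e (Opp f))) = [::] ->
  expr_eval y e = expr_eval y f.
Proof.
move=> E; apply/eqP; rewrite -subr_eq0 -/(expr_eval y (Add e (Opp f))) -nc_of_exprE.
suff <- : nc_eval (iter 30 D_pass (nc_of_expr (Add e (Opp f)))) =
          nc_eval (nc_of_expr (Add e (Opp f))) by rewrite E /nc_eval big_nil.
by elim: 30%N => //= n <-; rewrite D_passE.
Qed.

End NcEval.

Ltac D_reify y t :=
  match t with
  | y ?i => constr:(Gen i)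
  | 1 => constr:(@One D_gen)
  | - ?a => let a' := D_reify y a in constr:(Opp a')
  | ?a + ?b => let a' := D_reify y a in let b' := D_reify y b in constr:(Add a' b')
  | ?a * ?b => let a' := D_reify y a in let b' := D_reify y b in constr:(Mul a' b')
  | ?a ^+ ?n => let a' := D_reify y a in constr:(Exp a' n)
  end.

(* Proves an equality between expressions in the generators [y i] of [D]. *)
Ltac D_ring H :=
  try match goal with |- _ = 0 => rewrite -[RHS](subrr 1) end;
  match type of H with is_true (@D_holds _ _ ?y) =>
    match goal with |- ?a = ?b =>
      let e := D_reify y a in let f := D_reify y b in
      refine (@D_identity _ y _ H e f _); vm_compute; reflexivity
    end
  end.

(** ** The coproducts of [x_21] and [u_21] *)

Section Coproducts.
Variables (k : fieldType) (A : superAlgType k).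
Implicit Types a b c d : A.

Lemma smul22 (s t u v : tensor A A) :
  smul (s + t) (u + v) = smul s u + smul s v + (smul t u + smul t v).
Proof. by rewrite (linD (smul_linl _)) !(linD (smul_linr _)). Qed.

Lemma smul23 (s t u v w : tensor A A) :
  smul (s + t) (u + v - w) = smul s u + smul s v - smul s w +
    (smul t u + smul t v - smul t w).
Proof.
by rewrite (linD (smul_linl _)) !(linB (smul_linr _)) !(linD (smul_linr _)).
Qed.

Lemma smul32 (s t u v w : tensor A A) :
  smul (u + v - w) (s + t) = smul u s + smul u t + (smul v s + smul v t) -
    (smul w s + smul w t).
Proof.
by rewrite (linB (smul_linl _)) (linD (smul_linl _)) !(linD (smul_linr _)).
Qed.

(** The summands of the product of two skew-primitive elements, with the signs of
    the odd letters. The mixed terms [x_2 g ⊗ x_1] and [x_1 g ⊗ x_2] cancel, and what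
    remains is due to [g x_2 = (x_2 - x_1) g]. *)
Lemma tensor_x21 (Z : lmodType k) (T : A -> A -> Z) (x1 x2 g : A) :
  (forall w, linear (T^~ w)) -> (forall v, linear (T v)) ->
  g * x1 = x1 * g -> g * x2 = (x2 - x1) * g ->
  T (x2 * x1) 1 + T (x2 * g) x1 + (T (g * - x1) x2 + T (g * g) (x2 * x1))
  + (T (x1 * x2) 1 + T (x1 * g) x2 + (T (g * - x2) x1 + T (g * g) (x1 * x2)))
  = T (x2 * x1 + x1 * x2) 1 + T (g ^+ 2) (x2 * x1 + x1 * x2) + T (x1 * g) x1.
Proof.
move=> Tl Tr gx1 gx2; rewrite !mulrN gx1 gx2 expr2 mulrBl opprB.
rewrite (linB (Tl x1)) (linN (Tl x2)) (linD (Tl 1)) (linD (Tr (g * g))).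
move: (T (x2 * x1) 1) (T (x2 * g) x1) (T (x1 * g) x2) (T (g * g) _) (T (x1 * x2) 1)
  (T (x1 * g) x1) (T (g * g) _) => a b c d e f h.
rewrite (AC ((2*2)*(2*(2*1))) ((1*5)*(4*9)*7*((2*8)*(3*6)))) /=.
by rewrite subrr addNr !addr0.
Qed.

(** As before; the term [u_1 ⊗ u_1] is due to [u_1 zeta = zeta u_1 + u_1]. *)
Lemma tensor_u21 (Z : lmodType k) (T : A -> A -> Z) (u1 u2 z : A) :
  (forall w, linear (T^~ w)) -> (forall v, linear (T v)) ->
  u1 ^+ 2 = 0 -> u1 * z = z * u1 + u1 ->
  T (u1 * u2) 1 + T u1 u2 - T (u1 * z) u1 + (T (- u2) u1 + T 1 (u1 * u2) - T z (u1 * u1))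
  + (T (u2 * u1) 1 + T u2 u1 + (T (- u1) u2 + T 1 (u2 * u1)) - (T (z * - u1) u1 + T z (u1 * u1)))
  = T (u1 * u2 + u2 * u1) 1 + T 1 (u1 * u2 + u2 * u1) - T u1 u1.
Proof.
move=> Tl Tr u1u1 u1z; rewrite u1z mulrN -expr2 u1u1 !(lin0 (Tr z)) subr0 addr0.
rewrite !(linN (Tl _)) !(linD (Tl _)) (linD (Tr 1)) opprK.
move: (T (u1 * u2) 1) (T u1 u2) (T (z * u1) u1) (T u1 u1) (T u2 u1) (T 1 _)
  (T (u2 * u1) 1) (T 1 _) => a b c d e f h i.
rewrite opprD (AC ((2*2)*2*(2*2*1)) ((1*7)*(6*10)*4*((2*9)*(3*11)*(5*8)))) /=.
by rewrite !subrr !addNr !addr0.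
Qed.

End Coproducts.

Section ComulD.
Variables (k : fieldType) (A : hopfSuperAlgType k).

(** The coproduct of [X_1], with [T] and [Y_1] replaced by [g] and [x_1]. *)
Lemma comul_x21 (x1 x2 g : A) :
  homog true x1 -> homog true x2 -> homog false g ->
  comul x1 = x1 ⊗ 1 + g ⊗ x1 -> comul x2 = x2 ⊗ 1 + g ⊗ x2 ->
  g * x1 = x1 * g -> g * x2 = (x2 - x1) * g ->
  comul (x2 * x1 + x1 * x2) =
  (x2 * x1 + x1 * x2) ⊗ 1 + (g ^+ 2) ⊗ (x2 * x1 + x1 * x2) + (x1 * g) ⊗ x1.
Proof.
move=> hx1 hx2 hg c1 c2 gx1 gx2.
rewrite -(@tensor_x21 _ _ _ (fun a b : A => a ⊗ b) x1 x2 g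
  (@tens_linl k A A) (@tens_linr k A A) gx1 gx2).
have pure a b c d i c' e : homog i b -> sgn i c = c' -> b * d = e ->
    smul (a ⊗ b) (c ⊗ d) = (a * c') ⊗ e :> tensor A A.
  by move=> hb <- <-; apply: smulE_homog.
rewrite (linD (@comul_linear k A)) !comulM c1 c2.
have h1 := homog1 A.
apply: congr2; rewrite smul22; apply: congr2; apply: congr2.
- exact: (pure _ _ _ _ false _ _ h1 (sgn_even _) (mulr1 _)).
- exact: (pure _ _ _ _ false _ _ h1 (sgn_even _) (mul1r _)).
- exact: (pure _ _ _ _ true _ _ hx2 (sgn_homog1 hx1) (mulr1 _)).
- exact: (pure _ _ _ _ true _ _ hx2 (sgn_homog0 _ hg) erefl).
- exact: (pure _ _ _ _ false _ _ h1 (sgn_even _) (mulr1 _)).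
- exact: (pure _ _ _ _ false _ _ h1 (sgn_even _) (mul1r _)).
- exact: (pure _ _ _ _ true _ _ hx1 (sgn_homog1 hx2) (mulr1 _)).
- exact: (pure _ _ _ _ true _ _ hx1 (sgn_homog0 _ hg) erefl).
Qed.

(** The coproduct of [- X_2], with [Y_2] replaced by [u_1]: hence the sign in
    [X_2 |-> - u_21]. *)
Lemma comul_u21 (u1 u2 z : A) :
  homog true u1 -> homog true u2 -> homog false z ->
  comul u1 = u1 ⊗ 1 + 1 ⊗ u1 -> comul u2 = u2 ⊗ 1 + 1 ⊗ u2 - z ⊗ u1 ->
  u1 ^+ 2 = 0 -> u1 * z = z * u1 + u1 ->
  comul (u1 * u2 + u2 * u1) =
  (u1 * u2 + u2 * u1) ⊗ 1 + 1 ⊗ (u1 * u2 + u2 * u1) - u1 ⊗ u1.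
Proof.
move=> hu1 hu2 hz c1 c2 u1u1 u1z.
rewrite -(@tensor_u21 _ _ _ (fun a b : A => a ⊗ b) u1 u2 z
  (@tens_linl k A A) (@tens_linr k A A) u1u1 u1z).
have pure a b c d i c' e : homog i b -> sgn i c = c' -> b * d = e ->
    smul (a ⊗ b) (c ⊗ d) = (a * c') ⊗ e :> tensor A A.
  by move=> hb <- <-; apply: smulE_homog.
have h1 := homog1 A.
have pure0 a c d : smul (a ⊗ 1) (c ⊗ d) = (a * c) ⊗ d :> tensor A A.
  exact: (pure _ _ _ _ false _ _ h1 (sgn_even _) (mul1r _)).
have pure1 a b : homog true b -> smul (a ⊗ b) (1 ⊗ 1) = a ⊗ b :> tensor A A.
  by move=> hb; apply: etrans (pure _ _ _ _ true _ _ hb (sgn1 _ _) (mulr1 _)) _; rewrite mulr1.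
rewrite (linD (@comul_linear k A)) !comulM c1 c2.
have sub (Z : zmodType) (a b c d : Z) : a = c -> b = d -> a - b = c - d.
  by move=> -> ->.
have su2 := sgn_homog1 hu2; have su1 := sgn_homog1 hu1.
apply: congr2; [rewrite smul23; apply: congr2|rewrite smul32].
- apply: sub; [apply: congr2|]; [exact: pure0| |exact: pure0].
  by apply: etrans (pure0 _ _ _) _; rewrite mulr1.
- apply: sub; [apply: congr2|].
  + by apply: etrans (pure _ _ _ _ true _ _ hu1 su2 (mulr1 _)) _; rewrite mul1r.
  + by apply: etrans (pure _ _ _ _ true _ _ hu1 (sgn1 _ _) erefl) _; rewrite mulr1.
  + by apply: etrans (pure _ _ _ _ true _ _ hu1 (sgn_homog0 _ hz) erefl) _; rewrite mul1r.
apply: sub; [apply: congr2; apply: congr2|apply: congr2].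
- exact: pure0.
- by apply: etrans (pure0 _ _ _) _; rewrite mulr1.
- by apply: etrans (pure _ _ _ _ true _ _ hu2 su1 (mulr1 _)) _; rewrite mul1r.
- by apply: etrans (pure _ _ _ _ true _ _ hu2 (sgn1 _ _) erefl) _; rewrite mulr1.
- exact: (pure _ _ _ _ true _ _ hu1 su1 (mulr1 _)).
- by apply: etrans (pure _ _ _ _ true _ _ hu1 (sgn1 _ _) erefl) _; rewrite mulr1.
Qed.
End ComulD.

(** * The two morphisms *)

Section TwoMorphisms.
Variables (k : fieldType) (p : nat).
Hypotheses (p_char : p \in [pchar k]) (p_gt2 : (2 < p)%N).
Variables (R D U : hopfSuperAlgType k).
Variables (xR : R_gen -> R) (xD : D_gen -> D) (xU : osp_gen -> U).
Hypotheses (R_def : is_R p xR) (D_def : is_D p xD) (U_def : is_u_osp p xU).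

Lemma p_pred : p = p.-1.+1. Proof. by case: p p_gt2. Qed.

(** ** The generators of [D] *)

Let D_pres : presented_by D_par (fun r => r \in D_rels k p) xD.
Proof. by case: D_def. Qed.

Lemma D_relations : D_holds p xD.
Proof. by apply/D_holdsP => r /(presented_rel D_pres). Qed.
Let H := D_relations.

Lemma D_homog i : homog (D_par i) (xD i).
Proof. by case: D_pres. Qed.

Definition D_x21 : D := xD Dx2 * xD Dx1 + xD Dx1 * xD Dx2.
Definition D_u21 : D := xD Du1 * xD Du2 + xD Du2 * xD Du1.

Definition iota_gen (i : R_gen) : D :=
  match i with
  | RX1 => D_x21 | RX2 => - D_u21 | RT => xD Dg | RY1 => xD Dx1 | RY2 => xD Du1
  end.

Lemma iota_gen_comm i j : ~~ R_par i -> iota_gen i * iota_gen j = iota_gen j * iota_gen i.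
Proof.
by case: i; case: j => // _; rewrite /iota_gen /D_x21 /D_u21 ?mulNr ?mulrN; D_ring H.
Qed.

Lemma x21_p : D_x21 ^+ p = 0. Proof. exact: (D_holds_nth H (isT : (2 < 23)%N)). Qed.
Lemma u21_p : D_u21 ^+ p = 0. Proof. exact: (D_holds_nth H (isT : (6 < 23)%N)). Qed.
Lemma g_p : xD Dg ^+ p = 1.
Proof.
apply/eqP; rewrite -subr_eq0; apply/eqP.
exact: (D_holds_nth H (isT : (9 < 23)%N)).
Qed.
Lemma zeta_p : xD Dzeta ^+ p = xD Dzeta.
Proof.
apply/eqP; rewrite -subr_eq0; apply/eqP.
exact: (D_holds_nth H (isT : (8 < 23)%N)).
Qed.
Lemma x2_2p : xD Dx2 ^+ (2 * p) = 0.
Proof. exact: (D_holds_nth H (isT : (3 < 23)%N)). Qed.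
Lemma u2_2p : xD Du2 ^+ (2 * p) = 0.
Proof. exact: (D_holds_nth H (isT : (7 < 23)%N)). Qed.

Lemma iota_gen_rel r : R_rel p r -> free_eval iota_gen r = 0.
Proof.
case=> [i j ij|||||| ].
- by rewrite free_eval_comm iota_gen_comm // subrr.
- by rewrite free_evalX free_eval_gen /= x21_p.
- by rewrite free_evalX free_eval_gen /= exprNn u21_p mulr0.
- by rewrite free_eval_expB1 /= g_p subrr.
- by rewrite free_evalX free_eval_gen /=; D_ring H.
- by rewrite free_evalX free_eval_gen /=; D_ring H.
- rewrite free_eval_anticomm /=; D_ring H.
Qed.

Lemma T_p : xR RT ^+ p = 1.
Proof.
case: R_def => pres _; apply/eqP; rewrite -subr_eq0 -free_eval_expB1.
by apply/eqP; exact: (presented_rel pres (R_rel_T k p)).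
Qed.

Lemma counit_xR i : counit (xR i) = if i is RT then 1 else 0.
Proof.
have [pres [cX1 cT cX2 cY2 cY1]] := R_def.
have hX i' : homog (R_par i') (xR i') by case: pres.
have eT : counit (xR RT) = 1.
  by apply: (counit_grouplike cT (n := p.-1)); rewrite -p_pred T_p.
have eY1 := counit_odd (hX RY1); have eY2 := counit_odd (hX RY2).
case: i => //.
- by apply: (counit_skew2 cX1); rewrite ?expr2 ?counitM ?eY1 ?eT ?mul0r ?mulr1.
- by apply: (counit_skew2 cX2) => //; apply: counit1.
Qed.

Lemma iota_exists : exists iota : {lrmorphism R -> D},
  (forall i, iota (xR i) = iota_gen i) /\ hopf_morphism iota.
Proof.
have [pres [cX1 cT cX2 cY2 cY1]] := R_def.
have [iota iotaE] := presented_lift pres iota_gen_rel.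
exists iota; split=> //.
have il : linear iota by exact: linearP.
have h := D_homog.
have [_ [cg cz cu1 [cx1 cx2 cu2]]] := D_def.
have gx1 : xD Dg * xD Dx1 = xD Dx1 * xD Dg by D_ring H.
have gx2 : xD Dg * xD Dx2 = (xD Dx2 - xD Dx1) * xD Dg by D_ring H.
have c21 := comul_x21 (h Dx1) (h Dx2) (h Dg) cx1 cx2 gx1 gx2.
have u11 : xD Du1 ^+ 2 = 0 by D_ring H.
have u1z : xD Du1 * xD Dzeta = xD Dzeta * xD Du1 + xD Du1 by D_ring H.
have c21' := comul_u21 (h Du1) (h Du2) (h Dzeta) cu1 cu2 u11 u1z.
apply: (hopf_morphism_gen pres) => i; rewrite !iotaE.
- have h21 : homog false D_x21.
    by apply: homogD; [apply: (homogM (h Dx2) (h Dx1))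
                      |apply: (homogM (h Dx1) (h Dx2))].
  have h21' : homog false (- D_u21).
    apply: homogN; apply: homogD.
      exact: (homogM (h Du1) (h Du2)).
    exact: (homogM (h Du2) (h Du1)).
  by case: i => //=; [exact: (h Dg)|exact: (h Dx1)|exact: (h Du1)].
- have tl := tmap_linear il il.
  have tE a b := tmapE a b il il.
  have i1 : iota 1 = 1 := rmorph1 _.
  case: i => /=.
  + rewrite cX1 !(linD tl) !tE rmorphXn rmorphM /= i1 !iotaE; exact: c21.
  + rewrite cX2 !(linD tl) !tE i1 !iotaE /= (linN (@comul_linear k D)) c21'.
    rewrite (linN (tens_linl _)) (linN (tens_linr _)) opprB addrC opprD.
    exact: erefl.
  + by rewrite cT tE iotaE cg.
  + by rewrite cY1 (linD tl) !tE i1 !iotaE cx1.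
  + by rewrite cY2 (linD tl) !tE i1 !iotaE cu1.
- rewrite counit_xR.
  have eg : counit (xD Dg) = 1.
    by apply: (counit_grouplike cg (n := p.-1)); rewrite -p_pred; exact: g_p.
  have ex1 := counit_odd (h Dx1); have eu1 := counit_odd (h Du1).
  case: i => //=; rewrite ?linearN ?linearD /= ?counitM ?ex1 ?eu1 ?mulr0 ?mul0r;
    by rewrite ?addr0 ?oppr0.
Qed.

(** ** The projection to the enveloping algebra *)

Definition pi_gen (i : D_gen) : U :=
  match i with
  | Dx1 => 0 | Dx2 => xU Op | Du1 => 0 | Du2 => - xU Om | Dg => 1 | Dzeta => xU Oh
  end.

Let U_pres : presented_by osp_par (@u_osp_rel k p) xU. Proof. by case: U_def. Qed.

Let U_bracket i j : xU i * xU j - (-1) ^+ (osp_par i && osp_par j) *: (xU j * xU i) =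
     osp_eval xU (osp_bracket_basis k i j).
Proof. by apply: (u_osp_rel_bracketE (p := p)) => r /(presented_rel U_pres). Qed.

Lemma two_unit : (2%:R : k) != 0.
Proof.
rewrite -(dvdn_pcharf p_char); apply/negP => /dvdn_leq => /(_ isT).
by rewrite leqNgt p_gt2.
Qed.

Let oe := osp_eval_linear xU.

Lemma U_pp : xU Op ^+ 2 = xU Oe.
Proof.
have := U_bracket Op Op; rewrite /= (linZ oe) osp_eval_basis expr1 scaleN1r opprK.
rewrite -expr2 -mulr2n -scaler_nat => E.
by apply: (scalerI two_unit).
Qed.

Lemma U_mm : xU Om ^+ 2 = - xU Of.
Proof.
have := U_bracket Om Om; rewrite /= (linN oe) (linZ oe) osp_eval_basis expr1 scaleN1r opprK.
rewrite -expr2 -mulr2n -scaler_nat -scalerN => E.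
by apply: (scalerI two_unit).
Qed.

Lemma U_pm : xU Op * xU Om + xU Om * xU Op = - xU Oh.
Proof.
by have := U_bracket Op Om; rewrite /= (linN oe) osp_eval_basis expr1 scaleN1r opprK.
Qed.

Lemma U_hp : xU Oh * xU Op = xU Op * xU Oh + xU Op.
Proof.
have := U_bracket Oh Op; rewrite /= osp_eval_basis scale1r => /eqP.
by rewrite subr_eq addrC => /eqP.
Qed.

Lemma U_hm : xU Oh * xU Om = xU Om * xU Oh - xU Om.
Proof.
have := U_bracket Oh Om; rewrite /= (linN oe) osp_eval_basis scale1r => /eqP.
by rewrite subr_eq addrC => /eqP.
Qed.

Lemma U_pmap i : osp_par i = false ->
  osp_eval xU (osp_pmap p (osp_basis k i)) = xU i ^+ p.
Proof.
move=> hi; have hom : osp_homog false (osp_basis k i) by rewrite -hi; apply: osp_basis_homog.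
have := presented_rel U_pres (u_osp_rel_pmap p hom).
move/(etrans (esym (free_evalB xU (osp_free (osp_pmap p (osp_basis k i)))
  (osp_free (osp_basis k i) ^+ p)))) => /eqP.
rewrite subr_eq0 => /eqP E; apply: etrans (esym (free_eval_osp xU _)) (etrans E _).
have E' := free_evalX xU (osp_free (osp_basis k i)) p.
by rewrite free_eval_osp osp_eval_basis in E'.
Qed.

Lemma pi_gen_holds : D_holds p pi_gen.
Proof.
have [e_p f_p h_p] := osp_pmapE k (pchar_odd p_char p_gt2) p_gt2.
have ep : xU Oe ^+ p = 0 by rewrite -U_pmap // e_p linear0.
have fp : xU Of ^+ p = 0 by rewrite -U_pmap // f_p linear0.
have hp : xU Oh ^+ p = xU Oh by rewrite -U_pmap // h_p osp_eval_basis.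
have p0 : (p == 0)%N = false by rewrite p_pred.
rewrite /D_holds /= !(mul0r, mulr0, addr0, add0r, subr0, oppr0, mul1r, mulr1,
  expr0n, expr1n, subrr, eqxx) /=.
rewrite p0 !exprM sqrrN U_pp U_mm exprNn ep fp mulr0 hp !subrr !eqxx /=.
have mh : xU Om * xU Oh = xU Oh * xU Om + xU Om by rewrite U_hm addrNK.
rewrite U_hp subrr eqxx /= !mulNr !mulrN opprK mh.
rewrite -[- (_ * _) - xU Om]opprD subrr eqxx /=.
have -> : xU Oh = - (xU Op * xU Om) - xU Om * xU Op by rewrite -opprD U_pm opprK.
by rewrite addNKr subrr eqxx.
Qed.

Lemma pi_exists : exists pi : {lrmorphism D -> U},
  (forall i, pi (xD i) = pi_gen i) /\ hopf_morphism pi.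
Proof.
have /D_holdsP rel0 := pi_gen_holds.
have [pi piE] := presented_lift D_pres rel0.
exists pi; split=> //.
have pl : linear pi by exact: linearP.
have h := D_homog.
have [_ [cg cz cu1 [cx1 cx2 cu2]]] := D_def.
have [U_homog _ _] := U_pres; have [_ cU] := U_def.
have tl := tmap_linear pl pl.
have tE a b := tmapE a b pl pl.
have i1 : pi 1 = 1 := rmorph1 _.
have eg : counit (xD Dg) = 1.
  by apply: (counit_grouplike cg (n := p.-1)); rewrite -p_pred; exact: g_p.
have eU i : counit (xU i) = 0 by apply: (counit_skew (cU i)); apply: counit1.
apply: (hopf_morphism_gen D_pres) => i; rewrite !piE.
- case: i => /=.
  + exact: linear0.
  + exact: (U_homog Op).
  + exact: linear0.
  + exact: (homogN (U_homog Om)).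
  + exact: homog1.
  + exact: (U_homog Oh).
- case: i => /=.
  + rewrite cx1 (linD tl) !tE i1 !piE /= (lin0 (@comul_linear k U)).
    by rewrite tens0l tens0r addr0.
  + by rewrite cx2 (linD tl) !tE i1 !piE /= cU.
  + rewrite cu1 (linD tl) !tE i1 !piE /= (lin0 (@comul_linear k U)).
    by rewrite tens0l tens0r addr0.
  + rewrite cu2 (linB tl) (linD tl) !tE i1 !piE /= tens0r subr0.
    rewrite (linN (@comul_linear k U)) cU opprD.
    by rewrite (linN (tens_linl _)) (linN (tens_linr _)).
  + by rewrite cg tE !piE comul1.
  + by rewrite cz (linD tl) !tE i1 !piE /= cU.
- case: i => /=.
  + by rewrite linear0 (counit_odd (h Dx1)).
  + by rewrite eU (counit_odd (h Dx2)).
  + by rewrite linear0 (counit_odd (h Du1)).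
  + by rewrite linearN /= eU oppr0 (counit_odd (h Du2)).
  + by rewrite counit1 eg.
  + by rewrite eU (counit_skew cz counit1).
Qed.

End TwoMorphisms.

(** * Stripping off the powers of an element *)

Section Layers.
Variables (k : fieldType) (A : algType k).
Implicit Types (S K : A -> Prop) (a r s : A).

Definition subspace S := S 0 /\ forall (c : k) a a', S a -> S a' -> S (c *: a + a').

Lemma subspaceD S a b : subspace S -> S a -> S b -> S (a + b).
Proof. by move=> [_ HS] Sa Sb; rewrite -[a]scale1r; apply: HS. Qed.
Lemma subspaceZ S c a : subspace S -> S a -> S (c *: a).
Proof. by move=> [S0 HS] Sa; rewrite -[_ *: _]addr0; apply: HS. Qed.
Lemma subspaceN S a : subspace S -> S a -> S (- a).
Proof. by move=> HS Sa; rewrite -scaleN1r; apply: subspaceZ. Qed.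
Lemma subspaceB S a b : subspace S -> S a -> S b -> S (a - b).
Proof. by move=> HS Sa Sb; apply: subspaceD => //; apply: subspaceN. Qed.

(** Sums that need not be direct: the algebras of interest are first seen to be
    spanned by monomials, in the form of iterated [powers] and [pairs], and the
    coefficients are shown to be unique afterwards. *)
Definition powers n (X : A) S r := exists f : nat -> A,
  (forall b, S (f b)) /\ r = \sum_(b < n) X ^+ b * f b.
Definition pairs (Y : A) S r := exists a b, [/\ S a, S b & r = a + Y * b].

Lemma powers_subspace n X S : subspace S -> subspace (powers n X S).
Proof.
move=> HS; split=> [|c a b [f [Sf ->]] [g [Sg ->]]].
  by exists (fun=> 0); split=> [_|]; [case: HS|rewrite big1 // => b _; rewrite mulr0].
exists (fun i => c *: f i + g i); split=> [i|]; first by case: HS => _; apply.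
rewrite scaler_sumr -big_split; apply: eq_bigr => i _.
by rewrite mulrDr scalerAr.
Qed.

Lemma pairs_subspace Y S : subspace S -> subspace (pairs Y S).
Proof.
move=> HS; have [S0 HS'] := HS.
split=> [|c _ _ [a [b [Sa Sb ->]]] [a' [b' [Sa' Sb' ->]]]].
  by exists 0, 0; rewrite mulr0 addr0.
exists (c *: a + a'), (c *: b + b'); split; [exact: HS'|exact: HS'|].
by rewrite scalerDr mulrDr -scalerAr addrACA.
Qed.

Lemma powers_sub n X S s : subspace S -> S s -> powers n.+1 X S s.
Proof.
move=> [S0 _] Ss; exists (fun b => if b == 0%N then s else 0); split=> [b|].
  by case: ifP.
by rewrite big_ord_recl expr0 mul1r big1 ?addr0 // => b _; rewrite mulr0.
Qed.

Lemma pairs_sub Y S s : subspace S -> S s -> pairs Y S s.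
Proof. by move=> [S0 _] Ss; exists s, 0; rewrite mulr0 addr0. Qed.

Lemma powers_mull n X S y r : y * X = X * y -> (forall s, S s -> S (y * s)) ->
  powers n X S r -> powers n X S (y * r).
Proof.
move=> yX HS [f [Sf ->]]; exists (fun b => y * f b); split=> [b|]; first exact: HS.
rewrite mulr_sumr; apply: eq_bigr => b _.
by rewrite !mulrA (commrX b yX).
Qed.

Lemma powers_mulX n X S r : subspace S -> X ^+ n = 0 ->
  powers n X S r -> powers n X S (X * r).
Proof.
move=> [S0 _] Xn [f [Sf ->]]; exists (fun b => if b is b'.+1 then f b' else 0).
split=> [[|b]|]; rewrite // mulr_sumr; case: n Xn f Sf => [|n] Xn f Sf; first by rewrite !big_ord0.
rewrite big_ord_recr [RHS]big_ord_recl /= mulr0 add0r mulrA -exprS Xn mul0r addr0.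
by apply: eq_bigr => b _; rewrite mulrA -exprS.
Qed.

Lemma pairs_mull Y S y r (e : k) : subspace S -> y * Y = e *: (Y * y) ->
  (forall s, S s -> S (y * s)) -> pairs Y S r -> pairs Y S (y * r).
Proof.
move=> HS yY H [a [b [Sa Sb ->]]]; exists (y * a), (y * (e *: b)).
split; [exact: H|by apply: H; apply: subspaceZ|].
by rewrite mulrDr !mulrA yY -scalerAl -scalerAr.
Qed.

Lemma pairs_mulY Y S r : subspace S -> Y ^+ 2 = 0 -> pairs Y S r -> pairs Y S (Y * r).
Proof.
move=> [S0 _] YY [a [b [Sa Sb ->]]]; exists 0, a; split=> //.
by rewrite mulrDr mulrA -expr2 YY mul0r addr0 add0r.
Qed.

(** Suppose [E] differs from a commuting operator with [X] by [w], as a derivation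
    with [E X = w] does, and that it vanishes on [S]. Then [E^n] annihilates
    [X^b S] for [b < n] and maps [X^n s] to [n! w^n s]: the coefficients in [S] of a
    polynomial in [X] can be recovered, by descending induction on the degree. *)
Lemma powers_elim p n (K S : A -> Prop) (X : A) (E w : A -> A) :
  p \in [pchar k] -> (n <= p)%N ->
  subspace K -> (forall r, K r -> K (X * r)) -> (forall r, K r -> K (E r)) ->
  linear E -> linear w -> (forall r, E (X * r) = X * E r + w r) ->
  (forall r, w (X * r) = X * w r) ->
  (forall s, S s -> E s = 0) -> (forall s, S s -> S (w s)) ->
  (forall s, S s -> K (w s) -> K s) ->
  forall f : nat -> A, (forall b, S (f b)) -> K (\sum_(b < n) X ^+ b * f b) ->
  forall b, (b < n)%N -> K (f b).
Proof.
move=> p_char n_le HK KX KE El wl EX wX ES Sw Kw f Sf.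
have wXn b r : w (X ^+ b * r) = X ^+ b * w r.
  by elim: b r => [|b IH] r; rewrite ?expr0 ?mul1r // exprS -mulrA wX IH mulrA.
have EXn b s : S s -> E (X ^+ b * s) = b%:R *: (X ^+ b.-1 * w s).
  move=> Ss; elim: b => [|b IH]; first by rewrite expr0 mul1r ES // scale0r.
  rewrite exprS -mulrA EX IH wXn; case: b {IH} => [|b]; first by rewrite scale0r mulr0 add0r expr0 scale1r.
  by rewrite -scalerAr mulrA -exprS /= -[X in _ + X]scale1r -scalerDl natr1.
have EnX m b s : S s -> (b <= m)%N ->
    iter m E (X ^+ b * s) = (b == m)%:R *: ((m`!)%:R *: iter m w s).
  elim: m b s => [|m IH] b s Ss b_le.
    by move: b_le; rewrite leqn0 => /eqP ->; rewrite expr0 mul1r !scale1r.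
  rewrite iterSr EXn //; have El' j : linear (iter j E).
    by elim: j => [|j IHj] // z x y; rewrite /= IHj El.
  rewrite (linZ (El' m)).
  case: b b_le => [|b] b_le /=.
    by rewrite !scale0r.
  rewrite IH //; last exact: Sw.
  rewrite eqSS -iterSr; case: eqP => [->|_]; last by rewrite !scale0r scaler0.
  by rewrite !scale1r scalerA factS natrM.
have Sit j s : S s -> S (iter j w s) by elim: j s => // j IH s Ss /=; apply/Sw/IH.
have Kit j s : S s -> K (iter j w s) -> K s.
  elim: j s => // j IH s Ss; rewrite iterSr => Kj; apply: Kw => //.
  by apply: IH => //; apply: Sw.
elim: n n_le => // n IH n_lt; rewrite big_ord_recr /= => Ksum.
have Kn : K (f n).
  apply: (Kit n) => //; have nf : (n`!)%:R != 0 :> k.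
    rewrite -(dvdn_pcharf p_char); have p_pr := pcharf_prime p_char.
    elim: n n_lt {IH Ksum} => [|n IH] n_lt; first by rewrite fact0 dvdn1 eqn_leq leqNgt prime_gt1.
    rewrite factS Euclid_dvdM // negb_or IH ?(ltnW n_lt) // andbT.
    by rewrite gtnNdvd.
  rewrite -[iter n w _]scale1r -(mulVf nf) -scalerA; apply: subspaceZ => //.
  have El' : linear (iter n E).
    by elim: (n) => [|j IHj] // z x y; rewrite /= IHj El.
  have : K (iter n E (\sum_(i < n) X ^+ i * f i + X ^+ n * f n)).
    by elim: (n in iter n) => //= j; apply: KE.
  rewrite (linD El') (lin_sum El') big1 => [|i _].
    by rewrite add0r EnX // eqxx scale1r.
  by rewrite EnX 1?ltnW // ltn_eqF // scale0r.
have KXn : K (X ^+ n * f n).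
  by elim: (n in X ^+ n) => [|j IHj]; rewrite ?expr0 ?mul1r // exprS -mulrA; apply: KX.
move=> b; rewrite ltnS leq_eqVlt => /orP[/eqP -> //|]; apply: IH; first exact: ltnW.
by rewrite -[X in K X](addrK (X ^+ n * f n)); apply: subspaceB.
Qed.

End Layers.

(** * The map from [R] to [D] is injective *)

(** The values on products of the operator [hit phi], for [phi] a derivation at the
    unit in the direction of [xR i0], that is, [phi (a * b) = phi a * counit b +
    counit a * phi b] and [phi (xR i) = c] if [i] is [i0] and 0 otherwise. *)
Definition derivation_at (k : fieldType) (R : hopfSuperAlgType k) (xR : R_gen -> R)
    (i0 : R_gen) (c : k) (E : R -> R) :=
  let delta i := if i == i0 then c else 0 in
  [/\ linear E, E 1 = 0 & [/\
  forall r, E (xR RT * r) = xR RT * (delta RT *: r + E r),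
  forall r, E (xR RX1 * r) = xR RX1 * E r + delta RX1 *: (xR RT ^+ 2 * r)
     + delta RY1 *: (xR RY1 * xR RT * sgn true r),
  forall r, E (xR RX2 * r) = xR RX2 * E r + delta RX2 *: r
     + delta RY2 *: (xR RY2 * sgn true r),
  forall r, E (xR RY1 * r) = xR RY1 * E r + delta RY1 *: (xR RT * sgn true r)
& forall r, E (xR RY2 * r) = xR RY2 * E r + delta RY2 *: sgn true r]].

Section Injectivity.
Variables (k : fieldType) (p : nat).
Hypotheses (p_char : p \in [pchar k]) (p_gt2 : (2 < p)%N).
Variables (R D : hopfSuperAlgType k) (xR : R_gen -> R) (xD : D_gen -> D).
Hypotheses (R_def : is_R p xR) (D_def : is_D p xD).
Variable iota : {lrmorphism R -> D}.
Hypotheses (iotaE : forall i, iota (xR i) = iota_gen xD i)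
  (iota_hopf : hopf_morphism iota).

Let R_pres : presented_by R_par (@R_rel k p) xR. Proof. by case: R_def. Qed.
Let R_homog i : homog (R_par i) (xR i). Proof. by case: R_pres. Qed.
Let eR i : counit (xR i) = if i is RT then 1 else 0 := counit_xR p_gt2 R_def i.

Lemma R_comm i j : ~~ R_par i -> xR i * xR j = xR j * xR i.
Proof.
move=> ij; apply/eqP; rewrite -subr_eq0 -free_eval_comm; apply/eqP.
exact: (presented_rel R_pres (R_rel_comm k p j ij)).
Qed.

Lemma R_nilp i n : R_rel p (gen k i ^+ n) -> xR i ^+ n = 0.
Proof. by move=> /(presented_rel R_pres); rewrite free_evalX free_eval_gen. Qed.

Lemma Y_anticomm : xR RY2 * xR RY1 = - (xR RY1 * xR RY2).
Proof.
apply/eqP; rewrite -addr_eq0 addrC -free_eval_anticomm; apply/eqP.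
exact: (presented_rel R_pres (R_rel_Y12 k p)).
Qed.

(** The first-order terms of the generators of [R] in the representation of [D]:
    [- 2 e, - 2 f, h, - psi_+, psi_-], a basis of osp(1|2). *)
Definition infin_rows (i : R_gen) : seq (seq int) :=
  match i with
  | RX1 => [:: [:: 0; 0; -2]; [:: 0; 0; 0]; [:: 0; 0; 0]]
  | RX2 => [:: [:: 0; 0; 0]; [:: 0; 0; 0]; [:: -2; 0; 0]]
  | RT => nat_rows Oh
  | RY1 => neg_rows (nat_rows Op)
  | RY2 => nat_rows Om
  end.

Definition infin (i : R_gen) : 'M[k]_6 := imx k 5 (block_rows zero_rows (infin_rows i)).

Lemma infin_mul i j : infin i * infin j = 0.
Proof. by case: i; case: j; rewrite /infin; imx_compute. Qed.

Variable rho : {lrmorphism D -> 'M[k]_6}.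
Hypothesis rhoE : forall i, rho (xD i) = def_rep k i.

Lemma rho_iota_gen i : rho (iota (xR i)) = counit (xR i) *: 1 + infin i.
Proof.
rewrite iotaE eR; case: i => /=; rewrite ?scale0r ?add0r ?scale1r;
  rewrite /D_x21 /D_u21 ?rmorphN ?rmorphD /= ?rmorphM /= !rhoE /def_rep /infin;
  imx_compute.
Qed.

(** First-order terms multiply to zero, so [R] acts on them through the counit. *)
Lemma infin_rho i r : infin i * rho (iota r) = counit r *: infin i.
Proof.
elim/(presented_ind R_pres): r => [|a b Ha Hb|c a Ha||j a Ha].
- by rewrite !linear0 mulr0 scale0r.
- by rewrite !linearD /= mulrDr Ha Hb -scalerDl.
- by rewrite !linearZ /= -scalerAr Ha scalerA.
- by rewrite !rmorph1 mulr1 counit1 scale1r.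
- rewrite !rmorphM /= mulrA rho_iota_gen mulrDr infin_mul addr0.
  by rewrite -scalerAr mulr1 -scalerAl Ha scalerA counitM.
Qed.

Section Entry.
Variables (i0 : R_gen) (v w : 'I_6) (c : k).
Hypothesis vw : v != w.
Hypothesis infin_vw : forall i, infin i v w = if i == i0 then c else 0.

Let phi (r : R) : k := rho (iota r) v w.
Let E := hit phi.
Let delta i : k := if i == i0 then c else 0.

Let phi_lin : scalar phi.
Proof. by move=> z a b; rewrite /phi !linearP !mxE. Qed.

(* The entry [v, w] vanishes on the scalar part, by [vw], so it is a derivation at
   the unit. *)
Let phiM i r : phi (xR i * r) = delta i * counit r + counit (xR i) * phi r.
Proof.
rewrite /phi !rmorphM /= rho_iota_gen mulrDl infin_rho -scalerAl mul1r mxE.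
rewrite [(_ *: rho _) _ _]mxE [(_ *: infin _) _ _]mxE infin_vw.
by rewrite addrC [X in X + _]mulrC.
Qed.

Let hit_phiM i r : hit (fun d => phi (xR i * d)) r = delta i *: r + counit (xR i) *: E r.
Proof.
rewrite (@hit_comb _ _ (delta i) counit (fun d => counit (xR i) * phi d)); last exact: phiM.
rewrite hit_counit (@hit_comb _ _ (counit (xR i)) phi (fun=> 0)).
  by rewrite hit0 addr0.
by move=> d; rewrite addr0.
Qed.

Let derivation_atP : derivation_at xR i0 c E.
Proof.
have [_ [cX1 cT cX2 cY2 cY1]] := R_def.
have h := R_homog.
split; first exact: hit_linear.
  by rewrite /E hit1 // /phi !rmorph1 mxE (negPf vw) scale0r.
split=> r.
- by rewrite /E (hitM1 _ phi_lin (h RT) cT) hit_phiM sgn_even eR scale1r.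
- rewrite /E (hitM_skew2 _ phi_lin (h RX1) (h RY1) cX1) !hit_phiM !eR !scale0r !addr0.
  by rewrite sgn_even linearZ /= -!scalerAr.
- rewrite /E (hitM_skew2 _ phi_lin (h RX2) (h RY2) cX2) !hit_phiM !eR !scale0r !addr0.
  by rewrite sgn_even linearZ /= -!scalerAr mul1r.
- rewrite /E (hitM_skew _ phi_lin (h RY1) cY1) !hit_phiM !eR !scale0r !addr0.
  by rewrite linearZ /= -!scalerAr.
- rewrite /E (hitM_skew _ phi_lin (h RY2) cY2) !hit_phiM !eR !scale0r !addr0.
  by rewrite linearZ /= mul1r.
Qed.

Let derivation_at_ker r : iota r = 0 -> iota (E r) = 0.
Proof.
move=> ir; have [_ cf _ _] := iota_hopf.
have pl : scalar (fun d => rho d v w) by move=> z a b; rewrite !linearP !mxE.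
rewrite /E -(hit_morph cf r pl) ir.
exact: lin0 (hit_linear pl).
Qed.

Lemma entry_derivation : exists E : R -> R, derivation_at xR i0 c E /\
  forall r, iota r = 0 -> iota (E r) = 0.
Proof. by exists E; split. Qed.

End Entry.

Lemma derivation_exists i0 : exists c (E : R -> R),
  [/\ c != 0, derivation_at xR i0 c E & forall r, iota r = 0 -> iota (E r) = 0].
Proof.
have two0 : (2 : k) != 0 := two_unit p_char p_gt2.
have neq v w (c : k) : v != w -> c != 0 ->
    (forall i, infin i v w = if i == i0 then c else 0) -> exists c (E : R -> R),
    [/\ c != 0, derivation_at xR i0 c E & forall r, iota r = 0 -> iota (E r) = 0].
  by move=> vw c0 /(entry_derivation vw)[E [HE KE]]; exists c, E.
(* In the upper right block, each of these five entries vanishes on all elements of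
   the basis of osp(1|2) but one. *)
pose o m (lt : (m < 6)%N) := Ordinal lt.
case: i0 neq => neq.
- apply: (neq (@o 0%N isT) (@o 5%N isT) (-2)); rewrite ?oppr_eq0 //.
  by case; rewrite /infin mxE.
- apply: (neq (@o 2%N isT) (@o 3%N isT) (-2)); rewrite ?oppr_eq0 //.
  by case; rewrite /infin mxE.
- apply: (neq (@o 0%N isT) (@o 3%N isT) 1); rewrite ?oner_eq0 //.
  by case; rewrite /infin mxE.
- apply: (neq (@o 0%N isT) (@o 4%N isT) (-1)); rewrite ?oppr_eq0 ?oner_eq0 //.
  by case; rewrite /infin mxE.
- apply: (neq (@o 1%N isT) (@o 3%N isT) (-1)); rewrite ?oppr_eq0 ?oner_eq0 //.
  by case; rewrite /infin mxE.
Qed.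

(** ** A spanning set of [R] *)

Let T := xR RT. Let X1 := xR RX1. Let X2 := xR RX2.
Let Y1 := xR RY1. Let Y2 := xR RY2.

Definition poly_T (r : R) := exists P : {poly k}, r = horner_alg T P.
Definition span_Y2 := pairs Y2 poly_T.
Definition span_Y := pairs Y1 span_Y2.
Definition span_X2 := powers p X2 span_Y.
Definition span_R := powers p X1 span_X2.

Lemma poly_T_subspace : subspace poly_T.
Proof.
split=> [|c _ _ [P ->] [Q ->]]; first by exists 0; rewrite rmorph0.
by exists (c *: P + Q); rewrite linearD linearZ /= mulr_algl.
Qed.

Let sY2 := pairs_subspace Y2 poly_T_subspace.
Let sY := pairs_subspace Y1 sY2.
Let sX2 := powers_subspace p X2 sY.

Lemma poly_T_mulT r : poly_T r -> poly_T (T * r).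
Proof. by move=> [P ->]; exists ('X * P); rewrite rmorphM /= horner_algX. Qed.

Let Y2T s : span_Y2 s -> span_Y2 (T * s).
Proof.
by apply: (pairs_mull (e := 1) poly_T_subspace _ poly_T_mulT); rewrite scale1r; apply: R_comm.
Qed.

Let YT s : span_Y s -> span_Y (T * s).
Proof.
by apply: (pairs_mull (e := 1) sY2 _ Y2T); rewrite scale1r; apply: R_comm.
Qed.

Let X2T s : span_X2 s -> span_X2 (T * s).
Proof. by apply: (powers_mull _ YT); apply: R_comm. Qed.

(** The left-hand letters commute, up to sign, with all others, so each of the layers
    is stable under the letters to its right, and the whole under every letter. *)
Lemma span_R_all r : span_R r.
Proof.
have Y2Y2 s : span_Y2 s -> span_Y2 (Y2 * s).
  by apply: (pairs_mulY poly_T_subspace); exact: (R_nilp (R_rel_Y2 k p)).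
have YY2 s : span_Y s -> span_Y (Y2 * s).
  apply: (pairs_mull sY2 (e := -1) _ Y2Y2).
  by rewrite scaleN1r; apply: Y_anticomm.
have X2Y2 s : span_X2 s -> span_X2 (Y2 * s).
  by apply: (powers_mull _ YY2); rewrite [RHS]R_comm.
have YY1 s : span_Y s -> span_Y (Y1 * s).
  by apply: (pairs_mulY sY2); exact: (R_nilp (R_rel_Y1 k p)).
have X2Y1 s : span_X2 s -> span_X2 (Y1 * s).
  by apply: (powers_mull _ YY1); rewrite [RHS]R_comm.
have X2X2 s : span_X2 s -> span_X2 (X2 * s).
  by apply: (powers_mulX sY); exact: (R_nilp (R_rel_X2 k p)).
have [R0 RZ] : subspace span_R by apply: (powers_subspace p X1 sX2).
elim/(presented_ind R_pres): r => [//|a b Ra Rb|c a Ra||[] a Ra].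
- by rewrite -[a]scale1r; apply: RZ.
- by rewrite -[_ *: _]addr0; apply: RZ.
- rewrite /span_R /span_X2 (p_pred p_gt2); apply: (powers_sub _ _ (powers_subspace _ _ sY)).
  apply: (powers_sub _ _ sY); apply: (pairs_sub _ sY2); apply: (pairs_sub _ poly_T_subspace).
  by exists 1; rewrite rmorph1.
- by apply: (powers_mulX sX2) Ra; exact: (R_nilp (R_rel_X1 k p)).
- by apply: (powers_mull _ X2X2) Ra; apply: R_comm.
- by apply: (powers_mull _ X2T) Ra; apply: R_comm.
- by apply: (powers_mull _ X2Y1) Ra; rewrite [RHS]R_comm.
- by apply: (powers_mull _ X2Y2) Ra; rewrite [RHS]R_comm.
Qed.

(** ** Injectivity *)

Let K (r : R) := iota r = 0.

Let K_subspace : subspace K.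
Proof.
split=> [|c a b]; rewrite /K ?linear0 // linearD linearZ /= => -> ->.
by rewrite scaler0 addr0.
Qed.

Let K_mull y r : K r -> K (y * r).
Proof. by rewrite /K rmorphM /= => ->; rewrite mulr0. Qed.

Let K_T r : K (T * r) -> K r.
Proof.
move=> /(K_mull (T ^+ p.-1)); rewrite mulrA -exprSr -(p_pred p_gt2) (T_p R_def) mul1r.
by [].
Qed.

Let K_sgn r : K (sgn true r) -> K r.
Proof.
have [f_even _ _ _] := iota_hopf.
rewrite /K (sgn_morph f_even) => /(congr1 (sgn true)).
by rewrite sgnK linear0.
Qed.

Let K_scale c r : c != 0 -> K (c *: r) -> K r.
Proof. by rewrite /K linearZ /= => c0 /eqP; rewrite scaler_eq0 (negPf c0) => /eqP. Qed.

Let kerT E i c P : derivation_at xR i c E -> i != RT -> E (horner_alg T P) = 0.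
Proof.
move=> [El E1 [ET _ _ _ _]] iT.
elim/poly_ind: P => [|P a IH]; first by rewrite rmorph0 (lin0 El).
rewrite [P * 'X]mulrC rmorphD rmorphM /= horner_algX horner_algC (linD El) ET IH.
by rewrite eq_sym (negPf iT) scale0r addr0 mulr0 add0r (linZ El) E1 scaler0.
Qed.

Let ker_powers (E : R -> R) (X : R) (S : R -> Prop) n :
  linear E -> (forall r, E (X * r) = X * E r) ->
  (forall s, S s -> E s = 0) -> forall s, powers n X S s -> E s = 0.
Proof.
move=> El EX ES _ [f [Sf ->]]; rewrite (lin_sum El) big1 // => b _.
elim: (nat_of_ord b) (f b) (Sf b) => [|m IH] s Ss; first by rewrite expr0 mul1r ES.
by rewrite exprS -mulrA EX IH // mulr0.
Qed.

Let ker_pairs (E : R -> R) (Y : R) (S : R -> Prop) :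
  linear E -> (forall r, E (Y * r) = Y * E r) ->
  (forall s, S s -> E s = 0) -> forall s, pairs Y S s -> E s = 0.
Proof.
move=> El EY ES _ [a [b [Sa Sb ->]]].
by rewrite (linD El) EY !ES // mulr0 addr0.
Qed.

Let K_powers (X : R) (S : R -> Prop) (w : R -> R) (c : k) (E : R -> R) :
  (forall r, E (X * r) = X * E r + c *: w r) ->
  c != 0 -> linear E -> linear w ->
  (forall r, w (X * r) = X * w r) -> (forall r, K r -> K (E r)) ->
  (forall s, S s -> E s = 0) -> (forall s, S s -> S (w s)) ->
  (forall s, S s -> S (c *: s)) ->
  (forall r, K (w r) -> K r) ->
  (forall s, S s -> K s -> s = 0) -> forall s, powers p X S s -> K s -> s = 0.
Proof.
move=> EX c0 El wl wX KE ES Sw Sc Kw K0 _ [f [Sf ->]] Ks.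
apply: big1 => b _; rewrite (K0 (f b)) ?mulr0 //.
apply: (powers_elim (w := fun r => c *: w r) p_char (leqnn p) K_subspace
  _ KE El _ EX _ ES) Ks _ _ => //.
- by move=> r; apply: K_mull.
- by move=> z x y; rewrite wl scalerDr !scalerA mulrC.
- by move=> r; rewrite wX scalerAr.
- by move=> s Ss; apply/Sc/Sw.
- by move=> s Ss /(K_scale c0)/Kw.
Qed.

Let K_one : ~ K 1.
Proof. by rewrite /K rmorph1 => /eqP; rewrite oner_eq0. Qed.

(* [T d/dT] acts on [T^a] by the scalar [a], and these scalars are distinct for
   [a < p]. *)
Let K_horner n (P : {poly k}) : (n <= p)%N -> (size P <= n)%N ->
  K (horner_alg T P) -> P = 0.
Proof.
have [c [E [c0 [El E1 [ET _ _ _ _]] KE]]] := derivation_exists RT.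
have EP (Q : {poly k}) : E (horner_alg T Q) = c *: horner_alg T ('X * Q^`()).
  elim/poly_ind: Q => [|Q a IH]; first by rewrite deriv0 mulr0 !rmorph0 (lin0 El) scaler0.
  rewrite derivD derivC addr0 derivM derivX mulr1 [Q * 'X]mulrC.
  rewrite rmorphD rmorphM /= horner_algX horner_algC (linD El) ET eqxx IH.
  rewrite (linZ El) E1 scaler0 addr0 -scalerDr -scalerAr; congr (_ *: _).
  by rewrite [Q^`() * 'X]mulrC !(rmorphM, rmorphD) /= horner_algX addrC.
elim: n P => [|n IH] P n_le szP KP; first by apply/eqP; rewrite -size_poly_leq0.
pose Q := 'X * P^`() - n%:R *: P.
have Qa a : Q`_a = (a%:R - n%:R) * P`_a.
  rewrite coefB coefZ coefXM mulrBl; congr (_ - _).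
  by case: a => [|a] /=; rewrite ?mul0r // coef_deriv mulr_natl.
have Q0 : Q = 0.
  apply: IH; first exact: ltnW.
    apply/leq_sizeP => a; rewrite leq_eqVlt => /orP[/eqP <-|na].
      by rewrite Qa subrr mul0r.
    by rewrite Qa (leq_sizeP _ _ szP) // mulr0.
  have /(K_scale c0) KX : K (c *: horner_alg T ('X * P^`())) by rewrite -EP; apply: KE.
  rewrite /Q linearB linearZ /= mulr_algl.
  by apply: (subspaceB K_subspace KX); apply: (subspaceZ _ K_subspace).
have PE : P = P`_n *: 'X^n.
  apply/polyP => a; rewrite coefZ coefXn; case: (ltngtP a n) => [an|na|->].
  - rewrite mulr0; have /eqP : Q`_a = 0 by rewrite Q0 coef0.
    rewrite Qa mulf_eq0 => /orP[|/eqP //]; rewrite -opprB oppr_eq0 -natrB ?(ltnW an) //.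
    rewrite -(dvdn_pcharf p_char) => /dvdn_leq; rewrite subn_gt0 => /(_ an).
    by rewrite leqNgt (leq_ltn_trans (leq_subr _ _)).
  - by rewrite mulr0 (leq_sizeP _ _ szP).
  - by rewrite mulr1.
have [P0|P0] := eqVneq P`_n 0; first by rewrite PE P0 scale0r.
move: KP; rewrite PE linearZ /= mulr_algl => /(K_scale P0).
rewrite rmorphXn /= horner_algX => KT; case: K_one.
by elim: (n) KT => [|m IHm]; rewrite ?expr0 // exprS => /K_T.
Qed.

Let K_poly_T s : poly_T s -> K s -> s = 0.
Proof.
move=> [P ->] KP; pose M : {poly k} := 'X^p - 1.
have M0 : horner_alg T M = 0.
  by rewrite /M rmorphB rmorphXn /= horner_algX rmorph1 (T_p R_def) subrr.
have szM : size M = p.+1 by rewrite size_XnsubC // ltnW // ltnW.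
have PM : horner_alg T P = horner_alg T (P %% M).
  by rewrite {1}(divp_eq P M) rmorphD rmorphM /= M0 mulr0 add0r.
rewrite PM (@K_horner p (P %% M)) ?rmorph0 //; last by rewrite -PM.
by rewrite -ltnS -szM ltn_modp -size_poly_gt0 szM.
Qed.

(* In the remaining layers, the derivation in the direction of the outermost letter
   vanishes on the coefficients, so it extracts them. *)
Let K_Y2 s : span_Y2 s -> K s -> s = 0.
Proof.
have [c [E [c0 HE KE]]] := derivation_exists RY2.
move=> [a [b [[P ->] [Q ->] ->]]] Ks.
have [El E1 [_ _ _ _ EY]] := HE.
have KQ : K (horner_alg T Q).
  have := KE _ Ks; rewrite (linD El) EY !(kerT _ HE) // mulr0 !add0r eqxx.
  by move=> /(K_scale c0)/K_sgn.
have Q0 : horner_alg T Q = 0 by apply: K_poly_T => //; exists Q.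
by move: Ks; rewrite Q0 mulr0 addr0 => /K_poly_T; apply; exists P.
Qed.

Let K_Y s : span_Y s -> K s -> s = 0.
Proof.
have [c [E [c0 HE KE]]] := derivation_exists RY1.
have [El E1 [_ _ _ EY1 EY2]] := HE.
have E0 s' : span_Y2 s' -> E s' = 0.
  apply: (ker_pairs El); first by move=> r; rewrite EY2 /= scale0r addr0.
  by move=> _ [P ->]; apply: (kerT _ HE).
move=> [a [b [Sa Sb ->]]] Ks.
have Kb : K b.
  have := KE _ Ks; rewrite (linD El) EY1 !E0 // mulr0 !add0r eqxx.
  by move=> /(K_scale c0)/K_T/K_sgn.
have b0 := K_Y2 Sb Kb.
by move: Ks; rewrite b0 mulr0 addr0 => /(K_Y2 Sa).
Qed.

Let K_X2 s : span_X2 s -> K s -> s = 0.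
Proof.
have [c [E [c0 HE KE]]] := derivation_exists RX2.
have [El E1 [_ _ EX2 EY1 EY2]] := HE.
apply: (@K_powers X2 span_Y id c E) => //.
- by move=> r; rewrite EX2 /= scale0r addr0.
- apply: (ker_pairs El); first by move=> r; rewrite EY1 /= scale0r addr0.
  apply: (ker_pairs El); first by move=> r; rewrite EY2 /= scale0r addr0.
  by move=> _ [P ->]; apply: (kerT _ HE).
- by move=> s' ?; apply: subspaceZ.
Qed.

Let K_R s : span_R s -> K s -> s = 0.
Proof.
have [c [E [c0 HE KE]]] := derivation_exists RX1.
have [El E1 [_ EX1 EX2 EY1 EY2]] := HE.
apply: (@K_powers X1 span_X2 (fun r => T ^+ 2 * r) c E) => //.
- by move=> r; rewrite EX1 /= scale0r addr0.
- by move=> z x y; rewrite mulrDr -scalerAr.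
- have TX : T * X1 = X1 * T by apply: R_comm.
  by move=> r; rewrite expr2 !mulrA -[T * T * X1]mulrA TX mulrA TX.
- apply: (ker_powers El); first by move=> r; rewrite EX2 /= !scale0r !addr0.
  apply: (ker_pairs El); first by move=> r; rewrite EY1 /= scale0r addr0.
  apply: (ker_pairs El); first by move=> r; rewrite EY2 /= scale0r addr0.
  by move=> _ [P ->]; apply: (kerT _ HE).
- by move=> s' Ss; rewrite expr2 -mulrA; apply: X2T; apply: X2T.
- by move=> s' ?; apply: subspaceZ.
- by move=> r; rewrite expr2 -mulrA => /K_T/K_T.
Qed.

Lemma iota_injective : injective iota.
Proof.
move=> a b ab; apply/eqP; rewrite -subr_eq0; apply/eqP.
by apply: K_R (span_R_all _) _; rewrite /K linearB /= ab subrr.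
Qed.

End Injectivity.

(** * A basis of the restricted enveloping algebra *)

Lemma big_double (V : zmodType) (G : nat -> V) n :
  \sum_(l < 2 * n) G l = \sum_(m < n) (G (2 * m)%N + G (2 * m).+1%N).
Proof.
elim: n => [|n IH]; first by rewrite muln0 !big_ord0.
by rewrite mulnS !addSn add0n !big_ord_recr /= IH addrA.
Qed.

Section OspBasis.
Variables (k : fieldType) (p : nat).
Hypotheses (p_char : p \in [pchar k]) (p_gt2 : (2 < p)%N).
Variables (U : hopfSuperAlgType k) (xU : osp_gen -> U).
Hypothesis U_def : is_u_osp p xU.

Let U_pres : presented_by osp_par (@u_osp_rel k p) xU. Proof. by case: U_def. Qed.
Let U_homog i : homog (osp_par i) (xU i). Proof. by case: U_pres. Qed.
Let U_comul i : comul (xU i) = xU i ⊗ 1 + 1 ⊗ xU i. Proof. by case: U_def. Qed.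

Variable sigma : {lrmorphism U -> 'M[k]_3}.
Hypothesis sigmaE : forall i, sigma (xU i) = nat_rep k i.

Let x := xU Op.
Let y := - xU Om.
Let h := xU Oh.

(* The indices 0, 1, 2 stand for the weight vectors [v_1, v_0, v_-1]. As [x] raises
   weights, [E v w (x * d)] involves the [E v' w d] with [v <= v']; for [y] those with
   [v' <= v], for [h] only [v' = v]. This triangularity makes it possible to strip
   off first the [x], then the [y], then the [h]. *)
Let E (v w : 'I_3) : U -> U := hit (fun u => sigma u v w).
Let o (m : nat) : 'I_3 := inord m.

Let E_fun_lin v w : scalar (fun u => sigma u v w).
Proof. by move=> z a b; rewrite !linearP !mxE. Qed.

Let E_lin v w : linear (E v w).
Proof. exact: hit_linear. Qed.

Let E1 v w : E v w 1 = (v == w)%:R *: 1.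
Proof. by rewrite /E hit1 // rmorph1 mxE. Qed.

Let E_gen i v w d : E v w (xU i * d) =
  xU i * E v w d + sgn (osp_par i) (\sum_v' nat_rep k i v v' *: E v' w d).
Proof.
rewrite /E (hitM_skew _ (E_fun_lin v w) (U_homog i) (U_comul i)) mul1r.
congr (_ + sgn _ _); rewrite -hit_sum; apply: eq_hit => u.
by rewrite rmorphM /= sigmaE -mulmxE mxE.
Qed.

Let nat_repE i v v' : nat_rep k i v v' = (nth 0 (nth [::] (nat_rows i) v) v')%:~R.
Proof. by rewrite mxE. Qed.

Let s := @sgn k U true.
Let s_lin : linear s := @sgn_linear k U true.

Let o0 : ord0 = o 0. Proof. by apply: val_inj; rewrite /= inordK. Qed.
Let o1 : lift ord0 ord0 = o 1. Proof. by apply: val_inj; rewrite /= inordK. Qed.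
Let o2 : lift ord0 (lift ord0 ord0) = o 2.
Proof. by apply: val_inj; rewrite /= inordK. Qed.

Let E_x w d : [/\ E (o 0) w (x * d) = x * E (o 0) w d + s (E (o 1) w d),
  E (o 1) w (x * d) = x * E (o 1) w d + s (E (o 2) w d)
  & E (o 2) w (x * d) = x * E (o 2) w d].
Proof.
rewrite !E_gen !big_ord_recl !big_ord0 !nat_repE /= !inordK //= o2 o1 o0.
by rewrite !scale0r !scale1r !add0r !addr0 linear0 addr0.
Qed.

Let E_y w d : [/\ E (o 0) w (y * d) = y * E (o 0) w d,
  E (o 1) w (y * d) = y * E (o 1) w d + s (E (o 0) w d)
  & E (o 2) w (y * d) = y * E (o 2) w d - s (E (o 1) w d)].
Proof.
rewrite /y !mulNr !(linN (E_lin _ _)).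
rewrite !E_gen !big_ord_recl !big_ord0 !nat_repE /= !inordK //= o2 o1 o0.
rewrite !scale0r scaleN1r !scale1r !add0r !addr0 linear0 linearN addr0.
by rewrite !opprD opprK.
Qed.

Let E_h w d : [/\ E (o 0) w (h * d) = h * E (o 0) w d + E (o 0) w d,
  E (o 1) w (h * d) = h * E (o 1) w d
  & E (o 2) w (h * d) = h * E (o 2) w d - E (o 2) w d].
Proof.
rewrite !E_gen !big_ord_recl !big_ord0 !nat_repE /= !inordK //= o2 o1 o0.
by rewrite !scale0r scaleN1r !scale1r !add0r !addr0 !sgn_even addr0.
Qed.

Let s_y d : s (y * d) = - (y * s d).
Proof. by rewrite /s sgnM (sgn_homog1 (homogN (U_homog Om))) mulNr. Qed.
Let s_x d : s (x * d) = - (x * s d).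
Proof. by rewrite /s sgnM (sgn_homog1 (U_homog Op)) mulNr. Qed.
Let s_eq0 d : s d = 0 -> d = 0.
Proof. by move=> sd; rewrite -[d](sgnK true) -/(s d) sd linear0. Qed.

Let P_h (P : {poly k}) : U := horner_alg h P.

Let E_h_neq v w P : v != w -> E v w (P_h P) = 0.
Proof.
move=> vw; elim/poly_ind: P => [|P a IH]; first by rewrite /P_h rmorph0 (lin0 (E_lin v w)).
have eh d : E v w d = 0 -> E v w (h * d) = 0.
  move=> d0; rewrite E_gen -/h d0 mulr0 add0r sgn_even big1 // => v' _.
  have [->|] := eqVneq v' v; first by rewrite d0 scaler0.
  rewrite nat_repE; case: v v' {vw IH d0} => [[|[|[|[]]]] ?] // [[|[|[|[]]]] ?] //= _;
    by rewrite scale0r.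
rewrite /P_h [P * 'X]mulrC rmorphD rmorphM /= horner_algX horner_algC.
by rewrite (linD (E_lin v w)) (linZ (E_lin v w)) E1 (negPf vw) scale0r scaler0 addr0 eh.
Qed.

Let shift (c : k) (P : {poly k}) := P \Po ('X + c%:P).

Let E_h_eq v c P : (forall d, E v v (h * d) = h * E v v d + c *: E v v d) ->
  E v v (P_h P) = P_h (shift c P).
Proof.
move=> Eh; elim/poly_ind: P => [|P a IH].
  by rewrite /shift comp_poly0 /P_h rmorph0 (lin0 (E_lin v v)).
rewrite /shift comp_polyD comp_polyM comp_polyX comp_polyC -/(shift c P).
rewrite /P_h ![_ * ('X + _)]mulrC [P * 'X]mulrC !(rmorphD, rmorphM) /=.
rewrite !horner_algX !horner_algC.
rewrite (linD (E_lin v v)) (linZ (E_lin v v)) E1 eqxx scale1r Eh -/(P_h P) IH.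
by rewrite mulrDl -/(P_h _) mulr_algl.
Qed.

Let E00 P : E (o 0) (o 0) (P_h P) = P_h (shift 1 P).
Proof. by apply: E_h_eq => d; have [-> _ _] := E_h (o 0) d; rewrite scale1r. Qed.
Let E11 P : E (o 1) (o 1) (P_h P) = P_h P.
Proof.
rewrite (E_h_eq (c := 0)) /shift ?addr0 ?comp_polyXr // => d.
by have [_ -> _] := E_h (o 1) d; rewrite scale0r addr0.
Qed.
Let E22 P : E (o 2) (o 2) (P_h P) = P_h (shift (-1) P).
Proof. by apply: E_h_eq => d; have [_ _ ->] := E_h (o 2) d; rewrite scaleN1r. Qed.

Let shiftK P : shift 1 (shift (-1) P) = P.
Proof.
rewrite /shift -comp_polyA comp_polyD comp_polyX comp_polyC.
by rewrite -addrA -polyCD subrr addr0 comp_polyXr.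
Qed.
Let shiftNK P : shift (-1) (shift 1 P) = P.
Proof.
rewrite /shift -comp_polyA comp_polyD comp_polyX comp_polyC.
by rewrite -addrA -polyCD addNr addr0 comp_polyXr.
Qed.

Let K (r : U) := r = 0.
Let K_subspace : subspace K.
Proof. by split=> // c a b -> ->; rewrite /K scaler0 addr0. Qed.

(** Defined through closure under [y] so that the identities of [span_yhP] can be
    proved letter by letter. *)
Inductive span_yh : U -> Prop :=
| span_yh_h P : span_yh (horner_alg h P)
| span_yh_y d : span_yh d -> span_yh (y * d)
| span_yh_D d e : span_yh d -> span_yh e -> span_yh (d + e).

Let neq (i j : nat) : (i < 3)%N -> (j < 3)%N -> i != j -> o i != o j.
Proof. by move=> i3 j3; rewrite -val_eqE /= !inordK. Qed.

(* [E_22] maps the span to itself, and [E_00] inverts it there: on polynomials in [h]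
   they are the shifts by -1 and 1. *)
Let span_yhP d : span_yh d -> [/\ E (o 0) (o 2) d = 0, E (o 1) (o 2) d = 0,
  E (o 0) (o 1) d = 0, E (o 1) (o 1) d = d
  & span_yh (E (o 2) (o 2) d) /\ E (o 0) (o 0) (E (o 2) (o 2) d) = d].
Proof.
elim=> {d} [P|d Sd [e02 e12 e01 e11 [S22 e00]]
  |d e _ [d02 d12 d01 d11 [dS d00]] _ [e02 e12 e01 e11 [eS e00]]].
- split; try exact: (E_h_neq _ (neq _ _ _)); first exact: E11.
  by rewrite E22; split; [constructor|rewrite E00 shiftK].
- have [y02 y12 y22] := E_y (o 2) d; have [y01 y11 _] := E_y (o 1) d.
  rewrite y02 y12 y22 y01 y11 e02 e12 e01 e11 (lin0 s_lin) !mulr0 !addr0 subr0.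
  have [y00 _ _] := E_y (o 0) (E (o 2) (o 2) d).
  by split=> //; split; [constructor|rewrite y00 e00].
- split; rewrite ?(linD (E_lin _ _)) ?d02 ?e02 ?d12 ?e12 ?d01 ?e01 ?d11 ?e11 ?addr0 //.
  by rewrite d00 e00; split=> //; constructor.
Qed.

Let pairs_x_0 f g : span_yh f -> span_yh g -> f + x * g = 0 -> f = 0 /\ g = 0.
Proof.
move=> Sf Sg fg.
have [_ _ f01 _ _] := span_yhP Sf; have [_ _ g01 g11 _] := span_yhP Sg.
have := congr1 (E (o 0) (o 1)) fg; rewrite (linD (E_lin _ _)) (lin0 (E_lin _ _)).
have [-> _ _] := E_x (o 1) g; rewrite f01 g01 g11 mulr0 !add0r => /s_eq0 g0.
by move: fg; rewrite g0 mulr0 addr0.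
Qed.

(** The powers of [x] are grouped in pairs because [x^2 = e] is even and primitive:
    [E_02] acts on [e^m s] as the derivative in [e], twisted by the automorphism
    [E_22] of the span of the [y^j h^i], and [powers_elim] applies. Within a pair,
    [E_01] sends [x * g] to [g], up to parity. *)
Lemma x_layer (F : nat -> U) : (forall l, span_yh (F l)) ->
  \sum_(l < 2 * p) x ^+ l * F l = 0 -> forall l, (l < 2 * p)%N -> F l = 0.
Proof.
move=> SF; rewrite (big_double (fun l => x ^+ l * F l)) => F0.
have F0' : K (\sum_(m < p) (x ^+ 2) ^+ m * (F (2 * m)%N + x * F (2 * m).+1)).
  rewrite /K -[RHS]F0; apply: eq_bigr => m _.
  by rewrite mulrDr mulrA -exprM -exprSr.
have E02x d : E (o 0) (o 2) (x ^+ 2 * d) = x ^+ 2 * E (o 0) (o 2) d + E (o 2) (o 2) d.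
  rewrite expr2 -!mulrA; have [-> _ _] := E_x (o 2) (x * d).
  have [-> -> _] := E_x (o 2) d.
  rewrite mulrDr (linD s_lin) s_x [s (s _)]sgnK -addrA; congr (_ + _).
  by rewrite addrA subrr add0r.
have E22x d : E (o 2) (o 2) (x * d) = x * E (o 2) (o 2) d by have [] := E_x (o 2) d.
have Hp m : (m < p)%N -> F (2 * m)%N + x * F (2 * m).+1 = 0.
  apply: (powers_elim (S := pairs x span_yh) (E := E (o 0) (o 2)) (w := E (o 2) (o 2))
    (f := fun m => F (2 * m)%N + x * F (2 * m).+1) p_char (leqnn p) K_subspace
    _ _ _ _ E02x _ _ _ _ _ F0') => //.
  - by move=> r ->; rewrite /K mulr0.
  - by move=> r ->; rewrite /K (lin0 (E_lin _ _)).
  - by move=> r; rewrite expr2 -!mulrA !E22x.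
  - move=> _ [a [b [Sa Sb ->]]]; rewrite (linD (E_lin _ _)).
    have [-> _ _] := E_x (o 2) b.
    have [-> _ _ _ _] := span_yhP Sa; have [-> -> _ _ _] := span_yhP Sb.
    by rewrite mulr0 (lin0 s_lin) !addr0.
  - move=> _ [a [b [Sa Sb ->]]]; rewrite (linD (E_lin _ _)) E22x.
    have [_ _ _ _ [Sa' _]] := span_yhP Sa; have [_ _ _ _ [Sb' _]] := span_yhP Sb.
    by exists (E (o 2) (o 2) a), (E (o 2) (o 2) b).
  - move=> _ [a [b [Sa Sb ->]]]; rewrite /K (linD (E_lin _ _)) E22x.
    have [_ _ _ _ [Sa' ea]] := span_yhP Sa; have [_ _ _ _ [Sb' eb]] := span_yhP Sb.
    move=> /(pairs_x_0 Sa' Sb')[a0 b0].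
    by rewrite -ea -eb a0 b0 (lin0 (E_lin _ _)) mulr0 addr0.
  - by move=> l; exists (F (2 * l)%N), (F (2 * l).+1).
move=> l l_lt; have l2_lt : (l./2 < p)%N by rewrite ltn_half_double -mul2n.
have [F1 F2] := pairs_x_0 (SF _) (SF _) (Hp _ l2_lt).
by rewrite -(odd_double_half l) -mul2n; case: (odd l); rewrite ?add1n ?add0n.
Qed.

Let span_h (d : U) := exists P : {poly k}, d = P_h P.

Let span_h_subspace : subspace span_h.
Proof.
split=> [|c _ _ [P ->] [Q ->]]; first by exists 0; rewrite /P_h rmorph0.
by exists (c *: P + Q); rewrite /P_h linearD linearZ /= mulr_algl.
Qed.

Let pairs_y_0 P Q : P_h P + y * P_h Q = 0 -> P_h P = 0 /\ P_h Q = 0.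
Proof.
move=> PQ.
have := congr1 (E (o 1) (o 0)) PQ; rewrite (linD (E_lin _ _)) (lin0 (E_lin _ _)).
have [_ -> _] := E_y (o 0) (P_h Q).
rewrite !(@E_h_neq (o 1) (o 0)) ?neq // mulr0 !add0r => /s_eq0 Q0.
have {}Q0 : P_h Q = 0.
  rewrite -[Q]shiftNK -E22 -E00 Q0; exact: lin0 (E_lin _ _).
by move: PQ; rewrite Q0 mulr0 addr0.
Qed.

(** The same argument with [y^2 = - f], transposed: [E_20] differentiates in [y^2] with
    the twist [- E_00], a shift in [h], and [E_10] separates the pairs. *)
Lemma y_layer (F : nat -> {poly k}) :
  \sum_(j < 2 * p) y ^+ j * horner_alg h (F j) = 0 ->
  forall j, (j < 2 * p)%N -> horner_alg h (F j) = 0.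
Proof.
rewrite (big_double (fun j => y ^+ j * P_h (F j))) => F0.
have F0' : K (\sum_(m < p) (y ^+ 2) ^+ m * (P_h (F (2 * m)%N) + y * P_h (F (2 * m).+1))).
  rewrite /K -[RHS]F0; apply: eq_bigr => m _.
  by rewrite mulrDr mulrA -exprM -exprSr.
have E20y d : E (o 2) (o 0) (y ^+ 2 * d) = y ^+ 2 * E (o 2) (o 0) d + - E (o 0) (o 0) d.
  rewrite expr2 -!mulrA; have [_ _ ->] := E_y (o 0) (y * d).
  have [_ -> ->] := E_y (o 0) d.
  rewrite mulrBr (linD s_lin) s_y [s (s _)]sgnK opprD opprK addrA; congr (_ - _).
  by rewrite -addrA addNr addr0.
have E00y d : E (o 0) (o 0) (y * d) = y * E (o 0) (o 0) d by have [] := E_y (o 0) d.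
have E20P P : E (o 2) (o 0) (P_h P) = 0 by rewrite (@E_h_neq (o 2) (o 0)) ?neq.
have E10P P : E (o 1) (o 0) (P_h P) = 0 by rewrite (@E_h_neq (o 1) (o 0)) ?neq.
have E22y Q : E (o 2) (o 2) (y * P_h Q) = y * E (o 2) (o 2) (P_h Q).
  have [_ _ ->] := E_y (o 2) (P_h Q).
  by rewrite (@E_h_neq (o 1) (o 2)) ?neq // (lin0 s_lin) subr0.
have Hp m : (m < p)%N -> P_h (F (2 * m)%N) + y * P_h (F (2 * m).+1) = 0.
  apply: (powers_elim (S := pairs y span_h) (E := E (o 2) (o 0))
    (w := fun d => - E (o 0) (o 0) d)
    (f := fun m => P_h (F (2 * m)%N) + y * P_h (F (2 * m).+1)) p_char (leqnn p)
    K_subspace _ _ _ _ E20y _ _ _ _ _ F0') => //.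
  - by move=> r ->; rewrite /K mulr0.
  - by move=> r ->; rewrite /K (lin0 (E_lin _ _)).
  - by move=> z a b; rewrite E_lin opprD scalerN.
  - by move=> r; rewrite expr2 -!mulrA !E00y !mulrN.
  - move=> _ [_ [_ [[P ->] [Q ->] ->]]]; rewrite (linD (E_lin _ _)).
    have [_ _ ->] := E_y (o 0) (P_h Q).
    by rewrite !E20P E10P mulr0 (lin0 s_lin) subr0 addr0.
  - move=> _ [_ [_ [[P ->] [Q ->] ->]]]; rewrite (linD (E_lin _ _)) E00y !E00.
    apply: (subspaceN (pairs_subspace _ span_h_subspace)).
    exists (P_h (shift 1 P)), (P_h (shift 1 Q)).
    by split; [exists (shift 1 P)|exists (shift 1 Q)|].
  - move=> _ [_ [_ [[P ->] [Q ->] ->]]]; rewrite /K (linD (E_lin _ _)) E00y !E00.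
    move/eqP; rewrite oppr_eq0 => /eqP /(congr1 (E (o 2) (o 2))).
    by rewrite (linD (E_lin _ _)) E22y !E22 !shiftNK (lin0 (E_lin _ _)).
  - move=> l; exists (P_h (F (2 * l)%N)), (P_h (F (2 * l).+1)).
    by split; [exists (F (2 * l)%N)|exists (F (2 * l).+1)|].
move=> j j_lt; have j2_lt : (j./2 < p)%N by rewrite ltn_half_double -mul2n.
have [F1 F2] := pairs_y_0 (Hp _ j2_lt).
by rewrite -(odd_double_half j) -mul2n; case: (odd j); rewrite ?add1n ?add0n.
Qed.

(** Applying [E_00] to [P(h) = 0] shows that the translates [P(h + n)] vanish too, and
    so do the values [P(n)] of the counit on them: too many roots. *)
Lemma h_layer (P : {poly k}) : (size P <= p)%N -> horner_alg h P = 0 -> P = 0.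
Proof.
move=> szP Ph.
have shift_n n : P_h (iter n (shift 1) P) = 0.
  by elim: n => // n IH; rewrite -E00 IH; apply: lin0 (E_lin _ _).
have hornerP n (Q : {poly k}) : (iter n (shift 1) Q).[0] = Q.[n%:R].
  elim: n Q => // n IH Q; rewrite iterSr IH /shift horner_comp !hornerE.
  by rewrite -natr1.
have eh : counit h = 0 by apply: (counit_skew (U_comul Oh)); apply: counit1.
have counitP (Q : {poly k}) : counit (P_h Q) = Q.[0].
  elim/poly_ind: Q => [|Q a IH]; first by rewrite /P_h rmorph0 horner0 linear0.
  rewrite /P_h rmorphD rmorphM /= horner_algX horner_algC linearD /= counitM eh.
  rewrite linearZ /= counit1 !mulr0 mulr1 !add0r.
  by rewrite hornerD hornerM hornerX hornerC mulr0 add0r.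
have roots n : root P n%:R.
  by rewrite /root -hornerP -counitP shift_n linear0.
apply/eqP; case: eqVneq => // P0.
have := max_poly_roots (rs := [seq i%:R | i <- iota 0 p]) P0.
rewrite size_map size_iota ltnNge szP; apply.
  by apply/allP => _ /mapP[n _ ->].
rewrite map_inj_in_uniq ?iota_uniq // => i j; rewrite !mem_iota !add0n /=.
wlog ij : i j / (i <= j)%N => [W|] i_lt j_lt e.
  by case/orP: (leq_total i j) => ij; [apply: W|apply: esym; apply: W].
have : (j - i)%:R == 0 :> k by rewrite natrB // e subrr.
rewrite -(dvdn_pcharf p_char); case: (posnP (j - i)) => [/eqP|ji /dvdn_leq].
  by rewrite subn_eq0 => ji _; apply/eqP; rewrite eqn_leq ij.
by move=> /(_ ji); rewrite leqNgt (leq_ltn_trans (leq_subr _ _)).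
Qed.

End OspBasis.

(** * Exactness *)

Section Exactness.
Variables (k : fieldType) (p : nat).
Hypotheses (p_char : p \in [pchar k]) (p_gt2 : (2 < p)%N).
Variables (R D U : hopfSuperAlgType k).
Variables (xR : R_gen -> R) (xD : D_gen -> D) (xU : osp_gen -> U).
Hypotheses (R_def : is_R p xR) (D_def : is_D p xD) (U_def : is_u_osp p xU).
Variables (iota : {lrmorphism R -> D}) (pi : {lrmorphism D -> U}).
Hypotheses (iotaE : forall i, iota (xR i) = iota_gen xD i)
  (iota_hopf : hopf_morphism iota).
Hypotheses (piE : forall i, pi (xD i) = pi_gen xU i) (pi_hopf : hopf_morphism pi).

Let R_pres : presented_by R_par (@R_rel k p) xR. Proof. by case: R_def. Qed.
Let D_pres : presented_by D_par (fun r => r \in D_rels k p) xD.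
Proof. by case: D_def. Qed.
Let H := D_relations D_def.
Let D_hom := D_homog D_def.
Let R_homog i : homog (R_par i) (xR i). Proof. by case: R_pres. Qed.

Let iota_comm_gen i j : i \in [:: Dx2; Du2; Dzeta] -> exists r,
  iota (xR j) * xD i = xD i * iota (sgn (D_par i) (xR j)) + iota r.
Proof.
have sE : sgn (D_par i) (xR j) = (-1) ^+ (D_par i && R_par j) *: xR j.
  exact: sgn_homog.
rewrite sE linearZ /= => ii.
pose rX1 := xR RX1; pose rX2 := xR RX2; pose rT := xR RT.
pose rY1 := xR RY1; pose rY2 := xR RY2.
exists (match i, j with
  | Dx2, RX1 => - (rY1 * rX1)    | Dx2, RX2 => - ((1 + rT) * rY2)
  | Dx2, RT => - (rY1 * rT)      | Dx2, RY1 => rX1 | Dx2, RY2 => 1 - rT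
  | Du2, RX1 => - (rY1 * (1 + rT)) + (rX1 * rY2 + rX1 * rY2)
  | Du2, RX2 => - (rY2 * rX2)    | Du2, RT => rT * rY2
  | Du2, RY1 => 1 - rT + rY1 * rY2 | Du2, RY2 => - rX2
  | _, RX1 => - rX1 - rX1 | _, RX2 => rX2 + rX2 | _, RT => 0
  | _, RY1 => - rY1 | _, RY2 => rY2 end).
case: i ii {sE} => //= _; case: j => /=; rewrite ?expr0 ?expr1 ?scale1r ?scaleN1r;
  rewrite ?(rmorphN, rmorphD, rmorphM, rmorph1, rmorph0, linear0) /= ?rmorphM /=
    ?rmorphD /= ?rmorph1 ?iotaE /= /D_x21 /D_u21 ?addr0; D_ring H.
Qed.

(** Up to sign, the letters [x_2], [u_2] and [zeta] move past [iota R] at the cost of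
    a term in [iota R]. This is checked on the generators of [R] and extends to
    products as a derivation does. It makes [D] spanned over [R] by words in the three
    letters, and [D R^+] a two-sided ideal. *)
Lemma iota_comm i r : i \in [:: Dx2; Du2; Dzeta] -> exists r',
  iota r * xD i = xD i * iota (sgn (D_par i) r) + iota r'.
Proof.
move=> ii; elim/(presented_ind R_pres): r => [|a b [a' Ha] [b' Hb]|c a [a' Ha]||j a [a' Ha]].
- by exists 0; rewrite !linear0 mul0r mulr0 addr0.
- by exists (a' + b'); rewrite !linearD /= mulrDl mulrDr Ha Hb addrACA.
- by exists (c *: a'); rewrite !linearZ /= -scalerAl Ha scalerDr scalerAr.
- by exists 0; rewrite sgn1 rmorph0 !rmorph1 mul1r mulr1 addr0.
have [c Hc] := iota_comm_gen j ii.
exists (c * sgn (D_par i) a + xR j * a').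
rewrite sgnM !rmorphD !rmorphM /= -mulrA Ha mulrDr mulrA Hc mulrDl.
by rewrite -!addrA -mulrA.
Qed.

Lemma iota_comm_left i r : i \in [:: Dx2; Du2; Dzeta] -> exists r',
  xD i * iota r = iota (sgn (D_par i) r) * xD i + iota r'.
Proof.
move=> /(iota_comm (sgn (D_par i) r))[r' Hr]; exists (- r').
by rewrite Hr sgnK rmorphN /= addrK.
Qed.

(** ** [D] is spanned over [R] by the words [x_2^l u_2^j zeta^i] *)

Definition pbw_word (l j i : nat) : seq D_gen :=
  nseq l Dx2 ++ nseq j Du2 ++ nseq i Dzeta.

Let m l j i : D := word_eval xD (pbw_word l j i).

Let mE l j i : m l j i = xD Dx2 ^+ l * (xD Du2 ^+ j * xD Dzeta ^+ i).
Proof. by rewrite /m /word_eval !big_cat !big_nseq -!Monoid.iteropE. Qed.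

Inductive span_D : D -> Prop :=
| span_D_word r l j i : span_D (iota r * m l j i)
| span_D_D d e : span_D d -> span_D e -> span_D (d + e).

Let span_m l j i : span_D (m l j i).
Proof. by rewrite -[m l j i]mul1r -(rmorph1 iota); constructor. Qed.

Let span_iota r d : span_D d -> span_D (iota r * d).
Proof.
elim=> [r' l j i|d1 d2 _ H1 _ H2]; last by rewrite mulrDr; constructor.
by rewrite mulrA -rmorphM; constructor.
Qed.

Let span_opp d : span_D d -> span_D (- d).
Proof. by move=> Sd; rewrite -mulN1r -(rmorph1 iota) -rmorphN; apply: span_iota. Qed.

Let span_gen n : n \in [:: Dx2; Du2; Dzeta] ->
  (forall l j i, span_D (xD n * m l j i)) -> forall d, span_D d -> span_D (xD n * d).
Proof.
move=> nn Hm d; elim=> [r l j i|d1 d2 _ H1 _ H2]; last by rewrite mulrDr; constructor.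
have [r' Hr] := iota_comm_left r nn.
rewrite mulrA Hr mulrDl -mulrA; apply: span_D_D; last by constructor.
exact: span_iota.
Qed.

Let span_x2 d : span_D d -> span_D (xD Dx2 * d).
Proof.
apply: span_gen => // l j i.
by rewrite mE mulrA -exprS -mE.
Qed.

Let span_zeta d : span_D d -> span_D (xD Dzeta * d).
Proof.
apply: span_gen => // l j i.
have zx : xD Dzeta * xD Dx2 = xD Dx2 * xD Dzeta + xD Dx2 by D_ring H.
have zu : xD Dzeta * xD Du2 = xD Du2 * xD Dzeta - xD Du2 by D_ring H.
have zuj n : xD Dzeta * xD Du2 ^+ n = xD Du2 ^+ n * xD Dzeta - xD Du2 ^+ n *+ n.
  elim: n => [|n IH]; first by rewrite expr0 mulr1 mul1r mulr0n subr0.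
  rewrite [in LHS]exprS mulrA zu mulrBl -[_ * _ * xD Du2 ^+ n]mulrA IH mulrBr.
  by rewrite mulrA -exprS -addrA -opprD mulrnAr -exprS -mulrSr.
elim: l => [|l IH]; last first.
  rewrite mE exprS -mulrA mulrA zx mulrDl -!mulrA; apply: span_D_D; last first.
    by apply: span_x2; rewrite -mE.
  by apply: span_x2; rewrite -mE.
rewrite mE expr0 mul1r mulrA zuj mulrBl -mulrA -exprS; apply: span_D_D.
  by rewrite -[_ * _]mul1r -(expr0 (xD Dx2)) -mE.
apply: span_opp; rewrite mulrnAl -mulr_natl -(rmorph_nat iota); apply: span_iota.
by rewrite -[_ * _]mul1r -(expr0 (xD Dx2)) -mE.
Qed.

Let span_u2 d : span_D d -> span_D (xD Du2 * d).
Proof.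
apply: span_gen => // l j i; elim: l => [|l IH].
  by rewrite mE expr0 mul1r mulrA -exprS -[_ * _]mul1r -(expr0 (xD Dx2)) -mE.
(* [x_2 u_1] is replaced by [- u_1 x_2 + (1 - g)], as [iota R] acts on the left. *)
have ux : xD Du2 * xD Dx2 = - (xD Dx2 * xD Du2) + xD Dg * xD Dzeta
    - xD Du1 * xD Dx2 + (1 - xD Dg) by D_ring H.
have iT : iota (xR RT) = xD Dg := iotaE RT.
have iY2 : iota (xR RY2) = xD Du1 := iotaE RY2.
rewrite mE exprS -mulrA mulrA ux -mE -iT -iY2 !mulrDl !mulNr -!mulrA.
repeat apply: span_D_D.
- by apply: span_opp; apply: span_x2.
- by apply: span_iota; apply: span_zeta.
- by apply: span_opp; apply: span_iota; apply: span_x2.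
- by rewrite mul1r.
- by apply: span_opp; apply: span_iota.
Qed.

Lemma span_D_all d : span_D d.
Proof.
have S0 : span_D 0 by rewrite -(mul0r (m 0 0 0)) -(rmorph0 iota); constructor.
elim/(presented_ind D_pres): d => [//|a b|c a Sa||i a Sa].
- exact: span_D_D.
- by rewrite -mulr_algl -(rmorph_alg iota); apply: span_iota.
- by have := span_m 0 0 0; rewrite mE !expr0 !mulr1.
- case: i.
  + by rewrite -[xD Dx1]/(iota_gen xD RY1) -iotaE; apply: span_iota.
  + exact: span_x2.
  + by rewrite -[xD Du1]/(iota_gen xD RY2) -iotaE; apply: span_iota.
  + exact: span_u2.
  + by rewrite -[xD Dg]/(iota_gen xD RT) -iotaE; apply: span_iota.
  + exact: span_zeta.
Qed.

(** ** The words [x_2^l u_2^j zeta^i] give a basis of the enveloping algebra *)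

Definition pbw_index : finType := ('I_(2 * p) * 'I_(2 * p) * 'I_p)%type.
Definition pbw (t : pbw_index) : seq D_gen := pbw_word t.1.1 t.1.2 t.2.

Let mU (t : pbw_index) : U := pi (word_eval xD (pbw t)).

Let pi_m l j i : pi (m l j i) = xU Op ^+ l * ((- xU Om) ^+ j * xU Oh ^+ i).
Proof. by rewrite mE !rmorphM !rmorphXn /= !piE. Qed.

Lemma pbw_free (c : pbw_index -> k) : \sum_t c t *: mU t = 0 -> forall t, c t = 0.
Proof.
move=> c0.
have [U_pres _] := U_def.
have [sigma sigmaE] := presented_lift U_pres (@nat_rep_rel k p (pchar_odd p_char p_gt2)).
pose cn (l j i : nat) : k :=
  match (insub l : option 'I_(2 * p)), (insub j : option 'I_(2 * p)),
    (insub i : option 'I_p) with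
  | Some l', Some j', Some i' => c (l', j', i')
  | _, _, _ => 0
  end.
have cnE (t : pbw_index) : cn t.1.1 t.1.2 t.2 = c t by case: t => [[l j] i]; rewrite /cn !valK.
pose P l j : {poly k} := \poly_(i < p) cn l j i.
pose F l : U := \sum_(j < 2 * p) (- xU Om) ^+ j * horner_alg (xU Oh) (P l j).
have F0 : \sum_(l < 2 * p) xU Op ^+ l * F l = 0.
  rewrite -[RHS]c0.
  have -> : \sum_t c t *: mU t = \sum_(l < 2 * p) \sum_(j < 2 * p) \sum_(i < p)
      c (l, j, i) *: mU (l, j, i).
    rewrite (pair_bigA _ (fun l j => \sum_i c (l, j, i) *: mU (l, j, i))) /=.
    rewrite (pair_bigA _ (fun lj i => c (lj.1, lj.2, i) *: mU (lj.1, lj.2, i))) /=.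
    by apply: eq_bigr => -[[l j] i] _.
  apply: eq_bigr => l _; rewrite /F mulr_sumr; apply: eq_bigr => j _.
  rewrite /P poly_def rmorph_sum !mulr_sumr; apply: eq_bigr => i _ /=.
  rewrite linearZ /= mulr_algl rmorphXn /= horner_algX -(cnE (l, j, i)) /=.
  by rewrite -!scalerAr /mU -pi_m.
have SF l : span_yh xU (F l).
  apply: big_ind => [|a b|j _]; first by rewrite -(rmorph0 (horner_alg (xU Oh))); constructor.
    exact: span_yh_D.
  move: (P l j) => Q; elim: (nat_of_ord j) => [|n IH].
    by rewrite expr0 mul1r; apply: span_yh_h.
  by rewrite exprS -mulrA; apply: span_yh_y.
have Fl := x_layer p_char U_def sigmaE SF F0.
move=> t; have Fj := y_layer p_char U_def sigmaE (Fl _ (ltn_ord t.1.1)).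
have P0 := h_layer p_char U_def sigmaE (size_poly _ _) (Fj _ (ltn_ord t.1.2)).
by rewrite -cnE; move/polyP: P0 => /(_ t.2); rewrite coef_poly ltn_ord coef0.
Qed.

Let zeta_red i : exists2 i', (i' < p)%N & xD Dzeta ^+ i = xD Dzeta ^+ i'.
Proof.
elim/ltn_ind: i => i IH; have [ip|pi'] := ltnP i p; first by exists i.
have [|i' i'p E] := IH (i - p).+1.
  by rewrite -[X in (_ < X)%N](subnK pi') -addn1 ltn_add2l ltnW.
exists i' => //; rewrite -E -{1}(subnK pi') exprD (zeta_p D_def) -exprSr //.
Qed.

Lemma pbw_span d : exists f : pbw_index -> R, d = \sum_t iota (f t) * word_eval xD (pbw t).
Proof.
elim: (span_D_all d) => {d} [r l j i|d1 d2 _ [f1 ->] _ [f2 ->]]; last first.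
  exists (fun t => f1 t + f2 t); rewrite -big_split; apply: eq_bigr => t _.
  by rewrite rmorphD mulrDl.
have zero : exists f : pbw_index -> R, 0 = \sum_t iota (f t) * word_eval xD (pbw t).
  by exists (fun=> 0); rewrite big1 // => t _; rewrite rmorph0 mul0r.
have [i' i'p Ei] := zeta_red i; rewrite mE Ei -mE.
have [lp|lp] := ltnP l (2 * p); last first.
  by rewrite mE (expr0_leq (x2_2p D_def) lp) mul0r mulr0.
have [jp|jp] := ltnP j (2 * p); last first.
  by rewrite mE (expr0_leq (u2_2p D_def) jp) mul0r !mulr0.
pose t0 : pbw_index := (Ordinal lp, Ordinal jp, Ordinal i'p).
exists (fun t => if t == t0 then r else 0).
rewrite (bigD1 t0) //= eqxx big1 ?addr0 // => t /negPf ->.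
by rewrite rmorph0 mul0r.
Qed.

Let pi_iota r : pi (iota r) = counit r *: 1.
Proof.
have eR i := counit_xR p_gt2 R_def i.
elim/(presented_ind R_pres): r => [|a b Ha Hb|c a Ha||i a Ha].
- by rewrite !linear0 scale0r.
- by rewrite !linearD /= Ha Hb scalerDl.
- by rewrite !linearZ /= Ha scalerA.
- by rewrite !rmorph1 counit1 scale1r.
- rewrite !rmorphM /= Ha counitM -scalerA -scalerAr mulr1 eR iotaE scalerA mulrC -scalerA.
  congr (_ *: _); case: i; rewrite /= /D_x21 /D_u21 ?rmorphN ?rmorphD ?rmorphM /= !piE /=;
  by rewrite ?mul0r ?mulr0 ?addr0 ?oppr0 ?scale0r ?scale1r.
Qed.

Hypothesis pi_surj : forall u, exists d, pi d = u.

(** Coordinate functionals, obtained from uniqueness by choosing coefficients. *)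
Lemma pbw_coord (t0 : pbw_index) : exists phi : U -> k,
  scalar phi /\ forall t, phi (mU t) = (t == t0)%:R.
Proof.
have span u : exists c : pbw_index -> k, u = \sum_t c t *: mU t.
  have [d <-] := pi_surj u; have [f ->] := pbw_span d.
  exists (fun t => counit (f t)); rewrite rmorph_sum; apply: eq_bigr => t _.
  by rewrite rmorphM /= pi_iota -scalerAl mul1r.
pose c u := projT1 (cid (span u)); have cE u : u = \sum_t c u t *: mU t.
  by rewrite /c; case: cid.
have uniq (a b : pbw_index -> k) : \sum_t a t *: mU t = \sum_t b t *: mU t -> a =1 b.
  move=> ab t; apply/eqP; rewrite -subr_eq0; apply/eqP.
  apply: (@pbw_free (fun t => a t - b t)).
  by under eq_bigr => t' _ do rewrite scalerBl; rewrite sumrB ab subrr.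
exists (fun u => c u t0); split=> [z a b|t].
  apply: (@uniq _ (fun t => z * c a t + c b t)).
  rewrite -cE [in LHS](cE a) [in LHS](cE b) scaler_sumr -big_split; apply: eq_bigr => t _.
  by rewrite /= scalerA -scalerDl.
rewrite (@uniq _ (fun t' => (t == t')%:R)) // -cE.
rewrite (bigD1 t) //= eqxx scale1r big1 ?addr0 // => t'.
by rewrite eq_sym => /negPf ->; rewrite scale0r.
Qed.

(** ** Coinvariants *)

Let pi_fun_lin (psi : U -> k) : scalar psi -> scalar (fun d : D => psi (pi d)).
Proof. by move=> pl z a b; rewrite linearP pl. Qed.

Let hit_pi0 (phi : U -> k) r (a : D) : scalar phi -> pi a = 0 ->
  hit (fun d => phi (pi (a * d))) r = 0.
Proof.
move=> phi_lin a0; rewrite -[RHS](hit0 r); apply: eq_hit => d.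
rewrite rmorphM /= a0 mul0r.
by have := phi_lin (-1) 0 0; rewrite scaler0 addr0 mulN1r addNr.
Qed.

Let hit_iota_gen (phi : U -> k) i d : scalar phi ->
  hit (phi \o pi) (iota (xR i) * d) = iota (xR i) * hit (phi \o pi) d.
Proof.
move=> phi_lin; have il : linear iota by exact: linearP.
have [_ cf _ _] := iota_hopf; have tl := tmap_linear il il.
have tE a b := tmapE a b il il.
have i1 : iota 1 = 1 := rmorph1 _.
have [_ [cX1 cT cX2 cY2 cY1]] := R_def.
have [f_even _ _ _] := iota_hopf.
have hi j : homog (R_par j) (iota (xR j)) by rewrite /homog -f_even R_homog.
have pl := pi_fun_lin phi_lin.
have p0 j : j != RT -> pi (iota (xR j)) = 0.
  by rewrite pi_iota (counit_xR p_gt2 R_def); case: j => //; rewrite scale0r.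
have c := cf (xR i).
case: i c => c.
- move: c; rewrite cX1 !(linD tl) !tE i1 => c.
  by rewrite (hitM_skew2 _ pl (hi RX1) (hi RY1) c) !hit_pi0 ?p0 // !linear0 !mulr0 !addr0.
- move: c; rewrite cX2 !(linD tl) !tE i1 => c.
  by rewrite (hitM_skew2 _ pl (hi RX2) (hi RY2) c) !hit_pi0 ?p0 // !linear0 !mulr0 !addr0.
- move: c; rewrite cT tE => c.
  rewrite (hitM1 _ pl (hi RT) c) sgn_even; congr (_ * _); apply: eq_hit => e.
  by rewrite /= rmorphM /= pi_iota (counit_xR p_gt2 R_def) scale1r mul1r.
- move: c; rewrite cY1 !(linD tl) !tE i1 => c.
  by rewrite (hitM_skew _ pl (hi RY1) c) !hit_pi0 ?p0 // !linear0 !mulr0 !addr0.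
- move: c; rewrite cY2 !(linD tl) !tE i1 => c.
  by rewrite (hitM_skew _ pl (hi RY2) c) !hit_pi0 ?p0 // !linear0 !mulr0 !addr0.
Qed.

(** Functionals on [U] act [R]-linearly on [D], since [pi] is trivial on [iota R]. *)
Lemma hit_iota (phi : U -> k) r d : scalar phi ->
  hit (phi \o pi) (iota r * d) = iota r * hit (phi \o pi) d.
Proof.
move=> phi_lin; have hl := hit_linear (pi_fun_lin phi_lin).
elim/(presented_ind R_pres): r d => [|a b Ha Hb|c a Ha||i a Ha] d.
- by rewrite linear0 !mul0r (lin0 hl).
- by rewrite linearD /= !mulrDl (linD hl) Ha Hb.
- by rewrite linearZ /= -!scalerAl (linZ hl) Ha.
- by rewrite rmorph1 !mul1r.
- by rewrite rmorphM /= -!mulrA hit_iota_gen // Ha.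
Qed.

Let hit_letter (phi : U -> k) i d : scalar phi -> i \in [:: Dx2; Du2; Dzeta] ->
  hit (phi \o pi) (xD i * d) = xD i * hit (phi \o pi) d +
  (if i is Dx2 then xD Dg else 1) *
    sgn (D_par i) (hit ((fun u => phi (pi (xD i) * u)) \o pi) d).
Proof.
move=> phi_lin ii; have pl := pi_fun_lin phi_lin.
have [_ [cg cz cu1 [cx1 cx2 cu2]]] := D_def.
have E : hit (fun d => phi (pi (xD i * d))) d =
    hit ((fun u => phi (pi (xD i) * u)) \o pi) d.
  by apply: eq_hit => e; rewrite /= rmorphM.
case: i ii E => //= _ E.
- by rewrite (hitM_skew _ pl (D_hom Dx2) cx2) E.
- have c : comul (xD Du2) = xD Du2 ⊗ 1 + 1 ⊗ xD Du2 + (- xD Dzeta) ⊗ xD Du1.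
    by rewrite cu2 (linN (tens_linl _)).
  rewrite (hitM_skew2 _ pl (D_hom Du2) (D_hom Du1) c) E.
  by rewrite [X in _ + _ * sgn _ X]hit_pi0 ?piE // linear0 mulr0 addr0.
- by rewrite (hitM_skew _ pl (D_hom Dzeta) cz) E.
Qed.

(** The coproduct of a word distributes its letters over the two factors, so [phi]
    sees the subwords; when it sees the whole word, each [x_2] leaves a [g] behind. *)
Lemma hit_word (w : seq D_gen) (phi : U -> k) : scalar phi ->
  all [in [:: Dx2; Du2; Dzeta]] w ->
  (forall v, subseq v w -> v != w -> phi (pi (word_eval xD v)) = 0) ->
  hit (phi \o pi) (word_eval xD w) =
    phi (pi (word_eval xD w)) *: xD Dg ^+ count_mem Dx2 w.
Proof.
elim: w phi => [|i w IH] phi phi_lin.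
  by move=> _ _; rewrite /word_eval big_nil (hit1 (pi_fun_lin phi_lin)) expr0.
move=> /andP[ii ww] Hv; rewrite /word_eval big_cons -/(word_eval xD w).
rewrite hit_letter // IH //; last first.
  move=> v vw _; apply: Hv; first by apply: (subseq_trans vw); apply: subseq_cons.
  by apply: contraTneq vw => ->; apply/negP => /size_subseq /=; rewrite ltnn.
rewrite (Hv w (subseq_cons _ _)) ?scale0r ?mulr0 ?add0r; last first.
  by apply/eqP => /(congr1 size)/eqP /=; rewrite eqn_leq ltnn andbF.
rewrite IH //.
- rewrite -rmorphM linearZ /= sgn_homog0; last exact: (homogX _ (D_hom Dg)).
  rewrite -scalerAr; congr (_ *: _).
  by case: i ii {Hv}; rewrite // ?add0n ?mul1r // add1n exprS.
- by move=> z a b; rewrite mulrDr -scalerAr phi_lin.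
move=> v vw vw'; rewrite -rmorphM.
have -> : xD i * word_eval xD v = word_eval xD (i :: v) by rewrite /word_eval big_cons.
apply: Hv; first by rewrite /= eqxx.
by rewrite eqseq_cons eqxx.
Qed.

Let pbw_letters t : all [in [:: Dx2; Du2; Dzeta]] (pbw t).
Proof. by rewrite /pbw /pbw_word !all_cat !all_nseq !orbT. Qed.

Let subseq_pbw v t : subseq v (pbw t) -> exists t', v = pbw t'.
Proof.
have mask_nseq (T : eqType) (a : T) b n :
    exists2 n', (n' <= n)%N & mask b (nseq n a) = nseq n' a.
  elim: n b => [|n IH] [|[] b]; try by exists 0%N.
    by have [n' le E] := IH b; exists n'.+1; rewrite //= E.
  by have [n' le E] := IH b; exists n'; rewrite //= (leq_trans le).
case: t => [[l j] i]; rewrite /pbw /pbw_word /= => /subseqP[b sz ->].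
rewrite !size_cat !size_nseq in sz.
rewrite -(cat_take_drop l b) mask_cat; last first.
  by rewrite size_take sz size_nseq; case: ltngtP (leq_addr (j + i) l).
set b' := drop l b; have sz' : size b' = (j + i)%N by rewrite size_drop sz addKn.
rewrite -(cat_take_drop j b') mask_cat; last first.
  by rewrite size_take sz' size_nseq; case: ltngtP (leq_addr i j).
have [l' l'l ->] := mask_nseq _ Dx2 (take l b) l.
have [j' j'j ->] := mask_nseq _ Du2 (take j b') j.
have [i' i'i ->] := mask_nseq _ Dzeta (drop j b') i.
by exists (Ordinal (leq_ltn_trans l'l (ltn_ord l)), Ordinal (leq_ltn_trans j'j (ltn_ord j)),
  Ordinal (leq_ltn_trans i'i (ltn_ord i))).
Qed.

Let hit_coinv (phi : U -> k) c : scalar phi -> tmap id pi (comul c) = c ⊗ 1 ->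
  hit (phi \o pi) c = phi 1 *: c.
Proof.
move=> pl cc; rewrite -(contractE pl c 1) -cc hit.unlock.
have [Hl Hr] := contract_bil D pl.
by apply: esym; apply: tlift_tmap => //; exact: linearP.
Qed.

(** The coordinate functional at the image of a longest nonempty word [w] with nonzero
    coefficient [r] sends [c] to [r g^l] by [hit_word], and to [phi(1) c = 0] because
    [c] is coinvariant. As [g] is invertible, there is no such word. *)
Lemma coinv_iota c : tmap id pi (comul c) = c ⊗ 1 -> exists a, iota a = c.
Proof.
move=> cc; have [f cE] := pbw_span c.
pose P t := (pbw t != [::]) && (iota (f t) != 0).
have [t1 Pt1|noP] := pickP P; last first.
  exists (\sum_(t | pbw t == [::]) f t); rewrite cE rmorph_sum big_mkcond.
  apply: eq_bigr => t _; case: eqP => [e|ne].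
    by rewrite e /word_eval big_nil mulr1.
  have := noP t; rewrite /P; move/eqP: ne => -> /=; move/negbFE/eqP => ->.
  by rewrite mul0r.
case: (arg_maxnP (fun t => size (pbw t)) Pt1) => t0 /andP[t0n t00] t0_max.
have [phi [pl phiE]] := pbw_coord t0.
have phi1 : phi 1 = 0.
  have p_gt0 : (0 < p)%N by apply: leq_trans p_gt2.
  have pp_gt0 : (0 < 2 * p)%N by rewrite muln_gt0.
  pose te : pbw_index := (Ordinal pp_gt0, Ordinal pp_gt0, Ordinal p_gt0).
  have := phiE te; rewrite /mU /pbw /pbw_word /= /word_eval big_nil rmorph1 => ->.
  by case: eqP => // e; move: t0n; rewrite -e.
have hl := hit_linear (pi_fun_lin pl).
have phi_word t : P t -> hit (phi \o pi) (word_eval xD (pbw t)) =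
    (t == t0)%:R *: xD Dg ^+ count_mem Dx2 (pbw t).
  move=> Pt; rewrite hit_word // -?phiE // => v vt vne.
  have [t' vE] := subseq_pbw vt; rewrite vE phiE.
  suff /negPf -> : t' != t0 by [].
  apply: contraTneq (t0_max t Pt) => t't0; rewrite -ltnNge -t't0 -vE.
  rewrite ltn_neqAle size_subseq // andbT.
  by have [_ ->] := size_subseq_leqif vt.
have := hit_coinv pl cc; rewrite phi1 scale0r {1}cE (lin_sum hl).
rewrite (bigD1 t0) //= big1 => [|t tt0].
  rewrite addr0 hit_iota // phi_word ?/P ?t0n // eqxx scale1r => e.
  have gu n : xD Dg ^+ n * xD Dg ^+ (p.-1 * n) = 1.
    rewrite -exprD -{1}[n]mul1n -mulnDl add1n -(p_pred p_gt2) exprM.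
    by rewrite (g_p D_def) expr1n.
  move: t00; rewrite -[iota _]mulr1 -(gu (count_mem Dx2 (pbw t0))) mulrA e mul0r.
  by rewrite eqxx.
rewrite hit_iota //; have [Pt|] := boolP (P t).
  by rewrite phi_word // (negPf tt0) scale0r mulr0.
rewrite negb_and negbK => /orP[/eqP ->|/negPn/eqP ->]; last by rewrite mul0r.
by rewrite /word_eval big_nil (hit1 (pi_fun_lin pl)) rmorph1 phi1 scale0r mulr0.
Qed.

Lemma iota_coinv a : tmap id pi (comul (iota a)) = iota a ⊗ 1.
Proof.
have il : linear iota by exact: linearP.
have pl : linear pi by exact: linearP.
have [_ cf _ _] := iota_hopf; rewrite cf.
have idl : linear (@id D) by [].
have el : scalar (@counit k R) by exact: counit_linear.
have t1 := tmap_linear il il; have t2 := tmap_linear idl pl.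
have cl := contract_linear (V := R) el; have tl1 := tens_linl (V := D) (1 : U).
rewrite -[in RHS](contract_counitr a).
apply: (tens_ext (f := fun t => tmap id pi (tmap iota iota t))
  (g := fun t => iota (contract counit t) ⊗ 1)).
- by move=> z s t; apply: etrans (congr1 (tmap id pi) (t1 z s t)) (t2 z _ _).
- move=> z s t; rewrite cl il; exact: tl1.
move=> b d; rewrite (tmapE b d il il) (tmapE _ _ idl pl) (contractE el).
by rewrite pi_iota (linZ il) tensZl tensZr.
Qed.

(** ** The kernel of the projection *)

Let J := in_augmentation_ideal iota.

Let J_D c d : J c -> J d -> J (c + d).
Proof.
move=> [s [Hs ->]] [t [Ht ->]]; exists (s ++ t); split; first by rewrite all_cat Hs.
by rewrite big_cat.
Qed.

Let J_0 : J 0. Proof. by exists [::]; rewrite big_nil. Qed.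

Let J_mul a r : counit r = 0 -> J (a * iota r).
Proof. by move=> r0; exists [:: (a, r)]; rewrite /= r0 eqxx big_seq1. Qed.

(* [D R^+] is a right ideal too. *)
Let J_mulr c d : J c -> J (c * d).
Proof.
move=> Jc; elim/(presented_indr D_pres): d => [|a b|z a||i a].
- by rewrite mulr0.
- by move=> Ha Hb; rewrite mulrDr; apply: J_D.
- move=> [s [Hs E]]; exists [seq (z *: e.1, e.2) | e <- s]; split; first by rewrite all_map.
  by rewrite -scalerAr E big_map scaler_sumr; apply: eq_bigr => e _; rewrite scalerAl.
- by rewrite mulr1.
rewrite mulrA; move: (c * a) => {c Jc} {a} c [s [Hs ->]].
have iota_right a r j : counit r = 0 -> J (a * (iota r * iota (xR j))).
  by move=> r0; rewrite -rmorphM; apply: J_mul; rewrite counitM r0 mul0r.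
(* Applying [pi] to the commutation shows that the correction [r'] has counit 0. *)
have letter_right a r : i \in [:: Dx2; Du2; Dzeta] -> counit r = 0 ->
    J (a * (iota r * xD i)).
  move=> ii r0; have [r' E] := iota_comm r ii.
  rewrite E mulrDr mulrA; apply: J_D; apply: J_mul; first by rewrite counit_sgn.
  have := congr1 pi E; rewrite rmorphD !rmorphM /= !pi_iota counit_sgn r0.
  by rewrite !scale0r mul0r mulr0 add0r => /esym/scal1_inj.
have right a r : counit r = 0 -> J (a * (iota r * xD i)).
  case: i letter_right => letter_right r0; try exact: letter_right.
  - by have := iota_right a r RY1 r0; rewrite iotaE.
  - by have := iota_right a r RY2 r0; rewrite iotaE.
  - by have := iota_right a r RT r0; rewrite iotaE.
rewrite mulr_suml; elim: s Hs => [|[a r] s IH] /=; first by rewrite big_nil.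
case/andP=> /eqP r0 Hs; rewrite big_cons /=; apply: J_D; last exact: IH.
by rewrite -mulrA; apply: right.
Qed.

(** An element of the kernel has coefficients of counit 0 by [pbw_free], so it lies in
    [R^+ D], which is contained in the two-sided ideal [D R^+]. *)
Lemma ker_pi c : pi c = 0 <-> in_augmentation_ideal iota c.
Proof.
split=> [c0|[s [Hs ->]]]; last first.
  rewrite rmorph_sum /= big_seq big1 // => -[a r] /(allP Hs)/eqP /= r0.
  by rewrite rmorphM /= pi_iota r0 scale0r mulr0.
have [f cE] := pbw_span c.
have f0 : forall t, counit (f t) = 0.
  apply: pbw_free; rewrite -[RHS]c0 cE rmorph_sum; apply: eq_bigr => t _.
  by rewrite rmorphM /= pi_iota -scalerAl mul1r.
rewrite cE; apply: (big_ind J) => // t _.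
by apply: J_mulr; rewrite -[iota _]mul1r; apply: J_mul.
Qed.

End Exactness.

(** The even generators come for free: [e = psi_+^2] and [f = - psi_-^2]. *)
Lemma pi_surjective (k : fieldType) (p : nat) (D U : hopfSuperAlgType k)
    (xD : D_gen -> D) (xU : osp_gen -> U) (pi : {lrmorphism D -> U}) :
  p \in [pchar k] -> (2 < p)%N -> is_u_osp p xU ->
  (forall i, pi (xD i) = pi_gen xU i) -> forall u, exists d, pi d = u.
Proof.
move=> p_char p_gt2 U_def piE; have [U_pres _] := U_def.
apply: (presented_ind U_pres) => [|a b [a' <-] [b' <-]|c a [a' <-]||i a [a' <-]].
- by exists 0; rewrite rmorph0.
- by exists (a' + b'); rewrite rmorphD.
- by exists (c *: a'); rewrite linearZ.
- by exists 1; rewrite rmorph1.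
suff [b <-] : exists b, pi b = xU i by exists (b * a'); rewrite rmorphM.
case: i.
- by exists (xD Dx2 ^+ 2); rewrite rmorphXn /= piE /= (U_pp p_char p_gt2 U_def).
- exists (- xD Du2 ^+ 2).
  by rewrite rmorphN rmorphXn /= piE /= sqrrN (U_mm p_char p_gt2 U_def) opprK.
- by exists (xD Dzeta); rewrite piE.
- by exists (xD Dx2); rewrite piE.
- by exists (- xD Du2); rewrite rmorphN /= piE /= opprK.
Qed.

Theorem theorem4p6 (k : closedFieldType) (p : nat)
  (p_char : p \in [pchar k]) (p_gt2 : (2 < p)%N)
  (R D U : hopfSuperAlgType k)
  (xR : R_gen -> R) (xD : D_gen -> D) (xU : osp_gen -> U)
  (R_def : is_R p xR) (D_def : is_D p xD) (U_def : is_u_osp p xU) :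
  exists (iota : {lrmorphism R -> D}) (pi : {lrmorphism D -> U}),
    [/\ hopf_morphism iota, hopf_morphism pi & hopf_exact iota pi].
Proof.
have [iota [iotaE iota_hopf]] := iota_exists p_gt2 R_def D_def.
have [pi [piE pi_hopf]] := pi_exists p_char p_gt2 D_def U_def.
have [rho rhoE] : exists rho : {lrmorphism D -> 'M[k]_6},
    forall i, rho (xD i) = def_rep k i.
  have /D_holdsP rel0 := def_rep_holds p_char p_gt2.
  by case: D_def => D_pres _; apply: (presented_lift D_pres rel0).
have pi_surj := pi_surjective p_char p_gt2 U_def piE.
exists iota, pi; split=> //; split=> //.
- exact: (iota_injective p_char p_gt2 R_def iotaE iota_hopf rhoE).
- exact: (ker_pi p_char p_gt2 R_def D_def U_def iotaE piE).
move=> c; split=> [[a <-]|]; first exact: (iota_coinv p_gt2 R_def iotaE iota_hopf piE).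
exact: (coinv_iota p_char p_gt2 R_def D_def U_def iotaE iota_hopf piE pi_surj).
Qed.
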